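(* Let $\alpha_1,\alpha_2\in(0,1)$, $\lambda_1,\lambda_2>0$, $c_1,c_2\ge 0$ with $c_1+c_2=1$. The probability density function $H(x,t)$ (in $x$) of the inverse mixture tempered stable subordinator $E_{\alpha_1,\lambda_1,\alpha_2,\lambda_2}(t)$ satisfies the time-fractional differential equation $$\frac{\partial}{\partial x}H(x,t)=-c_1\Big(\lambda_1+\frac{\partial}{\partial t}\Big)^{\alpha_1}H(x,t)-c_2\Big(\lambda_2+\frac{\partial}{\partial t}\Big)^{\alpha_2}H(x,t)+c_1\lambda_1^{\alpha_1}H(x,t)+c_2\lambda_2^{\alpha_2}H(x,t)$$ $$-c_1t^{-\alpha_1}M_{1,1-\alpha_1}^{1-\alpha_1}(-\lambda_1t)\,\delta(x)-c_2t^{-\alpha_2}M_{1,1-\alpha_2}^{1-\alpha_2}(-\lambda_2t)\,\delta(x),$$ with $H(x,0)=\delta(x)$.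
   Context: The mixture tempered stable subordinator (MTSS) $S(t)=S_{\alpha_1,\lambda_1,\alpha_2,\lambda_2}(t)$, $t\ge0$, is the nondecreasing Lévy process with $\mathbb{E}(e^{-sS(t)})=e^{-t\phi(s)}$, $s>0$, where $\phi(s)=c_1((s+\lambda_1)^{\alpha_1}-\lambda_1^{\alpha_1})+c_2((s+\lambda_2)^{\alpha_2}-\lambda_2^{\alpha_2})$. Its inverse is $E_{\alpha_1,\lambda_1,\alpha_2,\lambda_2}(t)=\inf\{u>0:S(u)>t\}$; its density $H(x,t)$, $x>0$, has Laplace transform in $t$ equal to $\frac{\phi(s)}{s}e^{-x\phi(s)}$. For $c\ge0$, $\nu\in(0,1)$ the shifted fractional Riemann–Liouville derivative $(c+\frac{\partial}{\partial t})^\nu$ is characterized through the Laplace transform $\mathcal{L}_t$ in $t$ by $$\mathcal{L}_t\Big[\Big(c+\frac{\partial}{\partial t}\Big)^{\nu}f(x,\cdot)\Big](s)=(c+s)^{\nu}\,\mathcal{L}_t[f(x,\cdot)](s)-(c+s)^{\nu-1}f(x,0),\quad s>0,$$ where for $f=H$ the initial value is $H(x,0)=\delta(x)$, with $\delta$ the Dirac delta. $\frac{\partial}{\partial x}H$ is the derivative of the density in $x$ on the half-line. The generalized Mittag-Leffler function is $M^r_{p,q}(z)=\sum_{n=0}^\infty\frac{(r)_n}{\Gamma(pn+q)}\frac{z^n}{n!}$, with $(r)_n=\Gamma(r+n)/\Gamma(r)$. *)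

(* Defs.v *)
From HB Require Import structures.
From mathcomp Require Import all_boot all_order all_algebra.
From mathcomp Require Import all_classical all_reals all_analysis.

Set Implicit Arguments.
Unset Strict Implicit.
Unset Printing Implicit Defensive.

Import Order.TTheory GRing.Theory Num.Theory.
Import numFieldNormedType.Exports.

Local Open Scope classical_set_scope.
Local Open Scope ring_scope.

(** * Subordinators *)

Definition increment d (T : measurableType d) (R : realType)
    (P : probability T R) (S : R -> {RV P >-> R}) (s t : R) : T -> R :=
  fun w => S t w - S s w.

(* Mutual independence of the increments over [tau 0, tau 1], ...,
   [tau (n-1), tau n]; subfamilies are covered by taking B i = setT. *)
Definition independent_increments d (T : measurableType d) (R : realType)
    (P : probability T R) (S : R -> {RV P >-> R}) : Prop :=
  forall (n : nat) (tau : nat -> R), 0 <= tau 0%N ->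
    (forall i, tau i <= tau i.+1) ->
    forall B : nat -> set R, (forall i, measurable (B i)) ->
    (P (\bigcap_(i in `I_n) (increment S (tau i) (tau i.+1) @^-1` B i)) =
     \prod_(i < n) P (increment S (tau i) (tau i.+1) @^-1` B i))%E.

Definition stationary_increments d (T : measurableType d) (R : realType)
    (P : probability T R) (S : R -> {RV P >-> R}) : Prop :=
  forall s h : R, 0 <= s -> 0 <= h ->
    forall B : set R, measurable B ->
    P (increment S s (s + h) @^-1` B) = P (increment S 0 h @^-1` B).

Definition stochastically_continuous d (T : measurableType d) (R : realType)
    (P : probability T R) (S : R -> {RV P >-> R}) : Prop :=
  forall t e : R, 0 <= t -> 0 < e ->
    P [set w | e < `|S s w - S t w|] @[s --> within [set s | 0 <= s] (nbhs t)]
      --> 0%E.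

(* A nondecreasing Levy process, indexed by t >= 0 (the values at t < 0 are
   never used).  The left limits of cadlag paths exist by monotonicity, so
   only right-continuity is recorded. *)
Record subordinator d (T : measurableType d) (R : realType)
    (P : probability T R) (S : R -> {RV P >-> R}) : Prop := {
  sub_start : {ae P, forall w, S 0 w = 0} ;
  sub_indep : independent_increments S ;
  sub_stat : stationary_increments S ;
  sub_stoch : stochastically_continuous S ;
  sub_mono : forall (w : T) (s t : R), 0 <= s -> s <= t -> S s w <= S t w ;
  sub_rcont : forall (w : T) (t : R), 0 <= t ->
    S s w @[s --> t^'+] --> S t w }.

Definition mtss_exponent (R : realType) (a1 l1 a2 l2 c1 c2 s : R) : R :=
  c1 * ((s + l1) `^ a1 - l1 `^ a1) + c2 * ((s + l2) `^ a2 - l2 `^ a2).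

Definition MTSS d (T : measurableType d) (R : realType) (P : probability T R)
    (a1 l1 a2 l2 c1 c2 : R) (S : R -> {RV P >-> R}) : Prop :=
  subordinator S /\
  forall t s : R, 0 <= t -> 0 < s ->
    (\int[P]_w (expR (- s * S t w))%:E =
     (expR (- t * mtss_exponent a1 l1 a2 l2 c1 c2 s))%:E)%E.

(* Real infimum: it is 0 on the event (null for an MTSS) that the path never
   exceeds t. *)
Definition inverse_process d (T : measurableType d) (R : realType)
    (P : probability T R) (S : R -> {RV P >-> R}) (t : R) (w : T) : R :=
  inf [set u | 0 < u /\ t < S u w].

(* H(., t) is the density on the half-line x > 0 of X(t), for every t > 0.
   A density is determined up to null sets only; continuity in x selects the
   version whose pointwise x-derivative can be considered. *)
Record density_family d (T : measurableType d) (R : realType)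
    (P : probability T R) (X : R -> T -> R) (H : R -> R -> R) : Prop := {
  dens_ge0 : forall x t, 0 < x -> 0 < t -> 0 <= H x t ;
  dens_cont : forall x t, 0 < x -> 0 < t -> {for x, continuous (H ^~ t)} ;
  dens_law : forall t, 0 < t -> forall A : set R, measurable A ->
    (P (X t @^-1` A) =
     \int[@lebesgue_measure R]_(x in A `&` `]0%R, +oo[) (H x t)%:E)%E }.

(** * Generalized functions of x on the half-line [0, +oo[ *)

Definition test_function (R : realType) (psi : R -> R) : Prop :=
  (forall (n : nat) (x : R), derivable (derive1n n psi) x 1) /\
  exists b : R, forall x, b < `|x| -> psi x = 0.

(* Functionals on test functions; [is_distribution] is the usual linearity
   and continuity on C_c^oo(R). *)
Definition gfun (R : realType) : Type := (R -> R) -> R.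

Definition is_distribution (R : realType) (u : gfun R) : Prop :=
  (forall (a : R) (f g : R -> R), test_function f -> test_function g ->
     u (fun x => a * f x + g x) = a * u f + u g) /\
  (forall b : R, exists (N : nat) (C : R),
     forall (f : R -> R) (M : R), test_function f ->
       (forall x, b < `|x| -> f x = 0) ->
       (forall (n : nat) (x : R), (n <= N)%N -> `|derive1n n f x| <= M) ->
       `|u f| <= C * M).

Definition delta (R : realType) : gfun R := fun psi => psi 0.

(* The generalized function of a function f given on x > 0. *)
Definition regular (R : realType) (f : R -> R) : gfun R :=
  fun psi => \int[@lebesgue_measure R]_(x in `]0%R, +oo[) (f x * psi x).

Definition locally_integrable_half_line (R : realType) (f : R -> R) : Prop :=
  forall b : R, 0 < b ->
    (@lebesgue_measure R).-integrable `]0%R, b] (fun x => (f x)%:E).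

(** * Laplace transform and shifted fractional derivative in t *)

Definition has_laplace (R : realType) (f : R -> R) (s : R) : Prop :=
  (@lebesgue_measure R).-integrable `]0%R, +oo[
    (fun t => (expR (- s * t) * f t)%:E).

Definition laplace (R : realType) (f : R -> R) (s : R) : R :=
  \int[@lebesgue_measure R]_(t in `]0%R, +oo[) (expR (- s * t) * f t).

(* D = (c + d/dt)^nu f, for a family t |-> f t (t > 0) of generalized functions
   of x with initial value f0.  The Laplace transform in t of such a family is
   taken after pairing in x with a test function. *)
Definition shifted_RL_derivative (R : realType) (c nu : R)
    (f : R -> gfun R) (f0 : gfun R) (D : R -> gfun R) : Prop :=
  (forall t, 0 < t -> is_distribution (D t)) /\
  forall psi : R -> R, test_function psi -> forall s : R, 0 < s ->
    [/\ has_laplace (fun t => f t psi) s,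
        has_laplace (fun t => D t psi) s &
        laplace (fun t => D t psi) s =
          (c + s) `^ nu * laplace (fun t => f t psi) s
          - (c + s) `^ (nu - 1) * f0 psi].

(** * Special functions *)

(* Euler's integral, for z > 0. *)
Definition Gamma (R : realType) (z : R) : R :=
  \int[@lebesgue_measure R]_(x in `]0%R, +oo[) (x `^ (z - 1) * expR (- x)).

Definition rising (R : realType) (r : R) (n : nat) : R :=
  Gamma (r + n%:R) / Gamma r.

Definition mittag_leffler (R : realType) (r p q z : R) : R :=
  limn (series (fun n : nat =>
    rising r n / Gamma (p * n%:R + q) * (z ^+ n / n`!%:R))).

(* Main.v *)
(* The density of the inverse process is H = - dG/dx, where G (x, t) =
   P (S x <= t) has Laplace transform exp (- x phi s) / s in t.  Under the
   Laplace transform in t, - d/dx acts on functions E v (t - S x) as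
   multiplication of the transform of v by phi; hence such a function is C^2 in
   x, up to the boundary x = 0, once f, phi f, phi^2 f and phi^3 f are
   transforms of functions of at most exponential growth, f being that of v.
   For f s = prod_i (s + l_i) ^ (- b_i) this holds when one of the b_i is large.
   Smaller exponents are raised, by at least min_i (1 - a_i), with the identity
   t mu_x = x k * mu_x between the law mu_x of S x and the function k with
   transform phi', which divided by t expresses E v (t - S x) through functions
   of the same kind.  In particular G (., t) is C^2 on [0, +oo[.  Tested against
   psi and integrated by parts in x, both sides of the equation then have
   explicit Laplace transforms in t, which agree; the boundary value H (0+, t)
   has transform phi s / s.  A function whose Laplace transform vanishes is zero
   almost everywhere. *)

Require Import Defs.
From HB Require Import structures.
From mathcomp Require Import all_boot all_order all_algebra.
From mathcomp Require Import all_classical all_reals all_analysis.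
From mathcomp Require Import measurable_realfun ring lra.
Import Order.TTheory GRing.Theory Num.Theory.
Import numFieldNormedType.Exports.
Local Open Scope classical_set_scope.
Local Open Scope ring_scope.
Set Implicit Arguments.
Unset Strict Implicit.
Unset Printing Implicit Defensive.

(** The obstacle is regularity up to [x = 0]: of the law of [S x] only the Laplace transform is
    known, and [phi s] grows like a power of [s], so that a few factors [phi] may turn the transform
    [1 / s] of the Heaviside function into one that no function has. Multiplication by [t] helps
    because it differentiates the transform in [s]: the monomial gains a power of some
    [1 / (s + l_i)], while [exp (- x phi s)] contributes [x phi' s], whose terms
    [(s + l_i) ^ (a_i - 1)] decay as well. For a fixed [t > 0] dividing by [t] afterwards costs
    nothing, but uniformity as [t] tends to 0 is lost; the difference quotients that define the
    boundary value of the density are therefore dominated separately, by a tail estimate for [S x].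
    Fractional derivatives are prescribed through their transforms alone, that is up to null sets of
    [t], and the equation inherits this restriction. Their existence is the second difficulty: [D t]
    must be a distribution at every [t > 0], so the exceptional null set cannot depend on the test
    function. *)

Section integration_helpers.
Context d (T : measurableType d) (R : realType) (mu : {measure set T -> \bar R}).

(** * Integrability by comparison, and dominated convergence for real integrals *)

Lemma ae_eq_integrable (D : set T) (f g : T -> \bar R) : measurable D ->
  measurable_fun D g -> ae_eq mu D f g -> mu.-integrable D f -> mu.-integrable D g.
Proof.
move=> mD mg fg /integrableP[mf fy]; apply/integrableP; split => //.
have <- : (\int[mu]_(x in D) `|f x| = \int[mu]_(x in D) `|g x|)%E; last exact: fy.
apply: ae_eq_integral => //; [exact: measurableT_comp|exact: measurableT_comp|].
exact: ae_eq_abse.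
Qed.

Lemma le_Rintegrable (D : set T) (f g : T -> R) : measurable D ->
  measurable_fun D f -> (forall x, D x -> `|f x| <= g x) ->
  mu.-integrable D (EFin \o g) -> mu.-integrable D (EFin \o f).
Proof.
move=> mD mf fg ig; have mf' : measurable_fun D (EFin \o f) by exact/measurable_EFinP.
apply: (le_integrable mD mf' _ ig) => x Dx /=; rewrite lee_fin.
by rewrite (le_trans (fg x Dx))// ler_norm.
Qed.

Lemma EFin_Rintegral (D : set T) (f : T -> R) : measurable D ->
  mu.-integrable D (EFin \o f) ->
  (\int[mu]_(x in D) f x)%:E = (\int[mu]_(x in D) (f x)%:E)%E.
Proof. by move=> mD h; rewrite /Rintegral fineK//; exact: integrable_fin_num. Qed.

Lemma Rintegral_dominated_cvg (D : set T) (f_ : nat -> T -> R) (f g : T -> R) :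
  measurable D -> (forall n, measurable_fun D (f_ n)) ->
  (forall n x, D x -> `|f_ n x| <= g x) ->
  (forall x, D x -> f_ ^~ x @ \oo --> f x) ->
  mu.-integrable D (EFin \o g) ->
  mu.-integrable D (EFin \o f) /\
  \int[mu]_(x in D) f_ n x @[n --> \oo] --> \int[mu]_(x in D) f x.
Proof.
move=> mD mf_ fg ff ig.
have mf : measurable_fun D f by apply: (measurable_fun_cvg mf_ ff).
have [||||| if_ _ cv] := @dominated_convergence _ _ _ mu D mD
  (fun n x => (f_ n x)%:E) (EFin \o f) (EFin \o g).
- by move=> n; exact/measurable_EFinP.
- exact/measurable_EFinP.
- apply: aeW => x Dx; apply: cvg_EFin; first exact: nearW.
  exact: ff.
- exact: ig.
- by apply: aeW => x n Dx /=; rewrite lee_fin fg.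
split => //; apply: fine_cvg; rewrite EFin_Rintegral//.
Qed.

End integration_helpers.

Arguments ae_eq_integrable {d T R} mu [D] f [g].
Arguments le_Rintegrable {d T R} mu [D f] g.
Arguments Rintegral_dominated_cvg {d T R} mu [D] f_ [f] g.

(** * Affine changes of variable and integrals over the half-line *)

Section affine_change.
Context {R : realType}.
Notation mu := (@lebesgue_measure R).

Lemma measurable_affine (k y : R) :
  measurable_fun [set: measurableTypeR R] (fun t : measurableTypeR R => k * t + y :
      measurableTypeR R).
Proof. by apply: measurable_funD => //; apply: measurable_funM. Qed.

(** The pushforward of Lebesgue measure, rescaled by [k], gives every half-open interval its length,
    and this determines Lebesgue measure. *)
Lemma lebesgue_measure_affine (k y : R) (A : set R) : 0 < k -> measurable A ->
  mu ((fun t : R => k * t + y) @^-1` A) = ((k^-1)%:E * mu A)%E.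
Proof.
move=> k0 mA.
pose m0 : {measure set (measurableTypeR R) -> \bar R} := pushforward mu
  (fun t : measurableTypeR R => k * t + y : measurableTypeR R).
pose m : {measure set (measurableTypeR R) -> \bar R} :=
  mscale (NngNum (ltW k0)) (m0 (measurable_affine k y)).
have E B : measurable B -> mu B = m B.
  apply: lebesgue_measure_unique => X [[a b] /= ab <-].
  rewrite /m /mscale /m0 /pushforward /=.
  rewrite [X in (_ * mu X)%E](_ : _ = `](a - y) / k, (b - y) / k]%classic); last first.
    apply/seteqP; split => t /=; rewrite !in_itv/= ltr_pdivrMr// ler_pdivlMr//;
    by rewrite ltrBlDr lerBrDr mulrC.
  rewrite !lebesgue_measure_itv/= !lte_fin ltr_pM2r ?invr_gt0// ltrD2r.
  case: ifPn => _; last by rewrite mule0.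
  by rewrite -!EFinD -EFinM; congr EFin; field; rewrite gt_eqF.
rewrite [in RHS]E// /m /mscale /m0 /pushforward /= muleA -EFinM mulVf ?gt_eqF//.
by rewrite mul1e.
Qed.

Lemma ge0_integral_affine (k y : R) (f : R -> \bar R) : 0 < k ->
  measurable_fun setT f -> (forall t, 0 <= f t)%E ->
  (\int[mu]_t f (k * t + y)%R = (k^-1)%:E * \int[mu]_t f t)%E.
Proof.
move=> k0 mf f0.
have k0' : 0 <= k^-1 by rewrite invr_ge0 ltW.
have -> : (\int[mu]_t f (k * t + y)%R =
    \int[pushforward mu (fun t : measurableTypeR R => (k * t + y)%R : measurableTypeR R)]_t f
        t)%E.
  by rewrite (ge0_integral_pushforward (measurable_affine k y)).
rewrite (eq_measure_integral (mscale (NngNum k0') mu)).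
  by rewrite ge0_integral_mscale.
  exact: measurable_affine.
by move=> ? A mA _; exact: lebesgue_measure_affine.
Qed.

Lemma integral_shift (y : R) (f : R -> \bar R) : measurable_fun setT f ->
  (\int[mu]_t f (t - y)%R = \int[mu]_t f t)%E.
Proof.
move=> mf; rewrite [LHS]integralE [RHS]integralE.
have sh (g : R -> \bar R) : measurable_fun setT g -> (forall t, 0 <= g t)%E ->
    (\int[mu]_t g (t - y)%R = \int[mu]_t g t)%E.
  move=> mg g0; have := ge0_integral_affine (-y) ltr01 mg g0.
  by rewrite invr1 mul1e => <-; apply: eq_integral => t _; rewrite mul1r.
congr (_ - _)%E.
  rewrite -[RHS](sh (funepos f))//; last exact: measurable_funepos.
  by apply: eq_integral => x _; rewrite !funeposE.
rewrite -[RHS](sh (funeneg f))//; last exact: measurable_funeneg.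
  by apply: eq_integral => x _; rewrite !funenegE.
Qed.

(** Passing to the whole line makes translation invariance available for functions supported on
    [t >= 0]; the two domains then differ by the null set [{0}] only. *)
Lemma half_line_integral (f : R -> \bar R) :
  measurable_fun setT f -> (forall t, t < 0 -> f t = 0%E) ->
  (\int[mu]_(t in `]0%R, +oo[) f t = \int[mu]_t f t)%E.
Proof.
move=> mf f0; rewrite integral_mkcond; apply: ae_eq_integral => //.
  by apply/(measurable_restrictT _ _).1 => //; exact: measurable_funTS.
exists [set 0]; split => //; first exact: lebesgue_measure_set1.
move=> t /=; apply: contra_notP => t0 _; rewrite patchE; case: ifPn => //.
rewrite notin_setE/= in_itv/= andbT => /negP; rewrite -leNgt => tle.
by rewrite f0// lt_neqAle tle andbT; apply/eqP.
Qed.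

Lemma half_line_integrable (f : R -> R) :
  measurable_fun setT f -> (forall t, t < 0 -> f t = 0) ->
  mu.-integrable `]0%R, +oo[ (EFin \o f) <-> mu.-integrable setT (EFin \o f).
Proof.
move=> mf f0; split; last by move=> h; apply: integrableS h.
move=> /integrableP[_ h]; apply/integrableP; split; first exact/measurable_EFinP.
rewrite -half_line_integral//.
  by apply: measurableT_comp => //; exact/measurable_EFinP.
by move=> t t0 /=; rewrite f0// normr0.
Qed.

End affine_change.

(** * Measurability of integrals depending on a parameter *)

Section parametric_Rintegral.
Context d1 d2 (X : measurableType d1) (Y : measurableType d2) (R : realType).

(** The real integral is the [fine] part of a difference of two nonnegative integrals, each
    measurable in the parameter by Tonelli; parameters with a nonintegrable section receive a
    default value without harm. *)
Lemma measurable_Rintegral2 (m : {sigma_finite_measure set X -> \bar R})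
    (f : X * Y -> R) : measurable_fun setT f ->
  measurable_fun setT (fun y => \int[m]_x f (x, y)).
Proof.
move=> mf; have mEf : measurable_fun setT (EFin \o f) by exact/measurable_EFinP.
rewrite (_ : (fun _ => _) = fine \o (fun y => \int[m]_x (EFin \o f)^\+ (x, y) -
    \int[m]_x (EFin \o f)^\- (x, y))%E); last first.
  by apply/funext => y /=; rewrite /Rintegral integralE; congr (fine (_ - _))%E;
      apply: eq_integral => x _; rewrite ?funeposE ?funenegE.
apply: (measurableT_comp (fine_measurable measurableT)).
apply: emeasurable_funB.
  by apply: (measurable_fun_fubini_tonelli_G (m1 := m)) => //; exact: measurable_funepos.
by apply: (measurable_fun_fubini_tonelli_G (m1 := m)) => //; exact: measurable_funeneg.
Qed.

Lemma measurable_Rintegral1 (m : {sigma_finite_measure set Y -> \bar R})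
    (f : X * Y -> R) : measurable_fun setT f ->
  measurable_fun setT (fun x => \int[m]_y f (x, y)).
Proof.
move=> mf; have mEf : measurable_fun setT (EFin \o f) by exact/measurable_EFinP.
rewrite (_ : (fun _ => _) = fine \o (fun x => \int[m]_y (EFin \o f)^\+ (x, y) -
    \int[m]_y (EFin \o f)^\- (x, y))%E); last first.
  by apply/funext => y /=; rewrite /Rintegral integralE; congr (fine (_ - _))%E;
      apply: eq_integral => x _; rewrite ?funeposE ?funenegE.
apply: (measurableT_comp (fine_measurable measurableT)).
apply: emeasurable_funB.
  by apply: (measurable_fun_fubini_tonelli_F (m2 := m)) => //; exact: measurable_funepos.
by apply: (measurable_fun_fubini_tonelli_F (m2 := m)) => //; exact: measurable_funeneg.
Qed.

End parametric_Rintegral.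

(** * Generalized convolutions and their Laplace transforms *)

Section convolution.
Context {R : realType} d (X : measurableType d)
  (m : {sigma_finite_measure set X -> \bar R}).
Notation mu := (@lebesgue_measure R).

(** The convolution of [v] with the image under [Y] of the measure of density [W]. It is used with
    [W = 1] on a probability space (expectation of a delayed function), with a gamma density and
    [Y = |.|] on the line (convolution of two functions), and on a product space (mixture of such
    expectations). *)
Definition conv (W Y : X -> R) (v : R -> R) (t : R) : R :=
  \int[m]_w (W w * v (t - Y w)).

Lemma measurable_conv (W Y : X -> R) (v : R -> R) :
  measurable_fun setT W -> measurable_fun setT Y -> measurable_fun setT v ->
  measurable_fun setT (conv W Y v).
Proof.
move=> mW mY mv.
apply: (@measurable_Rintegral2 _ _ _ _ _ m (fun p : X * R => W p.1 * v (p.2 - Y p.1))).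
apply: measurable_funM; first exact: (measurableT_comp mW).
by apply: (measurableT_comp mv); apply: measurable_funB => //; exact: (measurableT_comp mY).
Qed.

(** Fubini: with [exp (- s t)] split into [exp (- s Y) exp (- s (t - Y))], translation invariance in
    [t] separates the factors. As [v] may be singular, the convolution integral converges for almost
    every [t] only; the last conclusion keeps track of these [t]. *)
Lemma laplace_conv (W Y : X -> R) (v : R -> R) (s : R) :
  measurable_fun setT W -> measurable_fun setT Y -> measurable_fun setT v ->
  (forall w, 0 <= Y w) -> (forall t, t < 0 -> v t = 0) ->
  m.-integrable setT (fun w => (W w * expR (- s * Y w))%:E) ->
  has_laplace v s ->
  [/\ has_laplace (conv W Y v) s,
      laplace (conv W Y v) s = (\int[m]_w (W w * expR (- s * Y w))) * laplace v s &
      {ae mu, forall t, m.-integrable setT (fun w => (W w * v (t - Y w))%:E)}].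
Proof.
move=> mW mY mv Y0 v0 iW iv.
have mg : measurable_fun setT (fun t : R => expR (- s * t) * v t).
  apply: measurable_funM => //; apply: (measurableT_comp (@measurable_expR R)).
  by apply: measurable_funM.
have g0 t : t < 0 -> expR (- s * t) * v t = 0 by move=> t0; rewrite v0// mulr0.
have ig : mu.-integrable setT (fun t : R => (expR (- s * t) * v t)%:E).
  by apply/half_line_integrable.
pose F := fun p : X * R => W p.1 * (expR (- s * p.2) * v (p.2 - Y p.1)).
have mF : measurable_fun setT F.
  apply: measurable_funM; first exact: (measurableT_comp mW).
  apply: measurable_funM.
    by apply: (measurableT_comp (@measurable_expR R)); apply: measurable_funM.
  apply: (measurableT_comp mv); apply: measurable_funB => //.
  exact: (measurableT_comp mY).
have FE w t : F (w, t) = W w * expR (- s * Y w) * (expR (- s * (t - Y w)) * v (t - Y w)).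
  rewrite /F/= -!mulrA [in RHS](mulrA (expR _) (expR _)) -expRD.
  by congr (_ * (expR _ * _)); ring.
have iF : (m \x mu)%E.-integrable setT (EFin \o F).
  apply/integrable12ltyP; first exact/measurable_EFinP.
  pose K := (\int[mu]_t `|(expR (- s * t) * v t)%:E|)%E.
  have Kfin : K \is a fin_num.
    by rewrite ge0_fin_numE ?integral_ge0//; case/integrableP: ig.
  rewrite (eq_integral (fun w => `|(W w * expR (- s * Y w))%:E| * K)%E); last first.
    move=> w _ /=; rewrite /K.
    rewrite -(integral_shift (Y w) (f := fun t => `|(expR (- s * t) * v t)%:E|)%E); last first.
      by apply: measurableT_comp => //; exact/measurable_EFinP.
    rewrite -ge0_integralZl//.
      by apply: eq_integral => t _; rewrite /= FE normrM EFinM.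
    apply: measurableT_comp => //; apply/measurable_EFinP.
    by apply: (measurableT_comp mg); apply: measurable_funB.
  rewrite -(fineK Kfin) ge0_integralZr//.
  - have Jfin : (\int[m]_x `|(W x * expR (- s * Y x))%:E|)%E \is a fin_num.
      by rewrite ge0_fin_numE ?integral_ge0//; case/integrableP: iW.
    by rewrite -(fineK Jfin) -EFinM ltry.
  - by apply: measurableT_comp => //; case/integrableP: iW.
  - by rewrite lee_fin fine_ge0// integral_ge0.
have aeF : {ae mu, forall t, m.-integrable setT (fun w => (W w * v (t - Y w))%:E)}.
  have := ae_integrable2 iF; apply: filterS => t /=.
  move=> /(integrableZl measurableT (expR (s * t))).
  apply: eq_integrable => // w _; rewrite /F/= -EFinM; congr EFin.
  by rewrite mulrCA (mulrA (expR _)) -expRD mulNr subrr expR0 mul1r.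
have aeE : {ae mu, forall t, setT t -> fubini_G m (EFin \o F) t =
    (expR (- s * t) * conv W Y v t)%:E}.
  move: aeF; apply: (@filterS _ _ (ae_filter_ringOfSetsType mu)) => t it _;
      rewrite /fubini_G /conv -RintegralZl// EFin_Rintegral//.
    by apply: eq_integral => w _; rewrite /F /=; congr EFin; rewrite mulrCA.
  by apply: eq_integrable (integrableZl measurableT (expR (- s * t)) it) => // w _.
have mc : measurable_fun setT (fun t => (expR (- s * t) * conv W Y v t)%:E).
  apply/measurable_EFinP; apply: measurable_funM; last exact: measurable_conv.
  by apply: (measurableT_comp (@measurable_expR R)); apply: measurable_funM.
have mEF : measurable_fun setT (EFin \o F) by exact/measurable_EFinP.
have iG : mu.-integrable setT (fubini_G m (EFin \o F)).
  apply/integrableP; split; first exact: measurable_fubini_G iF.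
  have fin : (\int[mu]_t \int[m]_w `|(EFin \o F) (w, t)| < +oo)%E.
    exact/(integrable21ltyP m mu).
  apply: le_lt_trans fin.
  apply: ge0_le_integral => //.
  - by apply: measurableT_comp => //; exact: measurable_fubini_G iF.
  - by apply: (measurable_fun_fubini_tonelli_G (m1 := m) (abse \o (EFin \o F))) => //=;
      exact: measurableT_comp.
  - move=> t _; apply: le_abse_integral => //.
    exact: (measurableT_comp mEF).
have ic : mu.-integrable setT (fun t => (expR (- s * t) * conv W Y v t)%:E).
  exact: (ae_eq_integrable mu (fubini_G m (EFin \o F)) measurableT mc aeE iG).
have c0 t : t < 0 -> expR (- s * t) * conv W Y v t = 0.
  move=> t0; rewrite /conv (@eq_Rintegral _ _ _ _ _ (cst 0));
      first by rewrite Rintegral_cst// mul0r mulr0.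
  by move=> w _ /=; rewrite v0 ?mulr0// subr_lt0 (lt_le_trans t0).
split => //.
  by apply/half_line_integrable => //; exact/measurable_EFinP.
apply: EFin_inj; rewrite EFinM /laplace.
rewrite EFin_Rintegral//; last first.
  by apply/half_line_integrable => //; exact/measurable_EFinP.
rewrite EFin_Rintegral// EFin_Rintegral//.
rewrite !half_line_integral//; last 3 first.
- exact/measurable_EFinP.
- by move=> t t0; rewrite g0.
- by move=> t t0; rewrite c0.
have <- : (\int[mu]_t fubini_G m (EFin \o F) t =
    \int[mu]_t (expR (- s * t) * conv W Y v t)%:E)%E.
  by apply: ae_eq_integral => //; case/integrableP: iG.
rewrite -(Fubini iF).
have Kfin := integrable_fin_num measurableT ig.
rewrite -(fineK Kfin) -integralZr//.
apply: eq_integral => w _; rewrite fineK//.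
rewrite -(integral_shift (Y w) (f := fun t => (expR (- s * t) * v t)%:E)%E);
    last exact/measurable_EFinP.
rewrite -integralZl//.
  by apply: eq_integral => t _; rewrite /= FE EFinM.
apply/integrableP; split.
  apply/measurable_EFinP; apply: (measurableT_comp mg).
  by apply: measurable_funB.
rewrite (integral_shift (Y w) (f := fun t => `|(expR (- s * t) * v t)%:E|)%E).
  by case/integrableP: ig.
by apply: measurableT_comp => //; exact/measurable_EFinP.
Qed.

End convolution.

(** * Derivative rules in a form that composes as terms *)

Section real_derivatives.
Context {R : realType}.
Implicit Types (f g : R -> R) (x df dg k : R).

Lemma der_cst k x : is_derive x 1 (fun _ : R => k) 0.
Proof. exact: is_derive_cst. Qed.

Lemma der_id x : is_derive x 1 (fun y : R => y) 1.
Proof. exact: is_derive_id. Qed.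

Lemma derD f g x df dg : is_derive x 1 f df -> is_derive x 1 g dg ->
  is_derive x 1 (fun y => f y + g y) (df + dg).
Proof. by move=> hf hg; exact: is_deriveD. Qed.

Lemma derN f x df : is_derive x 1 f df -> is_derive x 1 (fun y => - f y) (- df).
Proof. by move=> hf; exact: is_deriveN. Qed.

Lemma derB f g x df dg : is_derive x 1 f df -> is_derive x 1 g dg ->
  is_derive x 1 (fun y => f y - g y) (df - dg).
Proof. by move=> hf hg; exact: is_deriveB. Qed.

Lemma derM f g x df dg : is_derive x 1 f df -> is_derive x 1 g dg ->
  is_derive x 1 (fun y => f y * g y) (f x * dg + g x * df).
Proof. by move=> hf hg; exact: is_deriveM. Qed.

Lemma derZ f x df k : is_derive x 1 f df -> is_derive x 1 (fun y => k * f y) (k * df).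
Proof. by move=> hf; exact: is_deriveZ. Qed.

Lemma der_comp f g x df dg : is_derive x 1 g dg -> is_derive (g x) 1 f df ->
  is_derive x 1 (fun y => f (g y)) (dg * df).
Proof. by move=> hg hf; have := is_derive1_comp hf hg; rewrite mulrC. Qed.

Lemma der_expR f x df : is_derive x 1 f df ->
  is_derive x 1 (fun y => expR (f y)) (df * expR (f x)).
Proof. by move=> hf; apply: der_comp. Qed.

Lemma der_sum (I : Type) (r : seq I) (F : I -> R -> R) (dF : I -> R) x :
  (forall i, is_derive x 1 (F i) (dF i)) ->
  is_derive x 1 (fun y => \sum_(i <- r) F i y) (\sum_(i <- r) dF i).
Proof.
move=> h; elim: r => [|i r IH].
  by under eq_fun do rewrite big_nil; rewrite big_nil; exact: der_cst.
by under eq_fun do rewrite big_cons; rewrite big_cons; exact: derD.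
Qed.

Lemma der_eq f x df dg : is_derive x 1 f df -> df = dg -> is_derive x 1 f dg.
Proof. by move=> h <-. Qed.

Lemma der_continuous f x df : is_derive x 1 f df -> {for x, continuous f}.
Proof.
by move=> h; apply/differentiable_continuous/derivable1_diffP; apply: ex_derive.
Qed.

Lemma der_derive1 f x df : is_derive x 1 f df -> derivable f x 1 /\ derive1 f x = df.
Proof. by move=> h; split; [exact: ex_derive|rewrite derive1E derive_val]. Qed.

End real_derivatives.

(** * Uniqueness for the Laplace transform *)

Section laplace_uniqueness.
Context {R : realType}.
Notation mu := (@lebesgue_measure R).

Lemma bernoulli_sub (x : R) n : 0 <= x <= 1 -> 1 - n%:R * x <= (1 - x) ^+ n.
Proof.
move=> /andP[x0 x1]; elim: n => [|n IH]; first by rewrite mul0r subr0 expr0.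
rewrite exprS; apply: le_trans (ler_wpM2l _ IH); last by rewrite subr_ge0.
have n0 : 0 <= n%:R :> R by [].
rewrite -natr1; nra.
Qed.

(* The double limit behind Laplace inversion: at [y = 2 `^ (- t / u)] these
   polynomials in [y] converge boundedly to the indicator of [t > u]. *)
Lemma step_poly_cvg1 (y : R) : 0 <= y < 2^-1 ->
  (1 - y ^+ n) ^+ (2 ^ n) @[n --> \oo] --> (1 : R).
Proof.
move=> /andP[y0 y1].
have y1' : y <= 1 by lra.
have h : 1 - (2 * y) ^+ n @[n --> \oo] --> (1 : R).
  rewrite -[X in _ --> X]subr0; apply: cvgB; first exact: cvg_cst.
  by apply: cvg_expr; rewrite ger0_norm; lra.
apply: (squeeze_cvgr _ h (@cvg_cst _ _ _ _ _)).
apply: nearW => n; apply/andP; split.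
  rewrite exprMn -natrX; apply: bernoulli_sub.
  by rewrite exprn_ge0//= exprn_ile1.
by apply: exprn_ile1; rewrite ?subr_ge0 ?exprn_ile1// gerBl exprn_ge0.
Qed.

Lemma step_poly_cvg0 (y : R) : 2^-1 < y <= 1 ->
  (1 - y ^+ n) ^+ (2 ^ n) @[n --> \oo] --> (0 : R).
Proof.
move=> /andP[y0 y1].
have y0' : 0 < y by lra.
have h : (2 * y)^-1 ^+ n @[n --> \oo] --> (0 : R).
  apply: cvg_expr; rewrite ger0_norm ?invr_ge0; last lra.
  by rewrite invf_lt1; lra.
apply: (squeeze_cvgr _ (@cvg_cst _ _ _ _ _) h).
apply: nearW => n; apply/andP; split.
  by apply: exprn_ge0; rewrite subr_ge0 exprn_ile1// ltW.
have z0 : 0 < (2 * y) ^+ n by apply: exprn_gt0; lra.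
have le1 : (1 - y ^+ n) ^+ (2 ^ n) <= expR (- (2 * y) ^+ n).
  rewrite exprMn -natrX -mulrN mulrC expRM_natr.
  apply: lerXn2r; rewrite ?nnegrE ?expR_ge0// ?subr_ge0 ?exprn_ile1 ?(ltW y0')//.
  exact: expR_ge1Dx.
apply: (le_trans le1); rewrite expRN exprVn lef_pV2 ?posrE ?expR_gt0//.
by apply: le_trans (expR_ge1Dx _); rewrite lerDr.
Qed.

(** Values of the transform on an arithmetic progression integrate polynomials in [exp (- r t)]
    against [g = exp (- s1 t) h]. The step polynomials turn them into integrals of [g] over []u,
    +oo[], so every primitive of [g] vanishes. *)
Lemma laplace_unique0 (h : R -> R) (s0 : R) :
  (forall s, s0 < s -> has_laplace h s) ->
  (forall s, s0 < s -> laplace h s = 0) ->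
  {ae mu, forall t, 0 < t -> h t = 0}.
Proof.
move=> ih h0.
(* A point strictly beyond [s0] makes [g] below integrable, and [|g|] then dominates every [J]. *)
pose s1 := s0 + 1.
have s01 : s0 < s1 by rewrite ltrDl.
pose D : set R := `]0, +oo[%classic.
have mD : measurable D by exact: measurable_itv.
have DE t : (t \in D) = (0 < t).
  by apply/idP/idP; rewrite inE /D/= in_itv/= andbT.
pose g t := expR (- s1 * t) * h t.
have ig : mu.-integrable D (EFin \o g) by exact: ih.
have mg : measurable_fun D g by case/integrableP: ig => /measurable_EFinP.
have mexp (p : R) : measurable_fun D (fun t : R => expR (- p * t)).
  by apply: (measurableT_comp (@measurable_expR R)); apply: measurable_funM.
pose J (r p : R) N t := expR (- p * t) * (1 - expR (- r * t)) ^+ N * g t.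
have e1 (r t : R) : 0 <= r -> D t -> 0 <= expR (- r * t) <= 1.
  move=> r0; rewrite /D/= in_itv/= andbT => t0.
  by rewrite expR_ge0 expR_le1 mulNr oppr_le0 mulr_ge0// ltW.
have mJ (r p : R) N : measurable_fun D (J r p N).
  by apply: measurable_funM => //; apply: measurable_funM => //; apply: measurable_funX;
      apply: measurable_funB.
have leJ (r p : R) N t : 0 <= r -> 0 <= p -> D t -> `|J r p N t| <= `|g t|.
  move=> r0 p0 Dt; rewrite /J !normrM ler_piMl//.
  have /andP[a0 a1] := e1 r t r0 Dt; have /andP[b0 b1] := e1 p t p0 Dt.
  have q0 : 0 <= (1 - expR (- r * t)) ^+ N by rewrite exprn_ge0// subr_ge0.
  have q1 : (1 - expR (- r * t)) ^+ N <= 1.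
    by rewrite exprn_ile1 ?subr_ge0// gerBl.
  by rewrite (ger0_norm b0) (ger0_norm q0) mulr_ile1.
have iJ (r p : R) N : 0 <= r -> 0 <= p -> mu.-integrable D (EFin \o J r p N).
  move=> r0 p0; apply: (le_Rintegrable mu (fun t => `|g t|)) => //.
  - exact: mJ.
  - by move=> t Dt; exact: leJ.
  - exact: (integrable_abse ig).
have J0 (r p : R) N : 0 <= r -> 0 <= p -> \int[mu]_(t in D) J r p N t = 0.
  move=> r0; elim: N p => [p p0|N IH p p0].
    rewrite -(h0 (s1 + p)); last by rewrite (lt_le_trans s01)// lerDl.
    apply: eq_Rintegral => t _; rewrite /J /g expr0 mulr1 mulrA -expRD.
    by congr (expR _ * _); ring.
  (* Recursion: [J r p N.+1 = J r p N - J r (p + r) N]. *)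
  rewrite -[RHS]subr0 -[in X in X - _](IH p p0) -(IH (p + r)) ?addr_ge0//.
  rewrite -RintegralB ?iJ ?addr_ge0//; apply: eq_Rintegral => t _.
  rewrite /J opprD mulrDl expRD exprS; ring.
have gu (u : R) : 0 < u -> \int[mu]_(t in `]0, u]) g t = 0.
  move=> u0.
  have l2 : 0 < ln 2 :> R by rewrite ln_gt0// ltr1n.
  (* Then [exp (- r n t) = y ^ n] with [y = 2 ^ (- t / u)], and the threshold [y = 1 / 2] of the
     step polynomials is reached at [t = u]. *)
  pose r n : R := n%:R * (ln 2 / u).
  have r0 n : 0 <= r n by rewrite mulr_ge0// divr_ge0// ltW.
  pose lim t := g t * \1_(`]u, +oo[%classic) t.
  have mlim : measurable_fun D lim.
    by apply: measurable_funM => //; apply: measurable_indic.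
  have JE n t : J (r n) 0 (2 ^ n)%N t = (1 - expR (- (ln 2 / u * t)) ^+ n) ^+ (2 ^ n) * g t.
    rewrite /J oppr0 mul0r expR0 mul1r -expRM_natl; congr ((1 - expR _) ^+ _ * _).
    by rewrite /r; ring.
  have [||||| _ _ cv] := @dominated_convergence _ _ _ mu D mD
    (fun n t => (J (r n) 0 (2 ^ n)%N t)%:E) (EFin \o lim) (fun t => `|g t|%:E).
  - by move=> n; apply/measurable_EFinP; exact: mJ.
  - exact/measurable_EFinP.
  (* At [t = u] the step polynomials tend to [exp (-1)] instead of 0; this point is put into the
     exceptional set. *)
  - exists [set u]; split => //; first exact: lebesgue_measure_set1.
    move=> t; apply: contra_notP => /= tu Dt.
    have t0 : 0 < t by move: Dt; rewrite /D/= in_itv/= andbT.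
    apply: cvg_EFin; first by apply: nearW.
    rewrite /comp; under eq_fun do rewrite JE.
    have e2 : 2^-1 = expR (- ln 2) :> R by rewrite expRN lnK// posrE.
    rewrite /lim mulrC; apply: cvgMl.
    have [ut|ut] := ltP u t.
      rewrite indicE mem_set; last by rewrite /= in_itv/= ut.
      apply: step_poly_cvg1; rewrite expR_ge0 e2 ltr_expR ltrN2.
      by rewrite mulrAC ltr_pdivlMr// ltr_pM2l.
    rewrite indicE memNset; last by rewrite /= in_itv/= andbT; apply/negP; rewrite -leNgt.
    apply: step_poly_cvg0; rewrite expR_le1 oppr_le0 mulr_ge0 ?divr_ge0 ?ltW// andbT.
    rewrite e2 ltr_expR ltrN2 mulrAC ltr_pdivrMr// ltr_pM2l// lt_neqAle ut andbT.
    by apply/eqP.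
  - by apply: integrable_abse ig.
  - by apply/aeW => t n Dt /=; rewrite lee_fin leJ.
  have cv0 : (fun n => \int[mu]_(t in D) (J (r n) 0 (2 ^ n)%N t)%:E)%E = cst 0%E.
    by apply/funext => n; rewrite -EFin_Rintegral ?iJ// J0.
  have l0 : (\int[mu]_(t in D) (lim t)%:E = 0)%E.
    move: cv; rewrite [X in X @ _ --> _]cv0 => cv.
    by have := cvg_unique _ cv (@cvg_cst _ _ _ _ _); apply.
  have g0 : \int[mu]_(t in D) g t = 0.
    by rewrite -[RHS](h0 s1).
  have iu : mu.-integrable `]u, +oo[ (EFin \o g).
    apply: integrableS ig => //; apply: subset_itvr; rewrite bnd_simp; exact: ltW.
  have l1 : \int[mu]_(t in `]u, +oo[) g t = 0.
    rewrite /Rintegral; have -> : (\int[mu]_(t in `]u, +oo[) (g t)%:E =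
        \int[mu]_(t in D) (lim t)%:E)%E; last by rewrite l0.
    rewrite integral_mkcond [RHS]integral_mkcond; apply: eq_integral => t _.
    rewrite !patchE /lim indicE; case: ifPn => [|]; rewrite /= ?inE ?notin_setE /=.
      rewrite in_itv/= andbT => ut; rewrite (_ : t \in D = true); last first.
        by apply/mem_set; rewrite /D/= in_itv/= andbT (lt_trans u0).
      by rewrite mulr1.
    by move=> _; case: ifPn => //; rewrite mulr0.
  have := Rintegral_itvB (x := u) ig; rewrite !bnd_simp => /(_ (ltW u0) isT).
  by rewrite l1 g0 sub0r => /eqP; rewrite oppr_eq0 => /eqP.
pose f := g \_ D.
have if_ : mu.-integrable setT (EFin \o f).
  by rewrite -restrict_EFin; apply/integrable_restrict => //=; rewrite setTI.
have locf : locally_integrable setT f.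
  by apply: open_integrable_locally => //; exact: openT.
have ifN y : mu.-integrable `]-oo, y] (EFin \o f) by apply: integrableS if_.
have := FTC1Ny ifN locf.
have F0 x : \int[mu]_(t in `]-oo, x]) f t = 0.
  have [x0|x0] := leP x 0.
    rewrite (@eq_Rintegral _ _ _ _ _ (cst 0)) ?Rintegral_cst ?mul0r//.
    move=> t; rewrite inE/= in_itv/= => tx; rewrite /f patchE DE.
    by rewrite ltNge (le_trans tx x0).
  rewrite -[RHS](gu x x0) [RHS]Rintegral_mkcond [LHS]Rintegral_mkcond.
  apply: eq_Rintegral => t _; rewrite /f !patchE DE.
  have E1 : (t \in (`]-oo, x]%classic : set R)) = (t <= x).
    by apply/idP/idP; rewrite inE/= in_itv.
  have E2 : (t \in (`]0, x]%classic : set R)) = (0 < t) && (t <= x).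
    by apply/idP/idP; rewrite inE/= in_itv.
  by rewrite E1 E2; case: (0 < t); case: (t <= x).
rewrite (_ : (fun x => \int[mu]_(t in `]-oo, x]) f t) = cst 0); last exact/funext.
apply: (@filterS _ _ (ae_filter_ringOfSetsType mu)) => t /= [_] + t0.
rewrite derive1_cst /f patchE DE t0.
by move=> /esym/eqP; rewrite /g mulf_eq0 expR_eq0 => /eqP.
Qed.

End laplace_uniqueness.

(** * Gamma kernels *)

Section gamma_kernel.
Context {R : realType}.
Notation mu := (@lebesgue_measure R).

Lemma measurable_powR_fun (p : R) (D : set R) : measurable_fun D (fun x : R => x `^ p).
Proof. by apply: measurable_funTS; exact: measurable_powR. Qed.

Lemma measurable_expRM (k : R) (D : set R) : measurable_fun D (fun t : R => expR (k * t)).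
Proof. by apply: (measurableT_comp (@measurable_expR R)); apply: measurable_funM. Qed.

Lemma integral_expRN (k : R) : 0 < k ->
  (\int[mu]_(x in `[0%R, +oo[) (expR (- k * x))%:E = (k^-1)%:E)%E.
Proof.
move=> k0; have kn : k != 0 by rewrite gt_eqF.
have dF (x : R) : is_derive x 1 (fun x => - k^-1 * expR (- k * x)) (expR (- k * x)).
  apply: (der_eq (derZ _ (der_expR (derZ _ (der_id _))))).
  by field.
have cF (x : R) : {for x, continuous (fun x : R => - k^-1 * expR (- k * x))}.
  exact: der_continuous (dF x).
rewrite (@ge0_continuous_FTC2y _ _ (fun x => - k^-1 * expR (- k * x)) 0 0).
- by rewrite mulr0 expR0 mulr1 -EFinB sub0r opprK.
- by move=> x _; exact: expR_ge0.
- apply: continuous_subspaceT => x.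
  apply: continuous_comp; last exact: continuous_expR.
  by apply: continuousM => //; exact: cst_continuous.
- rewrite -[X in _ --> X](mulr0 (- k^-1)); apply: cvgMr.
  under eq_fun do rewrite mulNr.
  apply: (cvg_comp (fun x => k * x) (fun x => expR (- x))); last exact: cvgr_expR.
  by apply: gt0_cvgMry => //; exact: cvg_id.
- by move=> x _; exact: (der_derive1 (dF x)).1.
- by apply: cvg_at_right_filter; exact: cF.
- by move=> x _; exact: (der_derive1 (dF x)).2.
Qed.

(** For [p < 1] the integrand is singular at 0. On [[1 / (n + 1), 1]] the antiderivative [x ^ p / p]
    bounds each integral by [1 / p], and monotone convergence passes to the union. *)
Lemma integrable_powR_near0 (p : R) : 0 < p ->
  mu.-integrable `]0%R, 1%R] (fun x => (x `^ (p - 1))%:E).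
Proof.
move=> p0; apply/integrableP; split.
  by apply/measurable_EFinP; exact: measurable_powR_fun.
pose F (n : nat) : set R := `[n.+1%:R^-1, 1]%classic.
have FU : `]0%R, 1%R]%classic = \bigcup_n F n.
  apply/seteqP; split => [x|x [n _]]; rewrite /F /= !in_itv/=.
    move=> /andP[x0 x1]; exists (Num.truncn x^-1) => //=; rewrite in_itv/= x1 andbT.
    by rewrite invf_ple ?posrE// ltW// truncnS_gt.
  by move=> /andP[nx ->]; rewrite andbT; apply: lt_le_trans nx; rewrite invr_gt0.
have bound n : (\int[mu]_(x in F n) `|(x `^ (p - 1))%:E| <= (p^-1)%:E)%E.
  have n0 : 0 < n.+1%:R^-1 :> R by rewrite invr_gt0.
  under eq_integral do rewrite gee0_abs ?lee_fin ?powR_ge0//.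
  case: n n0 => [|n] n0.
    rewrite /F invr1 set_itv1 integral_set1 lee_fin invr_ge0 ltW//.
  have n1 : n.+2%:R^-1 < 1 :> R by rewrite invf_lt1// ltr1n.
  have dF (x : R) : 0 < x -> is_derive x 1 (fun x => p^-1 * x `^ p) (x `^ (p - 1)).
    move=> x0; apply: (der_eq (derZ _ (is_derive1_powR _ x0))).
    by rewrite mulrA mulVf ?mul1r// gt_eqF.
  have cF (x : R) : 0 < x -> {for x, continuous (fun x => p^-1 * x `^ p)}.
    by move=> x0; exact: der_continuous (dF x x0).
  rewrite (@continuous_FTC2 _ _ (fun x => p^-1 * x `^ p))//.
  - rewrite powR1 mulr1 -EFinB lee_fin gerBl mulr_ge0 ?powR_ge0// invr_ge0 ltW//.
  - apply: derivable_within_continuous => x; rewrite in_itv/= => /andP[nx _].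
    by apply: derivable_powR; rewrite in_itv/= andbT (lt_le_trans n0).
  - split.
    + move=> x; rewrite in_itv/= => /andP[nx _].
      exact: (der_derive1 (dF x (lt_trans n0 nx))).1.
    + by apply: cvg_at_right_filter; exact: cF.
    + by apply: cvg_at_left_filter; exact: cF.
  - move=> x; rewrite in_itv/= => /andP[nx _].
    exact: (der_derive1 (dF x (lt_trans n0 nx))).2.
apply: (@le_lt_trans _ _ (p^-1)%:E); last exact: ltry.
rewrite FU.
have cv : (\int[mu]_(x in F i) `|(x `^ (p - 1))%:E|)%E @[i --> \oo] -->
    (\int[mu]_(x in \bigcup_i F i) `|(x `^ (p - 1))%:E|)%E.
  apply: (@ge0_nondecreasing_set_cvg_integral _ (measurableTypeR R)) => //.
  - move=> m n mn; apply/subsetPset => x; rewrite /F/= !in_itv/= => /andP[mx ->].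
    by rewrite andbT; apply: le_trans mx; rewrite lef_pV2 ?posrE// ler_nat.
  - by move=> i; exact: measurable_itv.
  - by move=> i; apply: measurableT_comp => //; apply/measurable_EFinP;
      exact: measurable_powR_fun.
rewrite -(cvg_lim _ cv)//; apply: lime_le; last exact: nearW.
by apply/cvg_ex; eexists; exact: cv.
Qed.

(** The term of order [n > |p|] of the exponential series at [x / 2] dominates the power. Against
    [exp (- x)] this leaves the integrable [exp (- x / 2)]. *)
Lemma powR_le_expR (p : R) : exists2 C : R, 0 <= C & forall x, 1 <= x ->
    x `^ p <= C * expR (2^-1 * x).
Proof.
pose n := (Num.truncn `|p|).+1.
exists (n`!%:R * 2 ^+ n); first by rewrite mulr_ge0.
move=> x x1; have x0 : 0 <= x by rewrite (le_trans _ x1).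
apply: (@le_trans _ _ (x `^ n%:R)).
  by apply: ler_powR => //; rewrite (le_trans (ler_norm p))// ltW// truncnS_gt.
rewrite powR_mulrn// -mulrA -ler_pdivrMl ?ltr0n ?fact_gt0//.
rewrite -ler_pdivrMl ?exprn_gt0//.
have h : 0 <= 2^-1 * x by rewrite mulr_ge0.
have := expR_ge1Dxn (Num.truncn `|p|) h; rewrite -/n exprMn => /(le_trans _); apply.
have -> : 2 ^- n * (n`!%:R^-1 * x ^+ n) = 2^-1 ^+ n * x ^+ n / n`!%:R.
  by rewrite exprVn; ring.
by rewrite lerDr.
Qed.

Lemma integrable_Gamma (p : R) : 0 < p ->
  mu.-integrable `]0%R, +oo[ (fun x => (x `^ (p - 1) * expR (- x))%:E).
Proof.
move=> p0.
have mf D : measurable_fun D (fun x : R => x `^ (p - 1) * expR (- x)).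
  apply: measurable_funM; first exact: measurable_powR_fun.
  by apply: (measurableT_comp (@measurable_expR R)); exact: measurable_funN.
have -> : `]0%R, +oo[%classic = `]0%R, 1%R] `|` `]1%R, +oo[ :> set R.
  by rewrite -itv_bndbnd_setU// bnd_simp.
have [C C0 CP] := powR_le_expR (p - 1).
have i1 : mu.-integrable `]0%R, 1%R] (fun x => (x `^ (p - 1) * expR (- x))%:E).
  apply: (le_Rintegrable mu (fun x => x `^ (p - 1))) => //; last exact: integrable_powR_near0.
  - exact: mf.
  - move=> x /=; rewrite in_itv/= => /andP[x0 x1].
  rewrite ger0_norm ?mulr_ge0 ?powR_ge0 ?expR_ge0// ler_piMr ?powR_ge0//.
  by rewrite expR_le1 oppr_le0 ltW.
have i2 : mu.-integrable `]1%R, +oo[ (fun x => (x `^ (p - 1) * expR (- x))%:E).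
  apply: (le_Rintegrable mu (fun x => C * expR (- 2^-1 * x))) => //.
  - exact: mf.
  - move=> x /=; rewrite in_itv/= andbT => x1.
    rewrite ger0_norm ?mulr_ge0 ?powR_ge0 ?expR_ge0//.
    apply: (le_trans (ler_wpM2r (expR_ge0 _) (CP x (ltW x1)))).
    rewrite -mulrA -expRD le_eqVlt; apply/orP; left; apply/eqP.
    by congr (_ * expR _); field.
  - apply: (@integrableZl _ _ _ mu _ _ C (fun x => (expR (- 2^-1 * x))%:E)) => //.
  apply: (@integrableS _ _ _ mu `[0%R, +oo[) => //.
    by apply: subset_itvr; rewrite bnd_simp.
  apply/integrableP; split; first by apply/measurable_EFinP; exact: measurable_expRM.
  under eq_integral do rewrite gee0_abs ?lee_fin ?expR_ge0//.
  by rewrite integral_expRN ?ltry// invr_gt0.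
apply/integrableP; split; first by apply/measurable_EFinP; exact: mf.
rewrite ge0_integral_setU//.
- by apply: lte_add_pinfty; [case/integrableP: i1|case/integrableP: i2].
- by apply: measurableT_comp => //; apply/measurable_EFinP; exact: mf.
- apply/disj_setPS => x /= []; rewrite !in_itv/= andbT => /andP[_ x1] x2.
  by move: (lt_le_trans x2 x1); rewrite ltxx.
Qed.

Lemma Gamma_gt0 (p : R) : 0 < p -> 0 < Gamma p.
Proof.
move=> p0; have ig := integrable_Gamma p0.
have g0 : 0 <= Gamma p.
  by apply: Rintegral_ge0 => x _; rewrite mulr_ge0 ?powR_ge0 ?expR_ge0.
rewrite lt_neqAle g0 andbT eq_sym; apply/eqP => G0.
have : (\int[mu]_(x in `]0%R, +oo[) `|(x `^ (p - 1) * expR (- x))%:E| = 0)%E.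
  under eq_integral do rewrite gee0_abs ?lee_fin ?mulr_ge0 ?powR_ge0 ?expR_ge0//.
  by rewrite -EFin_Rintegral// -/(Gamma p) G0.
move/ae_eq_integral_abs => []//; first by case/integrableP: ig.
move=> N [mN N0 sN].
have : (mu (`]0%R, +oo[%classic : set R) <= mu N)%E.
  apply: le_measure; rewrite ?inE//.
  move=> x x0; apply: sN => /= /(_ x0) [] /eqP.
  rewrite mulf_eq0 expR_eq0 orbF powR_eq0 => /andP[/eqP x00 _].
  by move: x0; rewrite /= in_itv/= x00 ltxx.
by rewrite N0 lebesgue_measure_itv/= ltry leNgt lt0y.
Qed.

(** The tempered gamma kernel, with transform [(s + l) ^ (- p)]. For [p = 1 - a] it is the
    coefficient [t ^ (- a) M (- l t)] of the Dirac term in the equation, by [mittag_leffler_exp]. *)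
Definition gker (p l t : R) : R :=
  if 0 < t then t `^ (p - 1) * expR (- l * t) / Gamma p else 0.

Lemma gker_ge0 (p l t : R) : 0 < p -> 0 <= gker p l t.
Proof.
move=> p0; rewrite /gker; case: ifPn => // _.
by rewrite divr_ge0 ?mulr_ge0 ?powR_ge0 ?expR_ge0// ltW// Gamma_gt0.
Qed.

Lemma measurable_gker (p l : R) : measurable_fun setT (gker p l).
Proof.
apply: measurable_fun_ifT => //; first exact: measurable_fun_ltr.
apply: measurable_funM => //; apply: measurable_funM; first exact: measurable_powR_fun.
exact: measurable_expRM.
Qed.

(** The substitution [u = (s + l) t] reduces the transform to Euler's integral. *)
Lemma laplace_gker (p l s : R) : 0 < p -> 0 < s + l ->
  has_laplace (gker p l) s /\ laplace (gker p l) s = (s + l) `^ (- p).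
Proof.
move=> p0 sl0; have Gp := Gamma_gt0 p0; have ig := integrable_Gamma p0.
pose f (u : R) := if 0 < u then u `^ (p - 1) * expR (- u) else 0.
have mf : measurable_fun setT f.
  apply: measurable_fun_ifT => //; first exact: measurable_fun_ltr.
  apply: measurable_funM; first exact: measurable_powR_fun.
  by apply: (measurableT_comp (@measurable_expR R)); exact: measurable_funN.
have f0 u : 0 <= f u.
  by rewrite /f; case: ifPn => // _; rewrite mulr_ge0 ?powR_ge0 ?expR_ge0.
have fG : (\int[mu]_u (f u)%:E = (Gamma p)%:E)%E.
  rewrite EFin_Rintegral// -half_line_integral; last 2 first.
  - exact/measurable_EFinP.
  - by move=> t t0; rewrite /f ltNge ltW.
  by apply: eq_integral => x; rewrite inE/= in_itv/= andbT /f => ->.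
pose h t := expR (- s * t) * gker p l t.
have hE t : h t = ((s + l) `^ (p - 1) * Gamma p)^-1 * f ((s + l) * t + 0).
  rewrite /h /gker /f addr0 pmulr_rgt0//; case: ifPn => t0; last by rewrite !mulr0.
  rewrite powRM ?ltW// (_ : - ((s + l) * t) = - s * t + - l * t); last by ring.
  by rewrite expRD; field; rewrite !gt_eqF ?powR_gt0.
have mh : measurable_fun setT h.
  by apply: measurable_funM; [exact: measurable_expRM|exact: measurable_gker].
have h0 t : t < 0 -> h t = 0 by move=> t0; rewrite /h /gker ltNge ltW// mulr0.
have hge0 t : 0 <= h t by rewrite mulr_ge0 ?expR_ge0 ?gker_ge0.
have hI : (\int[mu]_t (h t)%:E = ((s + l) `^ (- p))%:E)%E.
  under eq_integral do rewrite hE EFinM.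
  have k0 : 0 <= ((s + l) `^ (p - 1) * Gamma p)^-1.
    by rewrite invr_ge0 mulr_ge0 ?powR_ge0 ?ltW.
  rewrite ge0_integralZl_EFin//; last 2 first.
  - by move=> t _; rewrite lee_fin.
  - apply/measurable_EFinP; apply: (measurableT_comp mf).
    exact: measurable_affine.
  have mEf : measurable_fun setT (EFin \o f) by exact/measurable_EFinP.
  have f0E t : (0 <= (EFin \o f) t)%E by rewrite lee_fin.
  rewrite (ge0_integral_affine 0 sl0 mEf f0E).
  rewrite [X in (_ * (_ * X))%E]fG -!EFinM; congr EFin.
  rewrite powRN -(mulr_powRB1 (ltW sl0) p0).
  by field; rewrite !gt_eqF ?powR_gt0.
have ih : mu.-integrable setT (EFin \o h).
  apply/integrableP; split; first exact/measurable_EFinP.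
  under eq_integral do rewrite /= ger0_norm//.
  by rewrite hI ltry.
split; first by apply/half_line_integrable.
rewrite /laplace /Rintegral half_line_integral ?hI//; first exact/measurable_EFinP.
by move=> t t0; rewrite -/(h t) h0.
Qed.

End gamma_kernel.

(** * Causal functions and convolutions *)

Section causal_functions.
Context {R : realType}.
Notation mu := (@lebesgue_measure R).

Lemma laplace_lin (k : R) (f g : R -> R) (s : R) :
  has_laplace f s -> has_laplace g s ->
  has_laplace (fun t => k * f t + g t) s /\
  laplace (fun t => k * f t + g t) s = k * laplace f s + laplace g s.
Proof.
move=> hf hg.
have hkf : mu.-integrable `]0%R, +oo[ (fun t => (k * (expR (- s * t) * f t))%:E).
  exact: (@integrableZl _ _ _ mu _ _ k (fun t => (expR (- s * t) * f t)%:E)).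
have E t : expR (- s * t) * (k * f t + g t) =
  k * (expR (- s * t) * f t) + expR (- s * t) * g t by ring.
split.
  apply: (@eq_integrable _ _ _ mu _ _ (fun t => (k * (expR (- s * t) * f t))%:E +
    (expR (- s * t) * g t)%:E)%E) => //; last exact: integrableD.
  by move=> t _; rewrite E EFinD.
rewrite /laplace; under eq_Rintegral do rewrite E.
by rewrite RintegralD// RintegralZl.
Qed.

Lemma eq_laplace (f g : R -> R) (s : R) : (forall t, 0 < t -> f t = g t) ->
  has_laplace f s -> has_laplace g s /\ laplace g s = laplace f s.
Proof.
move=> fg hf; split.
  apply: eq_integrable hf => // t; rewrite inE/= in_itv/= andbT => t0.
  by rewrite fg.
by apply: eq_Rintegral => t; rewrite inE/= in_itv/= andbT => t0; rewrite fg.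
Qed.

(** The growth rate is fixed at [exp t]: nonnegative delays preserve it, so every function built
    below has a transform on the common range [s > 1]. Right-continuity is what promotes equality
    almost everywhere to equality everywhere. *)
Definition causal (v : R -> R) : Prop :=
  [/\ measurable_fun setT v, (forall t, t < 0 -> v t = 0),
      (forall t, v x @[x --> t^'+] --> v t) &
      exists2 C, 0 <= C & forall t, `|v t| <= C * expR t].

Lemma causal_laplace (v : R -> R) (s : R) : causal v -> 1 < s -> has_laplace v s.
Proof.
move=> [mv _ _ [C C0 vC]] s1; rewrite /has_laplace.
apply: (le_Rintegrable mu (fun t => C * expR (- (s - 1) * t))) => //.
- apply: measurable_funM; first exact: measurable_expRM.
  exact: measurable_funTS.
- move=> t _; rewrite normrM ger0_norm ?expR_ge0//.
  apply: (le_trans (ler_wpM2l (expR_ge0 _) (vC t))).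
  rewrite mulrCA -expRD le_eqVlt; apply/orP; left; apply/eqP.
  by congr (_ * expR _); ring.
- apply: (@integrableZl _ _ _ mu _ _ C (fun t => (expR (- (s - 1) * t))%:E)) => //.
  apply: (@integrableS _ _ _ mu `[0%R, +oo[) => //.
    by apply: subset_itvr; rewrite bnd_simp.
  apply/integrableP; split; first by apply/measurable_EFinP; exact: measurable_expRM.
  under eq_integral do rewrite gee0_abs ?lee_fin ?expR_ge0//.
  by rewrite integral_expRN ?ltry// subr_gt0.
Qed.

Lemma causal_lin (k : R) (u v : R -> R) : causal u -> causal v ->
  causal (fun t => k * u t + v t).
Proof.
move=> [mu_ u0 ur [C C0 uC]] [mv v0 vr [D D0 vD]]; split.
- by apply: measurable_funD => //; apply: measurable_funM.
- by move=> t t0; rewrite u0// v0// mulr0 addr0.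
- by move=> t; apply: cvgD => //; apply: cvgMr.
- exists (`|k| * C + D); first by rewrite addr_ge0// mulr_ge0.
  move=> t; rewrite mulrDl (le_trans (ler_normD _ _))// lerD// normrM -mulrA.
  exact: ler_wpM2l.
Qed.

(** The value 1 at [t = 0] is the one compatible with right-continuity, and it makes the function of
    [t - S x] the indicator of [S x <= t], with a weak inequality. *)
Lemma causal_heaviside : causal (fun t : R => if 0 <= t then 1 else 0).
Proof.
split.
- apply: measurable_fun_ifT => //; exact: measurable_fun_ler.
- by move=> t t0; rewrite leNgt t0.
- move=> t; apply: cvg_near_cst; have [t0|t0] := leP 0 t; near=> x.
    have tx : t < x by near: x; exact: nbhs_right_gt.
    by rewrite (le_trans t0 (ltW tx)).
  have x0 : x < 0 by near: x; exact: nbhs_right_lt.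
  by rewrite leNgt x0.
- exists 1 => // t; rewrite mul1r; case: ifPn => t0.
    by rewrite normr1; apply: le_trans (expR_ge1Dx _); rewrite lerDl.
  by rewrite normr0 expR_ge0.
Unshelve. all: by end_near. Qed.

Lemma laplace_heaviside (s : R) : 0 < s ->
  has_laplace (fun t : R => if 0 <= t then 1 else 0) s /\
  laplace (fun t : R => if 0 <= t then 1 else 0) s = s^-1.
Proof.
move=> s0.
have E : (\int[mu]_(x in `]0%R, +oo[) (expR (- s * x))%:E = (s^-1)%:E)%E.
  rewrite integral_itv_obnd_cbnd ?integral_expRN//.
  by apply/measurable_EFinP; exact: measurable_expRM.
have EE (t : R) : 0 < t -> expR (- s * t) * (if 0 <= t then 1 else 0) = expR (- s * t).
  by move=> t0; rewrite ltW// mulr1.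
split; last first.
  rewrite /laplace /Rintegral -[RHS](congr1 fine E); congr fine; apply: eq_integral => t.
  by rewrite inE/= in_itv/= andbT => /EE ->.
apply: (@eq_integrable _ _ _ mu _ (measurable_itv _) (fun x => (expR (- s * x))%:E)).
  by move=> t; rewrite inE/= in_itv/= andbT => /EE ->.
apply/integrableP; split; first by apply/measurable_EFinP; exact: measurable_expRM.
under eq_integral do rewrite gee0_abs ?lee_fin ?expR_ge0//.
by rewrite E ltry.
Qed.

(** A nonzero difference at [t] would persist on some []t, t + e[], an interval of positive measure,
    against uniqueness almost everywhere. *)
Lemma right_continuous_unique (f g : R -> R) (s0 : R) :
  (forall t, 0 < t -> f x @[x --> t^'+] --> f t) ->
  (forall t, 0 < t -> g x @[x --> t^'+] --> g t) ->
  (forall s, s0 < s -> [/\ has_laplace f s, has_laplace g s & laplace f s = laplace g s]) ->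
  forall t, 0 < t -> f t = g t.
Proof.
move=> fr gr fg t t0; apply/eqP/negPn/negP => ne.
have ne' : -1 * f t + g t != 0 by rewrite mulN1r addrC subr_eq0 eq_sym.
have [N [mN N0 sN]] : {ae mu, forall t, 0 < t -> -1 * f t + g t = 0}.
  apply: (@laplace_unique0 _ _ s0) => s s0s; have [hf hg E] := fg _ s0s.
    exact: (laplace_lin (-1) hf hg).1.
  by rewrite (laplace_lin (-1) hf hg).2 E mulN1r addNr.
have hr : -1 * f x + g x @[x --> t^'+] --> -1 * f t + g t.
  by apply: cvgD; [apply: cvgMr; exact: fr|exact: gr].
have : \forall x \near t^'+, -1 * f x + g x != 0.
  by move/cvgr_neq0 : hr; apply.
move=> [e /= e0 he].
have sub : (`]t, t + e[%classic : set R) `<=` N.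
  move=> x /=; rewrite in_itv/= => /andP[tx xe]; apply: sN => /= /(_ (lt_trans t0 tx)).
  apply/eqP; apply: he => //=.
  by rewrite ltr0_norm ?subr_lt0// opprB ltrBlDl.
have : (mu (`]t, (t + e)%R[%classic : set R) <= mu N)%E by apply: le_measure; rewrite ?inE.
by rewrite N0 lebesgue_measure_itv/= lte_fin ltrDl e0 -EFinD addrC addKr lee_fin leNgt e0.
Qed.

Lemma causal_sum (J : Type) (r : seq J) (k : J -> R) (w : J -> R -> R) :
  (forall i, causal (w i)) -> causal (fun t => \sum_(i <- r) k i * w i t).
Proof.
move=> h; elim: r => [|i r IH].
  under eq_fun do rewrite big_nil.
  have := causal_lin (-1) causal_heaviside causal_heaviside.
  by under eq_fun do rewrite mulN1r addNr.
by under eq_fun do rewrite big_cons; exact: causal_lin.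
Qed.

Lemma laplace_sum (J : Type) (r : seq J) (k : J -> R) (w : J -> R -> R) (s : R) :
  (forall i, has_laplace (w i) s) ->
  has_laplace (fun t => \sum_(i <- r) k i * w i t) s /\
  laplace (fun t => \sum_(i <- r) k i * w i t) s = \sum_(i <- r) k i * laplace (w i) s.
Proof.
move=> h; elim: r => [|i r [IH1 IH2]].
  under eq_fun do rewrite big_nil; rewrite /has_laplace /laplace big_nil.
  split; last first.
    rewrite (@eq_Rintegral _ _ _ _ _ (cst 0)) ?Rintegral_cst ?mul0r// => t _.
    by rewrite mulr0.
  apply: (@eq_integrable _ _ _ mu _ (measurable_itv _) (cst 0%E)).
    by move=> t _; rewrite mulr0.
  exact: integrable0.
under eq_fun do rewrite big_cons; rewrite big_cons -IH2.
exact: laplace_lin.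
Qed.

Lemma cvg_at_right_mul_id (u : R -> R) t : u y @[y --> t^'+] --> u t ->
  y * u y @[y --> t^'+] --> t * u t.
Proof. by move=> h; apply: cvgM => //; apply: cvg_at_right_filter; exact: cvg_id. Qed.

End causal_functions.

(** * Convolution preserves causality *)

Section causal_convolution.
Context {R : realType} d (X : measurableType d)
  (m : {sigma_finite_measure set X -> \bar R}) (W Y : X -> R) (v : R -> R).
Hypothesis mW : measurable_fun setT W.
Hypothesis mY : measurable_fun setT Y.
Hypothesis Y0 : forall w, 0 <= Y w.
Hypothesis iW : m.-integrable setT (fun w => (W w * expR (- 1 * Y w))%:E).
Hypothesis cv : causal v.

(** The delay turns the growth [exp (t - Y)] into the weight [exp (- Y)], for which [W] is
    integrable. This majorant serves for integrability, for dominated convergence in [t] and for the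
    growth bound. *)
Lemma causal_conv_bound : exists2 C, 0 <= C & forall t w,
  `|W w * v (t - Y w)| <= C * expR t * `|W w * expR (- 1 * Y w)|.
Proof.
case: cv => _ _ _ [C C0 vC]; exists C => // t w.
rewrite !normrM [`|expR _|]ger0_norm ?expR_ge0// mulrCA.
apply: ler_wpM2l => //; rewrite -mulrA -expRD mulN1r; exact: vC.
Qed.

Lemma integrable_conv t : m.-integrable setT (fun w => (W w * v (t - Y w))%:E).
Proof.
have [C C0 bd] := causal_conv_bound.
apply: (le_Rintegrable m (fun w => C * expR t * `|W w * expR (- 1 * Y w)|)) => //.
  apply: measurable_funM => //; case: cv => mv _ _ _.
  by apply: (measurableT_comp mv); apply: measurable_funB.
apply: (@integrableZl _ _ _ m _ _ (C * expR t) (fun w => `|W w * expR (- 1 * Y w)|%:E)) => //.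
exact: (integrable_abse iW).
Qed.

Lemma causal_conv : causal (conv m W Y v).
Proof.
have [C C0 bd] := causal_conv_bound.
case: (cv) => mv v0 vr _.
have mt t : measurable_fun setT (fun w => W w * v (t - Y w)).
  apply: measurable_funM => //.
  by apply: (measurableT_comp mv); apply: measurable_funB.
pose K := \int[m]_w `|W w * expR (- 1 * Y w)|.
have iK : m.-integrable setT (EFin \o (fun w => `|W w * expR (- 1 * Y w)|)).
  exact: (integrable_abse iW).
have iCK k : m.-integrable setT (EFin \o (fun w => k * `|W w * expR (- 1 * Y w)|)).
  exact: (@integrableZl _ _ _ m _ _ k (fun w => `|W w * expR (- 1 * Y w)|%:E)).
split.
- exact: measurable_conv.
- move=> t t0; rewrite /conv (@eq_Rintegral _ _ _ _ _ (cst 0)).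
    by rewrite Rintegral_cst// mul0r.
  by move=> w _ /=; rewrite v0 ?mulr0// subr_lt0 (lt_le_trans t0).
- move=> t; apply/cvg_at_rightP => u [ut uc].
  (* Dropping finitely many terms makes the majorant taken at [t + 1] valid for the whole
     sequence. *)
  have [N _ uN] : \forall n \near \oo, u n < t + 1.
    by apply: (cvgr_lt t) => //; rewrite ltrDl.
  rewrite -(cvg_shiftn N).
  apply: (Rintegral_dominated_cvg m (fun n w => W w * v (u (n + N)%N - Y w))
    (fun w => C * expR (t + 1) * `|W w * expR (- 1 * Y w)|) _ _ _ _ _).2 => //.
  + move=> n w _; apply: (le_trans (bd _ _)).
    apply: ler_wpM2r => //; apply: ler_wpM2l => //.
    by rewrite ler_expR ltW//; apply: uN; rewrite /= leq_addl.
  + move=> w _; apply: cvgMr.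
    apply: ((cvg_at_rightP _ _ _).1 (vr (t - Y w))); split.
      by move=> n; rewrite ltrD2r.
    by apply: cvgB; [rewrite (cvg_shiftn N u)|exact: cvg_cst].
- exists (C * K); first by rewrite mulr_ge0// Rintegral_ge0.
  move=> t; rewrite /conv; apply: (le_trans (le_normr_Rintegral _ (integrable_conv t))) => //.
  rewrite mulrAC -RintegralZl//; apply: le_Rintegral => //.
  exact: (integrable_abse (integrable_conv t)).
Qed.

End causal_convolution.

(* The library declares its sigma-finite structure on [m1 \x m2] after the one
   for subprobabilities, which shadows it; hence this copy of the product. *)
Section sigma_finite_product.
Context d1 d2 (T1 : measurableType d1) (T2 : measurableType d2) (R : realType).
Variable m1 : {sigma_finite_measure set T1 -> \bar R}.
Variable m2 : {sigma_finite_measure set T2 -> \bar R}.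

Definition prodm : set (T1 * T2) -> \bar R := (m1 \x m2)%E.

HB.instance Definition _ := Measure.copy prodm (m1 \x m2)%E.

Lemma prodm_sigma_finite : sigma_finite setT prodm.
Proof.
have /sigma_finiteP[F [TF ndF Foo]] := sigma_finiteT m1.
have /sigma_finiteP[G [TG ndG Goo]] := sigma_finiteT m2.
exists (fun n => F n `*` G n).
  rewrite -setXTT TF TG predeqE => -[x y]; split.
    move=> [/= [n _ Fnx] [k _ Gky]]; exists (maxn n k) => //; split.
    - by move: x Fnx; exact/subsetPset/ndF/leq_maxl.
    - by move: y Gky; exact/subsetPset/ndG/leq_maxr.
  by move=> [n _ []/= ? ?]; split; exists n.
move=> k; have [? ?] := Foo k; have [? ?] := Goo k.
split; first exact: measurableX.
by rewrite /prodm product_measure1E// lte_mul_pinfty// ge0_fin_numE.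
Qed.

HB.instance Definition _ :=
  Measure_isSigmaFinite.Build _ _ _ prodm prodm_sigma_finite.

End sigma_finite_product.

(** * Functions of a subordinator *)

Section primitives.
Context {R : realType}.
Notation mu := (@lebesgue_measure R).

(** Integrating from [b < 0] makes 0 an interior point, so that the derivative there is two-sided;
    subtracting the integral up to 0 restores the primitive that vanishes at 0. *)
Lemma primitive_half_line (w : R -> R) (b : R) : b < 0 ->
  (forall x, b - 1 < x -> {for x, continuous w}) ->
  exists W : R -> R, [/\ W 0 = 0, forall x, b < x -> is_derive x 1 W (w x) &
    forall x, 0 <= x -> W x = \int[mu]_(y in `]0, x]) w y].
Proof.
move=> b0 cw.
have iw x : mu.-integrable `[b, x] (EFin \o w).
  apply: continuous_compact_integrable; first exact: segment_compact.
  apply: continuous_in_subspaceT => y; rewrite inE/= in_itv/= => /andP[bY _].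
  by apply: cw; rewrite (lt_le_trans _ bY)// ltrBlDr ltrDl.
exists (fun x => \int[mu]_(y in `[b, x]) w y - \int[mu]_(y in `[b, 0]) w y); split.
- by rewrite subrr.
- move=> x bx.
  have dI : is_derive x 1 (fun z => \int[mu]_(y in `[b, z]) w y) (w x).
    have [||dF dE] := @continuous_FTC1_closed _ w b x (x + 1) _ (iw _) bx.
    + by rewrite ltrDl.
    + by apply: cw; rewrite (lt_trans _ bx)// ltrBlDr ltrDl.
    + by apply: DeriveDef; [exact: dF|rewrite -derive1E; exact: dE].
  by apply: (der_eq (derB dI (der_cst (\int[mu]_(y in `[b, 0]) w y) x))); rewrite subr0.
- move=> x x0; rewrite -(@Rintegral_itvB _ w (BLeft b) (BRight x) 0) ?bnd_simp//.
  exact: ltW.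
Qed.

(** Two continuous derivatives up to the boundary: two-sided derivatives at 0 need values on its
    left, hence an extension of [u] to []-1, +oo[]. *)
Definition C2ext (u : R -> R) : Prop :=
  exists u0 u1 u2 : R -> R,
  [/\ forall x : R, 0 <= x -> u0 x = u x,
      forall x : R, -1 < x -> is_derive x 1 u0 (u1 x),
      forall x : R, -1 < x -> is_derive x 1 u1 (u2 x) &
      forall x : R, -1 < x -> {for x, continuous u2}].

Lemma C2ext_eq (u v : R -> R) : (forall x, 0 <= x -> u x = v x) -> C2ext u -> C2ext v.
Proof.
move=> uv [u0 [u1 [u2 [h0 h1 h2 h3]]]]; exists u0, u1, u2; split => // x x0.
by rewrite h0// uv.
Qed.

Lemma C2ext_lin (k : R) (u v : R -> R) : C2ext u -> C2ext v ->
  C2ext (fun x => k * u x + v x).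
Proof.
move=> [u0 [u1 [u2 [h0 h1 h2 h3]]]] [v0 [v1 [v2 [g0 g1 g2 g3]]]].
exists (fun x => k * u0 x + v0 x), (fun x => k * u1 x + v1 x), (fun x => k * u2 x + v2 x).
split => x x0.
- by rewrite h0// g0.
- exact: (derD (derZ k (h1 x x0)) (g1 x x0)).
- exact: (derD (derZ k (h2 x x0)) (g2 x x0)).
- by apply: cvgD; [apply: cvgMr; exact: h3|exact: g3].
Qed.

Lemma C2ext_mulx (u : R -> R) : C2ext u -> C2ext (fun x => x * u x).
Proof.
move=> [u0 [u1 [u2 [h0 h1 h2 h3]]]].
exists (fun x => x * u0 x), (fun x => x * u1 x + u0 x), (fun x => x * u2 x + u1 x + u1 x).
split => x x0.
- by rewrite h0.
- by apply: (der_eq (derM (der_id x) (h1 x x0))); rewrite mulr1.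
- apply: (der_eq (derD (derM (der_id x) (h2 x x0)) (h1 x x0))).
  by rewrite mulr1.
- have c1 := der_continuous (h2 x x0).
  by apply: cvgD => //; apply: cvgD => //; apply: cvgM; [exact: cvg_id|exact: h3].
Qed.

Lemma C2ext0 : C2ext (fun=> 0).
Proof.
exists (fun=> 0), (fun=> 0), (fun=> 0); split => // x _; [exact: der_cst|exact: der_cst|].
exact: cst_continuous.
Qed.

Lemma C2ext_sum (I : Type) (r : seq I) (k : I -> R) (F : I -> R -> R) :
  (forall i, C2ext (F i)) -> C2ext (fun x => \sum_(i <- r) k i * F i x).
Proof.
move=> h; elim: r => [|i r IH].
  by under eq_fun do rewrite big_nil; exact: C2ext0.
by under eq_fun do rewrite big_cons; exact: C2ext_lin.
Qed.

(** Here [p1] plays the role of [- p0'] and [p2] that of [- p1']. The extension freezes [p2] at its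
    value at 0 for negative arguments, where it stays Lipschitz, and integrates twice. *)
Lemma C2ext_primitives (p0 p1 p2 : R -> R) (L : R) :
  (forall x, 0 <= x -> p0 x = p0 0 - \int[mu]_(y in `]0, x]) p1 y) ->
  (forall x, 0 <= x -> p1 x = p1 0 - \int[mu]_(y in `]0, x]) p2 y) ->
  (forall x y, 0 <= x -> x <= y -> `|p2 y - p2 x| <= L * (y - x)) ->
  C2ext p0.
Proof.
move=> h0 h1 lip.
pose q2 x := p2 (Num.max x 0).
have c2 : continuous q2.
  have L0 : 0 <= L.
    by have := lip 0 1 (lexx 0) ler01; rewrite subr0 mulr1; apply: le_trans.
  have lip' x y : `|q2 y - q2 x| <= L * `|y - x|.
    wlog xy : x y / x <= y.
      move=> H; have [/H//|/ltW/H] := leP x y.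
      by rewrite (distrC (q2 x)) (distrC x).
    rewrite [`|y - x|]ger0_norm ?subr_ge0//.
    apply: (@le_trans _ _ (L * (Num.max y 0 - Num.max x 0))).
      apply: lip; first by rewrite le_max lexx orbT.
      by rewrite ge_max !le_max xy lexx !orbT.
    apply: ler_wpM2l => //; have [x0|x0] := leP x 0; have [y0|y0] := leP y 0.
    + by rewrite subrr subr_ge0.
    + by rewrite subr0 lerDl oppr_ge0.
    + by have := lt_le_trans x0 (le_trans xy y0); rewrite ltxx.
    + by [].
  have L1 : 0 < L + 1 by rewrite ltr_wpDl.
  move=> x; apply/cvgrPdist_le => e e0; near=> y.
  apply: (le_trans (lip' _ _)).
  apply: (@le_trans _ _ ((L + 1) * `|x - y|)).
    by rewrite ler_wpM2r// lerDl.
  rewrite -ler_pdivlMl//; near: y; apply: cvgr_dist_le; first exact: cvg_id.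
  by rewrite mulr_gt0 ?invr_gt0.
(* The inner primitive starts at -2 because the outer one, starting at -1, asks for continuity on
   []-2, +oo[]. *)
have [|W2 [W20 dW2 W2E]] := @primitive_half_line q2 (-2) _ (fun x _ => c2 x).
  by rewrite oppr_lt0.
pose q1 x := p1 0 - W2 x.
have q1E x : 0 <= x -> q1 x = p1 x.
  move=> x0; rewrite /q1 W2E// [RHS]h1//; congr (_ - _); apply: eq_Rintegral => y.
  by rewrite inE/= in_itv/= => /andP[y0 _]; rewrite /q2 max_l// ltW.
have d1 (x : R) : -2 < x -> is_derive x 1 q1 (- q2 x).
  by move=> x2; apply: (der_eq (derB (der_cst (p1 0) x) (dW2 x x2))); rewrite sub0r.
have [||W1 [W10 dW1 W1E]] := @primitive_half_line q1 (-1) _ _.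
- by rewrite oppr_lt0.
- move=> x x1; apply: (der_continuous (d1 x _)).
  by rewrite (le_lt_trans _ x1)// -opprD.
exists (fun x => p0 0 - W1 x), (fun x => - q1 x), q2; split.
- move=> x x0; rewrite W1E// [RHS]h0//; congr (_ - _); apply: eq_Rintegral => y.
  by rewrite inE/= in_itv/= => /andP[y0 _]; rewrite q1E// ltW.
- by move=> x x1; apply: (der_eq (derB (der_cst (p0 0) x) (dW1 x x1))); rewrite sub0r.
- move=> x x1; have x2 : -2 < x by rewrite (lt_trans _ x1)// ltrN2 ltr1n.
  by apply: (der_eq (derN (d1 x x2))); rewrite opprK.
- by move=> x _; exact: c2.
Unshelve. all: by end_near. Qed.

End primitives.

(** * Expectations of delayed causal functions *)

Section subordinated.
Context {R : realType} d (Om : measurableType d) (P : probability Om R)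
  (Y : R -> Om -> R) (phi : R -> R).
Notation mu := (@lebesgue_measure R).
Hypothesis Y0 : forall x w, 0 <= Y x w.
Hypothesis mY : measurable_fun setT (fun p : R * Om => Y p.1 p.2).
Hypothesis YL : forall x s, 0 <= x -> 0 < s ->
  \int[P]_w expR (- s * Y x w) = expR (- x * phi s).

Definition subord (v : R -> R) (x t : R) : R := conv P (cst 1) (Y x) v t.

Let mYx x : measurable_fun setT (Y x).
Proof. exact: (measurableT_comp mY (pair1_measurable x)). Qed.

Lemma integrable_subord_exp x s : 0 <= s ->
  P.-integrable setT (fun w => (cst 1 w * expR (- s * Y x w))%:E).
Proof.
move=> s0; apply: (le_Rintegrable P (cst 1)) => //.
- apply: measurable_funM => //; apply: (measurableT_comp (@measurable_expR R)).
  exact: measurable_funM.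
- move=> w _ /=; rewrite mul1r ger0_norm ?expR_ge0// expR_le1 mulNr oppr_le0.
  exact: mulr_ge0.
- exact: finite_measure_integrable_cst.
Qed.

Lemma causal_subord v x : causal v -> causal (subord v x).
Proof. by move=> cv; apply: causal_conv => //; exact: integrable_subord_exp. Qed.

Lemma laplace_subord v x s : causal v -> 0 <= x -> 1 < s ->
  laplace (subord v x) s = expR (- x * phi s) * laplace v s.
Proof.
move=> cv x0 s1; have s0 : 0 < s by rewrite (lt_trans _ s1).
have [mv v0 _ _] := cv.
have [_ -> _] := @laplace_conv R _ _ P (cst 1) _ _ _ (measurable_cst _) (mYx x) mv (Y0 x) v0
  (integrable_subord_exp x (ltW s0)) (causal_laplace cv s1).
by congr (_ * _); rewrite -YL//; apply: eq_Rintegral => w _; rewrite mul1r.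
Qed.

Lemma integrable_subord v x t : causal v ->
  P.-integrable setT (fun w => (cst 1 w * v (t - Y x w))%:E).
Proof. by move=> cv; apply: integrable_conv => //; exact: integrable_subord_exp. Qed.

Lemma subord_bound v : causal v ->
  exists2 C, 0 <= C & forall x t, `|subord v x t| <= C * expR t.
Proof.
move=> cv; have [mv v0 _ [C C0 vC]] := cv; exists C => // x t.
apply: (le_trans (le_normr_Rintegral _ (integrable_subord x t cv))) => //.
apply: (@le_trans _ _ (\int[P]_w (cst (C * expR t) w))).
  apply: le_Rintegral => //.
  - exact: (integrable_abse (integrable_subord x t cv)).
  - exact: finite_measure_integrable_cst.
  - move=> w _ /=; rewrite mul1r; apply: (le_trans (vC _)); apply: ler_wpM2l => //.
    by rewrite ler_expR gerBl.
have E : fine (P setT) = 1 by rewrite probability_setT.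
by rewrite Rintegral_cst// [X in _ * X]E mulr1.
Qed.

Lemma measurable_subord v t : causal v -> measurable_fun setT (fun x => subord v x t).
Proof.
move=> [mv _ _ _].
apply: (@measurable_Rintegral1 _ _ _ _ _ P (fun p : R * Om => cst 1 p.2 * v (t - Y p.1 p.2))).
apply: measurable_funM => //; apply: (measurableT_comp mv).
by apply: measurable_funB.
Qed.

Notation PW := (prodm mu P).

(** * Integrals over [x] of these expectations against a weight *)

Section mixture.
Variable q : R -> R.
Hypothesis iq : mu.-integrable setT (EFin \o q).
Hypothesis q0 : forall x, x <= 0 -> q x = 0.

Let mq : measurable_fun setT q.
Proof. by case/integrableP: iq => /measurable_EFinP. Qed.

Let mq1 : measurable_fun setT (fun p : R * Om => q p.1).
Proof. exact: (measurableT_comp mq). Qed.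

Lemma integrable_mixture_exp s : 0 <= s ->
  PW.-integrable setT (fun p => (q p.1 * expR (- s * Y p.1 p.2))%:E).
Proof.
move=> s0.
have mf : measurable_fun setT (fun p : R * Om => q p.1 * expR (- s * Y p.1 p.2)).
  apply: measurable_funM => //; apply: (measurableT_comp (@measurable_expR R)).
  exact: measurable_funM.
apply/(integrable12ltyP mu P); first exact/measurable_EFinP.
apply: (@le_lt_trans _ _ (\int[mu]_x `|(q x)%:E|)%E); last by case/integrableP: iq.
apply: ge0_le_integral => //.
- by move=> x _; apply: integral_ge0.
- apply: (measurable_fun_fubini_tonelli_F (m2 := P)
    (abse \o (EFin \o (fun p : R * Om => q p.1 * expR (- s * Y p.1 p.2))))) => //=.
  by apply: measurableT_comp => //; exact/measurable_EFinP.
- by apply: measurableT_comp => //; case/integrableP: iq.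
move=> x _; apply: (@le_trans _ _ (\int[P]_w (cst `|(q x)%:E| w))%E).
  apply: ge0_le_integral => //.
  + apply: measurableT_comp => //; apply/measurable_EFinP.
    exact: (measurableT_comp mf (pair1_measurable x)).
  + move=> w _ /=; rewrite lee_fin normrM ler_piMr// ger0_norm ?expR_ge0// expR_le1.
    by rewrite mulNr oppr_le0 mulr_ge0.
by rewrite integral_cst// [X in (_ * X)%E](probability_setT P) mule1.
Qed.

Lemma mixture_exp s : 0 < s ->
  \int[PW]_p (q p.1 * expR (- s * Y p.1 p.2)) =
  \int[mu]_x (q x * expR (- x * phi s)).
Proof.
move=> s0; rewrite /Rintegral; congr fine.
rewrite -(integral12_prod_meas1 (integrable_mixture_exp (ltW s0))).
apply: eq_integral => x _; rewrite /fubini_F/=.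
(* The exponential formula is available for [x >= 0]; to the left of 0 the weight vanishes. *)
have [x0|x0] := leP x 0.
  rewrite q0// mul0r; under eq_integral do rewrite mul0r.
  by rewrite integral0.
rewrite -(YL (ltW x0) s0) EFinM EFin_Rintegral//; last first.
  apply: eq_integrable (integrable_subord_exp x (ltW s0)) => // w _.
  by rewrite /= mul1r.
rewrite -integralZl//.
apply: eq_integrable (integrable_subord_exp x (ltW s0)) => // w _.
by rewrite /= mul1r.
Qed.

Lemma causal_mixture v : causal v ->
  causal (conv PW (fun p => q p.1) (fun p => Y p.1 p.2) v).
Proof. by move=> cv; apply: causal_conv => //; exact: integrable_mixture_exp. Qed.

(** Stated for functions with a transform rather than for causal ones: the kernel of the fractional
    derivative, to which it is applied, is singular at 0. *)
Lemma laplace_mixture (v : R -> R) (s : R) : measurable_fun setT v -> (forall t, t < 0 ->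
    v t = 0) ->
  has_laplace v s -> 0 < s ->
  [/\ has_laplace (conv PW (fun p => q p.1) (fun p => Y p.1 p.2) v) s,
      laplace (conv PW (fun p => q p.1) (fun p => Y p.1 p.2) v) s =
      (\int[mu]_x (q x * expR (- x * phi s))) * laplace v s &
      {ae mu, forall t, PW.-integrable setT (fun p => (q p.1 * v (t - Y p.1 p.2))%:E)}].
Proof.
move=> mv v0 hv s0; rewrite -mixture_exp//.
by apply: laplace_conv => //; exact: integrable_mixture_exp (ltW s0).
Qed.

Lemma mixture_subord v t : causal v ->
  conv PW (fun p => q p.1) (fun p => Y p.1 p.2) v t = \int[mu]_x (q x * subord v x t).
Proof.
move=> cv; rewrite /conv /Rintegral; congr fine.
have ic := integrable_conv (m := PW) mq1 mY
  (integrable_mixture_exp ler01) cv t.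
rewrite -(integral12_prod_meas1 ic).
apply: eq_integral => x _; rewrite /fubini_F/= EFinM /subord /conv EFin_Rintegral//; last first.
  exact: integrable_subord.
rewrite -integralZl//; last exact: integrable_subord.
by apply: eq_integral => w _; rewrite /cst/= mul1r.
Qed.

End mixture.

End subordinated.

(** * Multiplication by [t] as differentiation of the transform *)

Section laplace_derivative.
Context {R : realType}.
Notation mu := (@lebesgue_measure R).

(** Convolutions ask for a delay that is nonnegative everywhere, whence [|y|]; it agrees with [y]
    where the kernel lives. *)
Lemma gker_exp (p q s : R) : 0 < p -> 0 < s + q ->
  mu.-integrable setT (fun y => (gker p q y * expR (- s * `|y|))%:E) /\
  \int[mu]_y (gker p q y * expR (- s * `|y|)) = (s + q) `^ (- p).
Proof.
move=> p0 sq; have [hg hE] := laplace_gker p0 sq.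
have mW := measurable_gker p q.
have EE y : gker p q y * expR (- s * `|y|) = expR (- s * y) * gker p q y.
  by rewrite /gker; case: ifPn => [y0|_]; rewrite ?mul0r ?mulr0// mulrC (gtr0_norm y0).
have m1 : measurable_fun setT (fun y : R => expR (- s * y) * gker p q y).
  by apply: measurable_funM => //; exact: measurable_expRM.
have z1 t : t < 0 -> expR (- s * t) * gker p q t = 0.
  by move=> t0; rewrite /gker ltNge ltW// mulr0.
have i1 : mu.-integrable setT (EFin \o (fun y : R => expR (- s * y) * gker p q y)).
  exact/half_line_integrable.
split; first by apply: eq_integrable i1 => // y _; rewrite EE.
rewrite -hE /laplace /Rintegral half_line_integral//.
- by under eq_integral do rewrite EE.
- exact/measurable_EFinP.
- by move=> t t0; rewrite z1.
Qed.

Lemma causal_tmul_laplace (u : R -> R) (s : R) : causal u -> 1 < s ->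
  has_laplace (fun t => t * u t) s /\
  is_derive s 1 (laplace u) (- laplace (fun t => t * u t) s).
Proof.
move=> cu s1; have [mu_ u0 _ [C C0 uC]] := cu.
(* The point [s'] below is midway between 1 and [s]. Of the decay [exp (- 2 k t)] that remains there
   against the growth [exp t], one factor [exp (- k t)] absorbs [t] and the other is integrable. *)
pose k := (s - 1) / 4; have k0 : 0 < k by rewrite divr_gt0// subr_gt0.
pose s' := 1 + 2 * k.
have s's : s' < s by rewrite /s' /k; lra.
pose G (t : R) := C * k^-1 * expR (- k * t).
have tk t : 0 <= t -> t * expR (- (2 * k) * t) <= k^-1 * expR (- k * t).
  move=> t0; rewrite (_ : - (2 * k) * t = - k * t + - (k * t)); last by ring.
  rewrite expRD mulrCA mulrC ler_wpM2r ?expR_ge0// expRN ler_pdivrMr ?expR_gt0//.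
  rewrite mulrC ler_pdivlMr// mulrC.
  by apply: le_trans (expR_ge1Dx _); rewrite lerDr.
have bound x t : s' < x -> 0 < t -> `|expR (- x * t) * (t * u t)| <= G t.
  move=> xs t0; rewrite !normrM ger0_norm ?expR_ge0// (ger0_norm (ltW t0)).
  apply: (@le_trans _ _ (expR (- s' * t) * (t * (C * expR t)))).
    apply: ler_pM; rewrite ?expR_ge0 ?mulr_ge0 ?(ltW t0)//.
      by rewrite ler_expR ler_pM2r// lerN2 ltW.
    by rewrite ler_pM2l.
  rewrite /G -mulrA; apply: le_trans (ler_wpM2l C0 (tk t (ltW t0))).
  rewrite le_eqVlt; apply/orP; left; apply/eqP.
  rewrite (_ : - (2 * k) * t = - s' * t + t); last by rewrite /s'; ring.
  by rewrite expRD; ring.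
have iG : mu.-integrable `]0%R, +oo[ (EFin \o G).
  apply: (@integrableZl _ _ _ mu _ _ (C * k^-1) (fun t => (expR (- k * t))%:E)) => //.
  apply: (@integrableS _ _ _ mu `[0%R, +oo[) => //.
    by apply: subset_itvr; rewrite bnd_simp.
  apply/integrableP; split; first by apply/measurable_EFinP; exact: measurable_expRM.
  under eq_integral do rewrite gee0_abs ?lee_fin ?expR_ge0//.
  by rewrite integral_expRN ?ltry.
have mtu : measurable_fun setT (fun t : R => t * u t) by apply: measurable_funM.
have ht : has_laplace (fun t => t * u t) s.
  apply: (le_Rintegrable mu G) => //.
    apply: measurable_funM; first exact: measurable_expRM.
    exact: measurable_funTS.
  by move=> t /=; rewrite in_itv/= andbT => t0; exact: bound.
split => //.
pose f (x t : R) := expR (- x * t) * u t.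
have df (x t : R) : is_derive x 1 (f ^~ t) (- (expR (- x * t) * (t * u t))).
  have h : is_derive x 1 (fun x => - x * t) (- t).
    have -> : (fun x => - x * t) = (fun x => (- t) * x) by apply/funext => y; ring.
    by apply: (der_eq (derZ (- t) (der_id x))); rewrite mulr1.
  have -> : f ^~ t = (fun x => u t * expR (- x * t)) by apply/funext => y; rewrite /f mulrC.
  by apply: (der_eq (derZ (u t) (der_expR h))); ring.
have d1f (x t : R) : partial1of2 f x t = - (expR (- x * t) * (t * u t)).
  by rewrite /partial1of2; exact: (der_derive1 (df x t)).2.
have Is : (`]s', s + 1[%classic : set R) s by rewrite /= in_itv/= s's ltrDl/=.
have if_ x : (`]s', s + 1[%classic : set R) x -> mu.-integrable `]0%R, +oo[ (EFin \o f x).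
  rewrite /= in_itv/= => /andP[sx _]; apply: (causal_laplace cu).
  by apply: lt_trans sx; rewrite ltrDl mulr_gt0.
have dd x t : (`]s', s + 1[%classic : set R) x -> (`]0, +oo[%classic : set R) t ->
    derivable (f ^~ t) x 1 by move=> _ _; exact: (der_derive1 (df x t)).1.
have G0 t : 0 <= G t by rewrite !mulr_ge0 ?expR_ge0 ?invr_ge0// ltW.
have Gb x t : (`]s', s + 1[%classic : set R) x -> (`]0, +oo[%classic : set R) t ->
    `|partial1of2 f x t| <= G t.
  rewrite /= !in_itv/= andbT => /andP[sx _] t0.
  by rewrite d1f normrN; exact: bound.
have mD : measurable (`]0, +oo[%classic : set R) by exact: measurable_itv.
have D1 := @derivable_under_integral R _ _ mu f _ mD _ _ _ Is if_ dd G G0 iG Gb.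
have D2 := @differentiation_under_integral R _ _ mu f _ mD _ _ _ Is if_ dd G G0 iG Gb.
apply: DeriveDef; first exact: D1.
rewrite -derive1E; apply: (eq_trans D2).
rewrite -mulN1r /laplace -RintegralZl//.
by apply: eq_Rintegral => t _; rewrite d1f mulN1r.
Qed.

End laplace_derivative.

(** * Regularity in [x] up to the boundary *)

Section regularity.
Context {R : realType} d (Om : measurableType d) (P : probability Om R)
  (Y : R -> Om -> R) (I : finType) (l a c : I -> R) (i0 : I) (eps : R).
Notation mu := (@lebesgue_measure R).

(** Indexed by a finite type so that an untempered index [i0], with [l i0 = 0], makes [1 / s] one of
    the monomials in the [s + l i]. *)
Definition mix_exponent (s : R) : R := \sum_i c i * ((s + l i) `^ a i - l i `^ a i).
Notation phi := mix_exponent.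

Hypothesis l_ge0 : forall i, 0 <= l i.
Hypothesis l_i0 : l i0 = 0.
Hypothesis a_gt0 : forall i, 0 < a i.
Hypothesis eps_gt0 : 0 < eps.
Hypothesis eps_le1 : eps <= 1.
Hypothesis eps_a : forall i, eps <= 1 - a i.
Hypothesis Y0 : forall x w, 0 <= Y x w.
Hypothesis mY : measurable_fun setT (fun p : R * Om => Y p.1 p.2).
Hypothesis YL : forall x s, 0 <= x -> 0 < s ->
  \int[P]_w expR (- s * Y x w) = expR (- x * phi s).
Notation U := (subord P Y).

Let sl_gt0 (s : R) i : 0 < s -> 0 < s + l i.
Proof. by move=> s0; rewrite ltr_pwDl. Qed.

Definition raise (b : I -> R) (i : I) (x : R) : I -> R :=
  fun k => b k + x * (k == i)%:R.

(** The monomial [prod_i (s + l_i) ^ (- b_i)], as an exponential so that products and logarithmic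
    derivatives become sums. *)
Definition power_product (b : I -> R) (s : R) : R := expR (- \sum_i b i * ln (s + l i)).

Lemma power_product_raise (b : I -> R) i x s : 0 < s ->
  power_product (raise b i x) s = (s + l i) `^ (- x) * power_product b s.
Proof.
move=> s0; rewrite /power_product /raise.
under eq_bigr do rewrite mulrDl.
rewrite big_split/= opprD expRD mulrC; congr (_ * _).
rewrite (bigD1 i)//= eqxx mulr1 big1 ?addr0.
  by rewrite /powR gt_eqF ?sl_gt0// mulNr.
by move=> k /negPf ->; rewrite mulr0 mul0r.
Qed.

Definition represents (v f : R -> R) : Prop :=
  causal v /\ forall s, 1 < s -> laplace v s = f s.

Lemma represents_ext (v f g : R -> R) : (forall s, 1 < s -> f s = g s) -> represents v f ->
    represents v g.
Proof. by move=> fg [cv h]; split => // s s1; rewrite h// fg. Qed.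

Lemma represents_lin k (u v f g : R -> R) : represents u f -> represents v g ->
  represents (fun t => k * u t + v t) (fun s => k * f s + g s).
Proof.
move=> [cu hu] [cv hv]; split; first exact: causal_lin.
move=> s s1; rewrite (laplace_lin k (causal_laplace cu s1) (causal_laplace cv s1)).2.
by rewrite hu// hv.
Qed.

(** A factor [(s + q) ^ (- p)] is a convolution with a gamma kernel. That kernel may be singular at
    0, but its convolution with a causal function is causal. *)
Lemma represents_gamma (p q : R) (v f : R -> R) : 0 < p -> 0 <= q -> represents v f ->
  exists v', represents v' (fun s => (s + q) `^ (- p) * f s).
Proof.
move=> p0 q0 [cv hv]; have [mv v0 _ _] := cv.
have mW := measurable_gker p q.
have mN : measurable_fun setT (fun y : R => `|y|) by exact: normr_measurable.
have E s : 1 <= s -> mu.-integrable setT (fun y => (gker p q y * expR (- s * `|y|))%:E) /\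
    \int[mu]_y (gker p q y * expR (- s * `|y|)) = (s + q) `^ (- p).
  by move=> s1; apply: gker_exp => //; rewrite ltr_pwDl// (lt_le_trans _ s1).
exists (conv mu (gker p q) (fun y : R => `|y|) v); split.
  by apply: causal_conv => //; exact: (E 1 (lexx 1)).1.
move=> s s1; have [iE vE] := E s (ltW s1).
have [_ -> _] := @laplace_conv R _ _ mu _ _ _ _ mW mN mv (fun y => normr_ge0 y)
    v0 iE (causal_laplace cv s1).
by rewrite vE hv.
Qed.

(** One whole factor [1 / s] is split off, which is why [b i0 >= 1] is asked: the construction
    starts from the Heaviside function and adds the remaining factors by gamma convolutions. *)
Lemma represents_power_product (b : I -> R) : (forall k, 0 <= b k) -> 1 <= b i0 ->
  exists v, represents v (power_product b).
Proof.
move=> b0 b1; pose b' := raise b i0 (-1).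
have b'0 k : 0 <= b' k.
  rewrite /b' /raise; case: eqVneq => [->|_]; rewrite ?mulr1 ?mulr0 ?addr0//.
  by rewrite subr_ge0.
have H (r : seq I) : exists v, represents v (fun s => s^-1 * expR (- \sum_(i <- r)
    b' i * ln (s + l i))).
  elim: r => [|i r [v hv]].
    exists (fun t : R => if 0 <= t then 1 else 0); split; first exact: causal_heaviside.
    move=> s s1; rewrite (laplace_heaviside (lt_trans ltr01 s1)).2.
    by rewrite big_nil oppr0 expR0 mulr1.
  have [bi|bi] := eqVneq (b' i) 0.
    exists v; apply: represents_ext hv => s s1.
    by rewrite big_cons bi mul0r add0r.
  have bi0 : 0 < b' i by rewrite lt_neqAle eq_sym bi b'0.
  have [v' hv'] := represents_gamma bi0 (l_ge0 i) hv.
  exists v'; apply: represents_ext hv' => s s1.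
  have s0 : 0 < s by rewrite (lt_trans _ s1).
  have -> : expR (- \sum_(j <- i :: r) b' j * ln (s + l j)) =
      expR (- (b' i * ln (s + l i))) * expR (- \sum_(j <- r) b' j * ln (s + l j)).
    by rewrite big_cons/= -expRD -opprD.
  by rewrite /powR gt_eqF ?sl_gt0// mulNr mulrCA.
have [v hv] := H (index_enum I); exists v; apply: represents_ext hv => s s1.
have s0 : 0 < s by rewrite (lt_trans _ s1).
rewrite -/(power_product b' s) /b' power_product_raise// opprK l_i0 addr0 powRr1 ?ltW//.
by rewrite mulrA mulVf ?mul1r// gt_eqF.
Qed.

(* [phi ^ k * f] is represented for every [k <= n]. *)
Fixpoint represents_iter (n : nat) (f : R -> R) : Prop :=
  (exists v, represents v f) /\
  if n is n'.+1 then represents_iter n' (fun s => phi s * f s) else True.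

Lemma represents_iter_ext n (f g : R -> R) : (forall s, 1 < s -> f s = g s) ->
    represents_iter n f -> represents_iter n g.
Proof.
elim: n f g => [|n IH] f g fg [[v hv] h]; split.
- by exists v; exact: represents_ext hv.
- by [].
- by exists v; exact: represents_ext hv.
- by apply: IH h => s s1; rewrite fg.
Qed.

Lemma represents_iter_lin n k (f g : R -> R) : represents_iter n f -> represents_iter n g ->
    represents_iter n (fun s => k * f s + g s).
Proof.
elim: n f g => [|n IH] f g [[u hu] hf] [[v hv] hg]; split => //.
- by exists (fun t => k * u t + v t); exact: represents_lin.
- by exists (fun t => k * u t + v t); exact: represents_lin.
- apply: (@represents_iter_ext _ (fun s => k * (phi s * f s) + phi s * g s)); last exact: IH.
  by move=> s _; ring.
Qed.

Lemma represents_iter0 n : represents_iter n (fun=> 0).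
Proof.
have r0 : exists v, represents v (fun=> 0).
  have h := conj (@causal_heaviside R)
    (fun (s : R) (s1 : 1 < s) => (laplace_heaviside (lt_trans ltr01 s1)).2).
  exists (fun t : R => -1 * (if 0 <= t then 1 else 0) + (if 0 <= t then 1 else 0)).
  by apply: represents_ext (represents_lin (-1) h h) => s _; rewrite mulN1r addNr.
elim: n => [|n IH]; split => //.
by apply: represents_iter_ext IH => s _; rewrite mulr0.
Qed.

Lemma represents_iter_sum n (r : seq I) (F : I -> R ->
    R) : (forall i, represents_iter n (F i)) ->
  represents_iter n (fun s => \sum_(i <- r) F i s).
Proof.
move=> h; elim: r => [|i r IH].
  by apply: (@represents_iter_ext _ (fun=> 0)); [move=> s _;
      rewrite big_nil|exact: represents_iter0].
apply: (@represents_iter_ext _ (fun s => 1 * F i s + \sum_(j <- r) F j s)).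
  by move=> s _; rewrite big_cons mul1r.
exact: represents_iter_lin.
Qed.

(** Write [(s + l_i) ^ a_i] as [(s + l_i) ^ (a_i - 1)] times [(s + l_j) + (l_i - l_j)].
    Multiplication by [phi] then lowers only the exponent at the chosen [j], by at most 1. The
    closing [+ 0] fits the shape [k f + g] of [represents_iter_lin]. *)
Lemma exponent_power_product (b : I -> R) j s : 0 < s -> phi s * power_product b s =
  \sum_i (c i * power_product (raise (raise b i (1 - a i)) j (-1)) s +
    (c i * (l i - l j) * power_product (raise b i (1 - a i)) s +
     (- (c i * l i `^ a i) * power_product b s + 0))).
Proof.
move=> s0; rewrite /mix_exponent mulr_suml; apply: eq_bigr => i _.
rewrite !power_product_raise// opprK powRr1 ?ltW ?sl_gt0// opprB.
rewrite -[(s + l i) `^ a i](mulr_powRB1 (ltW (sl_gt0 i s0)) (a_gt0 i)).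
ring.
Qed.

(** Each factor [phi] takes at most one unit from [b j]. If [j] is [i0], one more unit is reserved
    for the factor [1 / s] that representability relies on. *)
Lemma represents_iter_power_product n (b : I -> R) j : (forall k, 0 <= b k) -> 1 <= b i0 ->
  n%:R + (j == i0)%:R <= b j -> represents_iter n (power_product b).
Proof.
elim: n b => [|n IH] b b0 b1 bj; first by split => //; exact: represents_power_product.
split; first exact: represents_power_product.
have ai i : 0 <= 1 - a i by rewrite (le_trans (ltW eps_gt0) (eps_a i)).
have ub i : (forall k, b k <= raise b i (1 - a i) k).
  by move=> k; rewrite /raise lerDl mulr_ge0.
have nat1 : n.+1%:R = n%:R + 1 :> R by rewrite -natr1.
have bj' : n%:R + (j == i0)%:R + 1 <= b j by rewrite addrAC -nat1.
apply: (@represents_iter_ext n (fun s => \sum_i (c i * power_product (raise (raise b i (1 - a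
    i)) j (-1)) s +
    (c i * (l i - l j) * power_product (raise b i (1 - a i)) s +
     (- (c i * l i `^ a i) * power_product b s + 0))))).
  by move=> s s1; rewrite (exponent_power_product b j)// (lt_trans _ s1).
apply: represents_iter_sum => i; apply: represents_iter_lin; last apply: represents_iter_lin;
    last apply: represents_iter_lin; last exact: represents_iter0.
- have uk k : b k - (k == j)%:R <= raise (raise b i (1 - a i)) j (-1) k.
    by rewrite /raise mulN1r lerD2r ub.
  apply: IH.
  + move=> k; apply: le_trans (uk k); case: eqVneq => [->|_]; rewrite ?subr0//.
    by rewrite subr_ge0; apply: le_trans bj'; rewrite lerDr addr_ge0.
  + apply: le_trans (uk i0); rewrite eq_sym; case: eqVneq bj' => [->|_ _]; rewrite ?subr0//.
    rewrite lerBrDr => bj'; apply: le_trans bj'; rewrite lerD2r lerDr//.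
  + by apply: le_trans (uk j); rewrite eqxx lerBrDr.
- apply: IH.
  + by move=> k; exact: le_trans (ub i k).
  + exact: le_trans (ub i i0).
  + by apply: le_trans (ub i j); apply: le_trans bj'; rewrite lerDl.
- by apply: IH => //; apply: le_trans bj'; rewrite lerDl.
Qed.

(** In transforms this is [1 - exp (- x phi)] equal to [phi] times the integral of [exp (- y phi)]
    over []0, x]], multiplied by [f]; both sides are causal, so it holds for every [t > 0]. *)
Lemma subord_primitive (v v1 f : R -> R) : represents v f ->
    represents v1 (fun s => phi s * f s) ->
  forall x t, 0 <= x -> 0 < t -> U v x t = U v 0 t - \int[mu]_(y in `]0, x]) U v1 y t.
Proof.
move=> [cv hv] [cv1 hv1] x t x0.
pose q (y : R) : R := \1_(`]0, x]%classic : set R) y.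
have iq : mu.-integrable setT (EFin \o q).
  exact: (integrable_indic_itv 0 x false false).
have q0 y : y <= 0 -> q y = 0.
  by move=> y0; rewrite /q indicE memNset//= in_itv/= ltNge y0.
pose g t := -1 * conv (prodm mu P) (fun p => q p.1) (fun p => Y p.1 p.2) v1 t + U v 0 t.
have cg : causal g.
  by apply: causal_lin; [exact: causal_mixture|exact: causal_subord].
have cU : causal (U v x) by exact: causal_subord.
suff H : forall t, 0 < t -> U v x t = g t.
  move=> t0; rewrite H// /g (mixture_subord P Y0 mY iq)// addrC mulN1r.
  congr (_ - _); rewrite [RHS]Rintegral_mkcond; apply: eq_Rintegral => y _.
  by rewrite patchE /q indicE; case: ifPn => _; rewrite ?mul1r ?mul0r.
apply: (@right_continuous_unique _ _ _ 1).
- by move=> r _; case: cU.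
- by move=> r _; case: cg.
- move=> s s1; have s0 : 0 < s by rewrite (lt_trans _ s1).
  split; [exact: causal_laplace|exact: causal_laplace|].
  have [mv1 v10 _ _] := cv1.
  have [h1 E1 _] := laplace_mixture Y0 mY YL iq q0 mv1 v10 (causal_laplace cv1 s1) s0.
  have cU0 : causal (U v 0) by exact: causal_subord.
  rewrite (laplace_lin (-1) h1 (causal_laplace cU0 s1)).2 E1.
  rewrite !(laplace_subord Y0 mY YL)// hv// hv1// oppr0 mul0r expR0 mul1r.
  suff E : \int[mu]_y (q y * expR (- y * phi s)) * phi s = 1 - expR (- x * phi s).
    by rewrite (mulrA _ (phi s)) E; ring.
  have iE : mu.-integrable `]0, x] (EFin \o (fun y => expR (- y * phi s))).
    apply: (@integrableS _ _ _ mu `[0, x]) => //.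
      by apply: subset_itvr; rewrite bnd_simp.
    apply: continuous_compact_integrable; first exact: segment_compact.
    apply: continuous_subspaceT => y; apply: continuous_comp; last exact: continuous_expR.
    by apply: cvgM; [apply: cvgN; exact: cvg_id|exact: cvg_cst].
  have -> : \int[mu]_y (q y * expR (- y * phi s)) = \int[mu]_(y in `]0, x]) expR (- y * phi s).
    rewrite [RHS]Rintegral_mkcond; apply: eq_Rintegral => y _.
    by rewrite patchE /q indicE; case: ifPn => _; rewrite ?mul1r ?mul0r.
  rewrite -RintegralZr//.
  move: x0; rewrite le_eqVlt => /predU1P[<-|x0].
    by rewrite set_itvoc0 Rintegral_set0 oppr0 mul0r expR0 subrr.
  have dF (y : R) : is_derive y 1 (fun y => - expR (- y * phi s)) (expR (- y * phi s) * phi s).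
    have h : is_derive y 1 (fun y => - y * phi s) (- phi s).
      have -> : (fun y => - y * phi s) = (fun y => (- phi s) * y) by apply/funext => z; ring.
      by apply: (der_eq (derZ _ (der_id y))); rewrite mulr1.
    by apply: (der_eq (derN (der_expR h))); ring.
  have cF (y : R) : {for y, continuous (fun y : R => - expR (- y * phi s))} by exact:
      der_continuous (dF y).
  rewrite /Rintegral integral_itv_obnd_cbnd; last first.
    apply/measurable_EFinP; apply: measurable_funM => //.
    by apply: (measurableT_comp (@measurable_expR R)); apply: measurable_funM => //;
        exact: measurable_funN.
  rewrite (@continuous_FTC2 _ _ (fun y => - expR (- y * phi s)) 0 x)//.
  + by rewrite /= oppr0 mul0r expR0 opprK addrC.
  + apply: continuous_subspaceT => y; apply: cvgM; last exact: cvg_cst.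
    rewrite -[X in _ --> X]opprK.
    rewrite (_ : (fun _ => _) = (fun y : R => - (- expR (- y * phi s))));
        last by apply/funext => z; rewrite opprK.
    by apply: cvgN; exact: cF.
  + split.
    * by move=> y _; exact: (der_derive1 (dF y)).1.
    * by apply: cvg_at_right_filter; exact: cF.
    * by apply: cvg_at_left_filter; exact: cF.
  + by move=> y _; exact: (der_derive1 (dF y)).2.
Qed.

Lemma integrable_cst_itv (k x y : R) : mu.-integrable `]x, y] (EFin \o cst k).
Proof.
have h : mu.-integrable `[x, y] (EFin \o cst k).
  apply: continuous_compact_integrable; first exact: segment_compact.
  by apply: continuous_subspaceT => z; exact: cst_continuous.
by apply: integrableS h => //; apply: subset_itvr; rewrite bnd_simp.
Qed.

(** Three factors [phi] are spent on two derivatives: [U v3] is only known to be measurable and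
    bounded uniformly in [x], and it serves to make [U v2] Lipschitz, hence continuous. *)
Lemma C2ext_represents_iter (v f : R -> R) : represents v f -> represents_iter 3 f ->
  forall t, 0 < t -> C2ext (fun x => U v x t).
Proof.
move=> hv [_ [[v1 h1] [[v2 h2] [[v3 h3] _]]]] t t0.
have [C C0 bd] := subord_bound P Y0 mY h3.1.
have E2 x : 0 <= x -> U v2 x t = U v2 0 t - \int[mu]_(y in `]0, x]) U v3 y t.
  by move=> x0; exact: (subord_primitive h2 h3).
have i3 x : 0 <= x -> mu.-integrable `]0, x] (EFin \o (fun y => U v3 y t)).
  move=> x0; have m3 : measurable_fun `]0, x] (fun y => U v3 y t).
    by apply: measurable_funTS; apply: measurable_subord => //; exact: h3.1.
  have mD : measurable (`]0, x]%classic : set R) by exact: measurable_itv.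
  exact: (le_Rintegrable mu _ mD m3 (fun y _ => bd y t) (integrable_cst_itv (C * expR t) 0 x)).
apply: (@C2ext_primitives _ (fun x => U v x t) (fun x => U v1 x t) (fun x => U v2 x t)
    (C * expR t)).
- by move=> x x0; exact: (subord_primitive hv h1).
- by move=> x x0; exact: (subord_primitive h1 h2).
- move=> x y x0 xy; have y0 := le_trans x0 xy.
  have -> : U v2 y t - U v2 x t =
      - (\int[mu]_(z in `]0, y]) U v3 z t - \int[mu]_(z in `]0, x]) U v3 z t).
    by rewrite (E2 y y0) (E2 x x0); ring.
  rewrite normrN.
  rewrite (@Rintegral_itvB _ _ (BRight 0) (BRight y) x (i3 y y0)) ?bnd_simp//.
  have ixy : mu.-integrable `]x, y] (EFin \o (fun y => U v3 y t)).
    by apply: integrableS (i3 y y0) => //; apply: subset_itvr; rewrite bnd_simp.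
  apply: (le_trans (le_normr_Rintegral _ ixy)) => //.
  apply: (@le_trans _ _ (\int[mu]_(z in `]x, y]) cst (C * expR t) z)).
    apply: le_Rintegral => //.
    + exact: (integrable_abse ixy).
    + exact: integrable_cst_itv.
  rewrite Rintegral_cst// ler_wpM2l ?mulr_ge0 ?expR_ge0//.
  rewrite (congr1 fine (lebesgue_measure_itv `]x, y])) /= lte_fin.
  by case: ifPn => //= _; rewrite subr_ge0.
Qed.

Lemma der_mix_exponent (s : R) : 0 < s ->
  is_derive s 1 phi (\sum_i c i * (a i * (s + l i) `^ (a i - 1))).
Proof.
move=> s0; apply: der_sum => i; apply: derZ.
have h : is_derive s 1 (fun s => s + l i) 1.
  by apply: (der_eq (derD (der_id s) (der_cst (l i) s))); rewrite addr0.
have h2 := der_comp h (is_derive1_powR (a i) (sl_gt0 i s0)).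
apply: (der_eq (derB h2 (der_cst (l i `^ a i) s))).
by rewrite mul1r subr0.
Qed.

Lemma der_power_product (b : I -> R) (s : R) : 0 < s ->
  is_derive s 1 (power_product b) (- \sum_i b i * power_product (raise b i 1) s).
Proof.
move=> s0.
have h i : is_derive s 1 (fun s => b i * ln (s + l i)) (b i * (s + l i)^-1).
  apply: derZ; have h : is_derive s 1 (fun s => s + l i) 1.
    by apply: (der_eq (derD (der_id s) (der_cst (l i) s))); rewrite addr0.
  by apply: (der_eq (der_comp h (is_derive1_ln (sl_gt0 i s0)))); rewrite mul1r.
apply: (der_eq (der_expR (derN (der_sum (index_enum I) h)))).
rewrite mulNr mulr_suml; congr (- _); apply: eq_bigr => i _.
by rewrite power_product_raise// powR_inv1 ?mulrA// ltW// sl_gt0.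
Qed.

(* The relation [t mu_x = x k * mu_x] between the law of [Y x] and the function
   [k] with Laplace transform [phi'], convolved with an arbitrary monomial. *)
Lemma subord_tmul (b : I -> R) (v : R -> R) (p q : I -> R -> R) :
  represents v (power_product b) -> (forall i, represents (p i) (power_product (raise b i 1)))
      ->
  (forall i, represents (q i) (power_product (raise b i (1 - a i)))) ->
  forall x t, 0 <= x -> 0 < t ->
  t * U v x t = \sum_i b i * U (p i) x t + x * \sum_i (c i * a i) * U (q i) x t.
Proof.
move=> [cv hv] hp hq x t x0; move: t.
have cU : causal (U v x) by exact: causal_subord.
have cp i : causal (U (p i) x) by apply: causal_subord => //; exact: (hp i).1.
have cq i : causal (U (q i) x) by apply: causal_subord => //; exact: (hq i).1.
have c1 := causal_sum (index_enum I) b cp.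
have c2 := causal_sum (index_enum I) (fun i => c i * a i) cq.
suff H : forall t, 0 < t -> t * U v x t =
    x * (\sum_i (c i * a i) * U (q i) x t) + \sum_i b i * U (p i) x t.
  by move=> t t0; rewrite H// addrC.
have c12 := causal_lin x c2 c1.
apply: (@right_continuous_unique _ _ _ 1).
- by move=> t _; apply: cvg_at_right_mul_id; case: cU.
- by move=> t _; case: c12.
move=> s s1; have s0 : 0 < s by rewrite (lt_trans _ s1).
have [ht dt] := causal_tmul_laplace cU s1.
split => //; first exact: (causal_laplace c12).
rewrite (laplace_lin x (causal_laplace c2 s1) (causal_laplace c1 s1)).2.
rewrite (laplace_sum _ _ (fun i => causal_laplace (cq i) s1)).2.
rewrite (laplace_sum _ _ (fun i => causal_laplace (cp i) s1)).2.
(* The product rule applied to [exp (- x phi s)] times the monomial: differentiating the monomial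
   gives the terms in [p], differentiating the exponential those in [q]. *)
have d2 : is_derive s 1 (laplace (U v x))
    (expR (- x * phi s) * (- \sum_i b i * power_product (raise b i 1) s) +
     power_product b s * (- x * (\sum_i c i * (a i * (s + l i) `^ (a i - 1)))
         * expR (- x * phi s))).
  have := derM (der_expR (derZ (- x) (der_mix_exponent s0))) (der_power_product b s0).
  apply: near_eq_is_derive.
  have : \forall y \near s, 1 < y by exact: lt_nbhsr.
  apply: filterS => y y1.
  by rewrite (laplace_subord Y0 mY YL)// hv.
have := @derive_val _ _ _ _ _ _ _ dt; rewrite (@derive_val _ _ _ _ _ _ _ d2) => /eqP.
rewrite -eqr_oppLR => /eqP <-.
have -> : \sum_i b i * laplace (U (p i) x) s =
    expR (- x * phi s) * \sum_i b i * power_product (raise b i 1) s.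
  rewrite mulr_sumr; apply: eq_bigr => i _.
  by rewrite (laplace_subord Y0 mY YL)//; [rewrite (hp i).2// mulrCA|exact: (hp i).1].
have -> : \sum_i c i * a i * laplace (U (q i) x) s =
    power_product b s * ((\sum_i c i * (a i * (s + l i) `^ (a i - 1))) * expR (- x * phi s)).
  rewrite mulr_suml mulr_sumr; apply: eq_bigr => i _.
  rewrite (laplace_subord Y0 mY YL)//; last exact: (hq i).1.
  by rewrite (hq i).2// power_product_raise// opprB; ring.
ring.
Qed.

(** Induction on the number of steps of size [eps] by which the total exponent falls short of
    [4 |I|]. Each use of [subord_tmul] raises the total by 1 or by [1 - a i], both at least
    [eps]. *)
Lemma C2ext_power_product (b : I -> R) (v : R -> R) : (forall k, 0 <= b k) -> 1 <= b i0 ->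
  represents v (power_product b) -> forall t, 0 < t -> C2ext (fun x => U v x t).
Proof.
move=> + + + t t0.
have step n : forall b : I -> R, (forall k, 0 <= b k) -> 1 <= b i0 ->
    (#|I| * 4)%:R - n%:R * eps <= \sum_i b i ->
    forall v, represents v (power_product b) -> C2ext (fun x => U v x t).
  elim: n => [|n IH] {b v} b b0 b1 bs v hv.
    (* Pigeonhole. The value 4 pays for three factors [phi] and for the unit reserved at [i0]. *)
    have [j bj] : exists j, 4 <= b j.
      apply: contrapT => /forallNP H.
      move: bs; rewrite mul0r subr0; apply/negP; rewrite -ltNge.
      have -> : (#|I| * 4)%:R = \sum_(i : I) 4 :> R.
        by rewrite big_const iter_addr_0 natrM mulr_natl cardE// cardE.
      apply: ltr_sum => [|i _]; last by rewrite ltNge; exact/negP/H.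
      by apply/hasP; exists i0; rewrite ?mem_index_enum.
    apply: (C2ext_represents_iter hv) => //;
        apply: (represents_iter_power_product _ b1 _ (j := j)) => //.
    by apply: le_trans bj; case: (j == i0); rewrite -?natrD ?addr0 ler_nat.
  have up i x k : 0 <= x -> b k <= raise b i x k by move=> x0; rewrite /raise lerDl mulr_ge0.
  have upS i x : \sum_k raise b i x k = \sum_k b k + x.
    rewrite /raise big_split/=; congr (_ + _); rewrite (bigD1 i)//= eqxx mulr1 big1 ?addr0//.
    by move=> k /negPf ->; rewrite mulr0.
  have upok i x : eps <= x -> [/\ forall k, 0 <= raise b i x k, 1 <= raise b i x i0 &
      (#|I| * 4)%:R - n%:R * eps <= \sum_k raise b i x k].
    move=> ex; have x0 : 0 <= x by rewrite (le_trans (ltW eps_gt0) ex).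
    split; [move=> k; exact: le_trans (up i x k x0)|exact: le_trans (up i x i0 x0)|].
    rewrite upS; apply: (@le_trans _ _ (\sum_k b k + eps)); last by rewrite lerD2l.
    by rewrite -lerBlDr; apply: le_trans bs; rewrite -natr1; lra.
  have /choice[p hp] i : exists p, represents p (power_product (raise b i 1)).
    by have [h1 h2 _] := upok i 1 eps_le1; exact: represents_power_product.
  have /choice[q hq] i : exists q, represents q (power_product (raise b i (1 - a i))).
    by have [h1 h2 _] := upok i _ (eps_a i); exact: represents_power_product.
  have cp i : C2ext (fun x => U (p i) x t).
    by have [h1 h2 h3] := upok i 1 eps_le1; exact: IH (hp i).
  have cq i : C2ext (fun x => U (q i) x t).
    by have [h1 h2 h3] := upok i _ (eps_a i); exact: IH (hq i).
  have S1 := C2ext_sum (index_enum I) b cp.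
  have S2 := C2ext_mulx (C2ext_sum (index_enum I) (fun i => c i * a i) cq).
  have S3 := C2ext_lin t^-1 (C2ext_lin 1 S1 S2) C2ext0.
  apply: C2ext_eq S3 => x x0; rewrite addr0 mul1r -(subord_tmul hv hp hq x0 t0).
  by rewrite mulrA mulVf ?mul1r// gt_eqF.
move=> b0 b1 hv.
pose n := Num.truncn ((#|I| * 4)%:R / eps).
apply: (step n.+1 b b0 b1 _ v hv).
have h : (#|I| * 4)%:R <= n.+1%:R * eps.
  by rewrite -ler_pdivrMr// ltW// truncnS_gt.
by apply: (@le_trans _ _ 0); [rewrite subr_le0|apply: sumr_ge0].
Qed.

End regularity.

(** * The subordinator and its inverse *)

Section subordinators.
Context {R : realType} d (T : measurableType d) (P : probability T R)
  (S : R -> {RV P >-> R}) (phi : R -> R).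
Notation mu := (@lebesgue_measure R).
Hypothesis hS : subordinator S.
Hypothesis SL : forall t s : R, 0 <= t -> 0 < s ->
  (\int[P]_w (expR (- s * S t w))%:E = (expR (- t * phi s))%:E)%E.

(* Agrees almost surely with [S x] for [x >= 0]. *)
Definition clip (x : R) (w : T) : R := Num.max (S (Num.max x 0) w) 0.

Lemma clip_ge0 x w : 0 <= clip x w.
Proof. by rewrite /clip le_max lexx orbT. Qed.

Lemma clip_ae : {ae P, forall w, forall x, 0 <= x -> clip x w = S x w}.
Proof.
apply: (@filterS _ _ (ae_filter_ringOfSetsType P)) (sub_start hS) => w S0 x x0.
by rewrite /clip (max_l x0) max_l// -S0 sub_mono.
Qed.

Lemma measurable_countable_fun (k : R -> nat) (F : nat -> T -> R) :
  (forall m, measurable [set x | k x = m]) -> (forall m, measurable_fun setT (F m)) ->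
  measurable_fun setT (fun p : R * T => F (k p.1) p.2).
Proof.
move=> mk mF _ B mB; rewrite setTI.
rewrite (_ : _ @^-1` _ = \bigcup_m ([set x | k x = m] `*` (F m @^-1` B))); last first.
  apply/seteqP; split => [[x w] /= h|[x w] [m _ [/= <-]]//].
  by exists (k x).
apply: bigcupT_measurable => m; apply: measurableX; first exact: mk.
by rewrite -[X in measurable X]setTI; exact: mF.
Qed.

(** Joint measurability comes from right-continuous paths: the process is the limit of its values at
    the points [r n x] of a grid of mesh [1 / (n + 1)], and each approximation uses countably many
    times. Truncation plus one keeps the grid point strictly to the right. *)
Lemma measurable_clip : measurable_fun setT (fun p : R * T => clip p.1 p.2).
Proof.
apply: measurable_maxr; last exact: measurable_cst.
pose k (n : nat) (x : R) := Num.truncn (n.+1%:R * Num.max x 0).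
pose r n x : R := (k n x).+1%:R / n.+1%:R.
have kP n x : (k n x)%:R <= n.+1%:R * Num.max x 0 < (k n x).+1%:R.
  by apply: truncn_itv; rewrite mulr_ge0// le_max lexx orbT.
apply: (@measurable_fun_cvg _ _ _ _ (fun n (p : R * T) => S (r n p.1) p.2)).
  move=> n; apply: (measurable_countable_fun (k := k n)
    (F := fun m w => S (m.+1%:R / n.+1%:R) w)) => m; last exact: measurable_funPT.
  have mz : measurable_fun setT (fun x : R => n.+1%:R * Num.max x 0).
    by apply: measurable_funM => //; apply: measurable_maxr.
  rewrite (_ : [set _ | _] = (fun x : R => n.+1%:R * Num.max x 0) @^-1` `[m%:R, m.+1%:R[).
    by rewrite -[X in measurable X]setTI; apply: mz => //; exact: measurable_itv.
  apply/seteqP; split => x /=; rewrite in_itv/=; first by move=> <-.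
  by rewrite -truncn_eq ?mulr_ge0 ?le_max ?lexx ?orbT// => /eqP.
move=> [x w] _ /=.
have z0 : 0 <= Num.max x 0 by rewrite le_max lexx orbT.
have /cvg_at_rightP h := @sub_rcont _ _ _ _ _ hS w _ z0.
apply: (h (fun n => r n x)); split.
  by move=> n; rewrite /r ltr_pdivlMr// mulrC; case/andP: (kP n x).
apply: (@squeeze_cvgr _ _ _ _ (fun=> Num.max x 0) (fun n => Num.max x 0 + n.+1%:R^-1)).
- apply: nearW => n; rewrite /r ler_pdivlMr// mulrC.
  have /andP[k1 k2] := kP n x; rewrite (ltW k2)/= ler_pdivrMr//.
  by rewrite mulrDl mulVf// -natr1 mulrC lerD2r.
- exact: cvg_cst.
- by rewrite -[X in _ --> X]addr0; apply: cvgD; [exact: cvg_cst|exact: cvg_harmonic].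
Qed.

Let mclip x : measurable_fun setT (clip x).
Proof. exact: (measurableT_comp measurable_clip (pair1_measurable x)). Qed.

Lemma clip_laplace x s : 0 <= x -> 0 < s ->
  \int[P]_w expR (- s * clip x w) = expR (- x * phi s).
Proof.
move=> x0 s0; rewrite /Rintegral -[RHS](congr1 fine (SL x0 s0)); congr fine.
have me (f : T -> R) : measurable_fun setT f ->
    measurable_fun setT (fun w => (expR (- s * f w))%:E).
  move=> mf; apply/measurable_EFinP; apply: (measurableT_comp (@measurable_expR R)).
  exact: measurable_funM.
apply: ae_eq_integral => //; [exact: me|exact: (me (S x) (measurable_funPT _))|].
apply: (@filterS _ _ (ae_filter_ringOfSetsType P)) clip_ae => w h _.
by rewrite h.
Qed.

Lemma measurable_gtS x t : measurable [set w | t < S x w].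
Proof.
rewrite (_ : [set _ | _] = S x @^-1` `]t, +oo[).
  by rewrite -[X in measurable X]setTI; apply: measurable_funPT => //; exact: measurable_itv.
by apply/seteqP; split => w /=; rewrite in_itv/= andbT.
Qed.

Lemma measurable_leS x t : measurable [set w | S x w <= t].
Proof.
rewrite (_ : [set _ | _] = ~` [set w | t < S x w]).
  by apply: measurableC; exact: measurable_gtS.
by apply/seteqP; split => w /=; [move=> h; apply/negP; rewrite -leNgt|move/negP;
    rewrite -leNgt].
Qed.

Lemma prob_leS x t : 0 <= x ->
  P [set w | S x w <= t] = (subord P clip (fun t => if 0 <= t then 1 else 0) x t)%:E.
Proof.
move=> x0; rewrite /subord /conv EFin_Rintegral//; last first.
  apply: (le_Rintegrable P (cst 1)) => //.
  - apply: measurable_funM => //; apply: measurable_fun_ifT => //.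
    by apply: measurable_fun_ler => //; exact: measurable_funB.
  - by move=> w _ /=; rewrite mul1r; case: ifPn => _; rewrite ?normr1 ?normr0.
  - exact: finite_measure_integrable_cst.
rewrite -[X in P X]setIT -(integral_indic P measurableT (measurable_leS x t)).
apply: ae_eq_integral => //.
- by apply/measurable_EFinP; exact: measurable_indic (measurable_leS x t).
- apply/measurable_EFinP.
  apply: measurable_funM => //; apply: measurable_fun_ifT => //.
  by apply: measurable_fun_ler => //; exact: measurable_funB.
- apply: (@filterS _ _ (ae_filter_ringOfSetsType P)) clip_ae => w h _ /=.
  rewrite h// mul1r subr_ge0 indicE; case: ifPn => hw; first by rewrite mem_set.
  by rewrite memNset//=; exact/negP.
Qed.

Lemma prob_gtS x t : 0 <= x ->
  P [set w | t < S x w] = (1 - subord P clip (fun t => if 0 <= t then 1 else 0) x t)%:E.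
Proof.
move=> x0; rewrite EFinB -(prob_leS t x0) -probability_setC; last exact: measurable_leS.
congr (P _); apply/seteqP; split => w /=; rewrite ltNge; first exact/negP.
by move/negP.
Qed.

(* Markov's inequality for [exp (- s S x)]. *)
Lemma prob_leS_exp x t s : 0 <= x -> 0 < s ->
  (P [set w | (S x w <= t)%R] <= (expR (s * t - x * phi s))%:E)%E.
Proof.
move=> x0 s0; have mI := measurable_leS x t.
rewrite -[X in P X]setIT -(integral_indic P measurableT mI).
rewrite -mulNr expRD EFinM -(SL x0 s0) -ge0_integralZl//; last first.
  apply/measurable_EFinP; apply: (measurableT_comp (@measurable_expR R)).
  by apply: measurable_funM => //; exact: measurable_funPT.
apply: ge0_le_integral => //.
- by apply/measurable_EFinP; exact: measurable_indic mI.
- apply/measurable_EFinP; apply: measurable_funM => //.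
  apply: (measurableT_comp (@measurable_expR R)).
  by apply: measurable_funM => //; exact: measurable_funPT.
- move=> w _; rewrite -EFinM lee_fin -expRD indicE; have [h|h] := boolP (w \in _).
    rewrite -[leLHS]expR0 ler_expR mulNr -mulrBr mulr_ge0 ?(ltW s0)// subr_ge0.
    by move: h; rewrite inE.
  exact: expR_ge0.
Qed.

(** * Distribution of the inverse process *)

Section inverse.
Hypothesis phi1 : 0 < phi 1.

(** The event on which the set defining the inverse is empty and its infimum takes the default value
    0. *)
Definition never (t : R) : set T := [set w | forall u, 0 < u -> S u w <= t].

Let never_bigcap t : never t = \bigcap_n [set w | S n.+1%:R w <= t].
Proof.
apply/seteqP; split => w /= h; first by move=> n _; exact: h.
move=> u u0; apply: le_trans (h (Num.truncn u) I) => /=.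
by apply: (sub_mono hS); rewrite ltW// truncnS_gt.
Qed.

Lemma measurable_never t : measurable (never t).
Proof.
by rewrite never_bigcap; apply: bigcapT_measurable => n; exact: measurable_leS.
Qed.

(** Markov's inequality at [s = 1] gives the bounds [exp (t - n phi 1)], which tend to 0 as
    [phi 1 > 0]. *)
Lemma prob_never t : P (never t) = 0%E.
Proof.
have h n : (P (never t) <= (expR t * expR (- phi 1) ^+ n.+1)%:E)%E.
  apply: (@le_trans _ _ (P [set w | S n.+1%:R w <= t])).
    apply: le_measure; rewrite ?inE; [exact: measurable_never|exact: measurable_leS|].
    by move=> w; apply.
  apply: (le_trans (prob_leS_exp _ _ ltr01)) => //.
  by rewrite mul1r expRD lee_fin -expRM_natl -mulr_natl mulrN.
have c : (expR t * expR (- phi 1) ^+ n.+1)%:E @[n --> \oo] --> 0%:E.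
  apply: cvg_EFin; first exact: nearW.
  rewrite -[X in _ --> X](mulr0 (expR t)); apply: cvgMr.
  rewrite (cvg_shiftS (fun n => expR (- phi 1) ^+ n)); apply: cvg_expr.
  by rewrite ger0_norm ?expR_ge0// expR_lt1 oppr_lt0.
apply/eqP; rewrite eq_le measure_ge0 andbT.
by apply: (cvge_ge _ c); apply: nearW.
Qed.

Notation E := (inverse_process S).

Let lb0 t w : lbound [set u | 0 < u /\ t < S u w] 0.
Proof. by move=> u [/ltW]. Qed.

Lemma inverse_ge0 t w : 0 <= E t w.
Proof.
rewrite /inverse_process; have [->|/set0P h] := eqVneq [set u | 0 < u /\ t < S u w] set0.
  by rewrite inf0.
exact: lb_le_inf.
Qed.

Lemma inverse_le t w u : 0 < u -> t < S u w -> E t w <= u.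
Proof. by move=> u0 h; apply: ge_inf => //; exists 0. Qed.

Lemma inverse_lt t w x : ~ never t w -> E t w < x -> t < S x w.
Proof.
move=> /existsNP[u /not_implyP[u0 /negP]]; rewrite -ltNge => tu.
move=> /inf_lt[]; first by exists u.
by move=> y [y0 ty] yx; apply: (lt_le_trans ty); apply: (sub_mono hS); exact: ltW.
Qed.

Lemma inverse_never t w : never t w -> E t w = 0.
Proof.
move=> h; rewrite /inverse_process (_ : [set _ | _] = set0) ?inf0//.
apply/seteqP; split => u //= [u0]; apply/negP; rewrite -leNgt; exact: h.
Qed.

(** By monotonicity, passing [t] before [x] is witnessed at one of the countably many times
    [x - 1 / (n + 1)]; [never] joins in because of the default value 0. *)
Lemma inverse_ltE t x : 0 < x -> [set w | E t w < x] =
  never t `|` \bigcup_n [set w | n.+1%:R^-1 < x /\ t < S (x - n.+1%:R^-1) w].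
Proof.
move=> x0; apply/seteqP; split => w /=.
  move=> Ex; have [nw|nw] := pselect (never t w); [by left|right].
  have [y [y0 ty] yx] : exists2 y, [set u | 0 < u /\ t < S u w] y & y < x.
    move/existsNP: nw => [u /not_implyP[u0 /negP]]; rewrite -ltNge => tu.
    by apply: inf_lt Ex; exists u.
  have xy : 0 < x - y by rewrite subr_gt0.
  have [n _ /(_ n (leqnn n)) hn] := near_infty_natSinv_lt (PosNum xy).
  move: hn => /= hn; exists n => //; split.
    by rewrite (lt_trans hn)// ltrBlDr ltrDl.
  apply: (lt_le_trans ty); apply: (sub_mono hS); first exact: ltW.
  by rewrite lerBrDr -lerBrDl ltW.
move=> [h|[n _ [nx h]]]; first by rewrite inverse_never.
by apply: (le_lt_trans (inverse_le _ h)); rewrite ?subr_gt0// ltrBlDr ltrDl.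
Qed.

Lemma measurable_inverse t : measurable_fun setT (E t).
Proof.
move=> mT; apply: (measurability _ (RGenInftyO.measurableE R)) => //.
move=> _ [_ [x ->] <-]; rewrite setTI.
rewrite (_ : _ @^-1` _ = [set w | E t w < x]); last first.
  by apply/seteqP; split => w /=; rewrite in_itv.
have [x0|x0] := leP x 0.
  rewrite (_ : [set _ | _] = set0)//; apply/seteqP; split => w //=.
  by apply/negP; rewrite -leNgt (le_trans x0)// inverse_ge0.
rewrite inverse_ltE//; apply: measurableU; first exact: measurable_never.
apply: bigcupT_measurable => n; have [nx|nx] := ltP n.+1%:R^-1 x.
  rewrite (_ : [set _ | _] = [set w | t < S (x - n.+1%:R^-1) w]); first exact: measurable_gtS.
  by apply/seteqP; split => w /=; [case|].
by rewrite (_ : [set _ | _] = set0)//; apply/seteqP; split => w //= [].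
Qed.

(** A path may equal [t] at time [x] and exceed it immediately afterwards, so [t < S x] is only
    sandwiched between two events for the inverse. A density gives no mass to [x], and then the two
    bounds coincide. *)
Lemma prob_inverse_lt t x : 0 < x ->
  (P [set w | (E t w < x)%R] <= P [set w | (t < S x w)%R])%E /\
  (P [set w | (t < S x w)%R] <= P [set w | (E t w <= x)%R])%E.
Proof.
move=> x0.
have mlt : measurable [set w | E t w < x].
  rewrite (_ : [set _ | _] = E t @^-1` `]-oo, x[).
    by rewrite -[X in measurable X]setTI; apply: measurable_inverse => //;
        exact: measurable_itv.
  by apply/seteqP; split => w /=; rewrite in_itv.
have mle : measurable [set w | E t w <= x].
  rewrite (_ : [set _ | _] = E t @^-1` `]-oo, x]).
    by rewrite -[X in measurable X]setTI; apply: measurable_inverse => //;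
        exact: measurable_itv.
  by apply/seteqP; split => w /=; rewrite in_itv.
split; last first.
  apply: le_measure; rewrite ?inE//; first exact: measurable_gtS.
  by move=> w /= h; exact: inverse_le.
apply: (@le_trans _ _ (P ([set w | t < S x w] `|` never t))).
  apply: le_measure; rewrite ?inE//.
    by apply: measurableU; [exact: measurable_gtS|exact: measurable_never].
  move=> w /= h; have [nw|nw] := pselect (never t w); [by right|left].
  exact: inverse_lt.
rewrite measureU0//; [exact: measurable_gtS|exact: measurable_never|exact: prob_never].
Qed.

Section density.
Variable H : R -> R -> R.
Hypothesis hH : density_family P E H.

Lemma density_integrable t : 0 < t -> mu.-integrable `]0, +oo[ (fun x => (H x t)%:E).
Proof.
move=> t0; apply/integrableP; split.
  apply/measurable_EFinP; apply: open_continuous_measurable_fun; first exact: interval_open.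
  by move=> x; rewrite inE/= in_itv/= andbT => x0; exact: (dens_cont hH).
have -> : (\int[mu]_(x in `]0%R, +oo[) `|(H x t)%:E| =
    \int[mu]_(x in `]0%R, +oo[) (H x t)%:E)%E.
  apply: eq_integral => x; rewrite inE/= in_itv/= andbT => x0.
  by rewrite /= ger0_norm// (dens_ge0 hH).
have := dens_law hH t0 measurableT; rewrite setTI => <-.
by rewrite preimage_setT probability_setT ltry.
Qed.

Lemma density_cdf t x : 0 < t -> 0 < x -> \int[mu]_(y in `]0, x]) H y t =
  1 - subord P clip (fun t => if 0 <= t then 1 else 0) x t.
Proof.
move=> t0 x0; have [h1 h2] := prob_inverse_lt t x0.
have Eoc : (P [set w | (E t w <= x)%R] = \int[mu]_(y in `]0%R, x]) (H y t)%:E)%E.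
  have := dens_law hH t0 (measurable_itv `]-oo, x]).
  rewrite -set_itvI/= => <-; congr (P _); apply/seteqP; by split => w /=; rewrite in_itv.
have Eoo : (P [set w | (E t w < x)%R] = \int[mu]_(y in `]0%R, x[) (H y t)%:E)%E.
  have := dens_law hH t0 (measurable_itv `]-oo, x[).
  rewrite -set_itvI/= => <-; congr (P _); apply/seteqP; by split => w /=; rewrite in_itv.
have EE : (\int[mu]_(y in `]0%R, x[) (H y t)%:E = \int[mu]_(y in `]0%R, x]) (H y t)%:E)%E.
  apply: integral_itv_bndo_bndc.
  case/integrableP: (density_integrable t0) => + _; apply: measurable_funS => //.
  by apply: subset_itvl; rewrite bnd_simp.
have := prob_gtS t (ltW x0); rewrite /Rintegral -Eoc => E1.
have -> : P [set w | E t w <= x] = P [set w | t < S x w].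
  by apply/eqP; rewrite eq_le h2 andbT Eoc -EE -Eoo.
by rewrite E1.
Qed.

End density.

(** With [phi s] arbitrarily large, Markov's inequality at level 0 shows that almost every path is
    positive at all times [1 / (n + 1)]; it leaves 0 at once. *)
Lemma inverse0 : (forall K, exists2 s, 0 < s & K < phi s) ->
  forall A : set R, measurable A -> P (E 0 @^-1` A) = \d_(0 : R)%R A.
Proof.
move=> phiy.
have p0 u : 0 < u -> P [set w | S u w <= 0] = 0%E.
  move=> u0; apply/eqP; rewrite eq_le measure_ge0 andbT; apply/lee_addgt0Pr => e e0.
  rewrite add0e; have [s s0 Ks] := phiy (- ln e / u).
  apply: (le_trans (prob_leS_exp 0 (ltW u0) s0)).
  rewrite mulr0 sub0r lee_fin -[leRHS](lnK) ?posrE// ler_expR lerNl mulrC.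
  by rewrite -ler_pdivrMr// ltW.
have E0 : {ae P, forall w, E 0 w = 0}.
  have h : {ae P, forall w, forall n : nat, 0 < S n.+1%:R^-1 w}.
    apply: ae_foralln => n; exists [set w | S n.+1%:R^-1 w <= 0]; split.
    - exact: measurable_leS.
    - by apply: p0; rewrite invr_gt0.
    - by move=> w /= /negP; rewrite -leNgt.
  apply: (@filterS _ _ (ae_filter_ringOfSetsType P)) h => w h.
  apply/eqP; rewrite eq_le inverse_ge0 andbT.
  have c : n.+1%:R^-1 @[n --> \oo] --> (0 : R) by exact: cvg_harmonic.
  rewrite -[leRHS](cvg_lim _ c)//; apply: limr_ge; first by apply: cvgP c.
  by apply: nearW => n; apply: inverse_le; rewrite ?invr_gt0.
move=> A mA; have mE (B : set R) : measurable B -> measurable (E 0 @^-1` B).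
  by move=> mB; rewrite -[X in measurable X]setTI; exact: measurable_inverse.
have nul (B : set R) : measurable B -> ~ B 0 -> P (E 0 @^-1` B) = 0%E.
  move=> mB B0; case: E0 => N [mN N0 sN].
  apply/eqP; rewrite eq_le measure_ge0 andbT -N0; apply: le_measure; rewrite ?inE//.
    exact: mE.
  by move=> w /= Bw; apply: sN => /= Ew; apply: B0; rewrite -Ew.
rewrite diracE; have [A0|A0] := pselect (A 0).
  rewrite mem_set//=; have : P (~` (E 0 @^-1` A)) = 0%E.
    exact: (nul (~` A) (measurableC mA) (fun h => h A0)).
  rewrite probability_setC; last exact: mE.
  rewrite -(fineK (fin_num_measure P _ (mE _ mA))) -EFinB => -[/eqP].
  by rewrite subr_eq0 => /eqP <-.
by rewrite memNset// nul.
Qed.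

End inverse.

End subordinators.

(** * Generalized functions on the half-line *)

Section test_functions.
Context {R : realType}.
Notation mu := (@lebesgue_measure R).
Implicit Types (psi u v : R -> R).

Lemma test_function_der psi (x : R) : test_function psi ->
  is_derive x 1 psi (derive1 psi x).
Proof.
by move=> [h _]; apply: DeriveDef; [exact: (h 0%N x)|rewrite derive1E].
Qed.

Lemma derive1_supported psi (b : R) : (forall x, b < `|x| -> psi x = 0) ->
  forall x, b < `|x| -> derive1 psi x = 0.
Proof.
move=> hb x bx; rewrite derive1E (@near_eq_derive _ _ _ _ (cst 0) x 1) ?derive_cst//.
have cn : `|y| @[y --> x] --> `|x| by apply: cvg_norm; exact: cvg_id.
near=> y; apply: hb; near: y.
exact: (cvgr_gt _ cn).
Unshelve. all: by end_near. Qed.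

Lemma test_function_derive1 psi : test_function psi -> test_function (derive1 psi).
Proof.
move=> [h [b hb]]; split; first by move=> n x; rewrite -derive1Sn; exact: h.
by exists b; exact: derive1_supported.
Qed.

Lemma test_function_continuous psi (x : R) : test_function psi -> {for x, continuous psi}.
Proof. by move=> /(test_function_der x); exact: der_continuous. Qed.

(** The radius is enlarged by 1 so that [psi] vanishes at the radius itself, where the outer
    boundary term of an integration by parts is evaluated. *)
Lemma test_function_support psi : test_function psi ->
  exists2 b : R, 0 < b & forall x, b <= `|x| -> psi x = 0.
Proof.
move=> [_ [b hb]]; exists (Num.max b 0 + 1).
  by rewrite ltr_pwDr// le_max lexx orbT.
move=> x bx; apply: hb; apply: lt_le_trans bx.
by rewrite ltr_pwDr// le_max lexx.
Qed.

Lemma test_function_bounded psi : test_function psi -> exists2 M, 0 <= M &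
    forall x, `|psi x| <= M.
Proof.
move=> hp; have [b b0 hb] := test_function_support hp.
have [||c _ hc] := @EVT_max _ (fun x => `|psi x|) (- b) b.
- by rewrite (le_trans _ (ltW b0))// oppr_le0 ltW.
- apply: continuous_subspaceT => x; apply: cvg_norm; exact: test_function_continuous.
exists `|psi c| => // x; have [xb|xb] := leP b `|x|; first by rewrite hb// normr0.
by apply: hc; rewrite in_itv/= -ler_norml ltW.
Qed.

Lemma continuous_integrable_oc (f : R -> R) (b : R) :
  (forall x, -1 < x -> {for x, continuous f}) -> mu.-integrable `]0, b] (EFin \o f).
Proof.
move=> cf; apply: (@integrableS _ _ _ mu `[0, b]) => //.
  by apply: subset_itvr; rewrite bnd_simp.
apply: continuous_compact_integrable; first exact: segment_compact.
apply: continuous_in_subspaceT => y; rewrite inE/= in_itv/= => /andP[y0 _].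
by apply: cf; rewrite (lt_le_trans _ y0).
Qed.

Lemma Rintegral_supported (f : R -> R) (b : R) : (forall x, b < x -> f x = 0) ->
  \int[mu]_(x in `]0, +oo[) f x = \int[mu]_(x in `]0, b]) f x.
Proof.
move=> fb; rewrite Rintegral_mkcond [RHS]Rintegral_mkcond; apply: eq_Rintegral => x _.
rewrite !patchE; have [bx|xb] := ltP b x.
  by rewrite fb//; case: ifPn => _; case: ifPn.
by rewrite !mem_setE /= !in_itv/= xb andbT.
Qed.

Lemma integrable_supported (f : R -> R) (b : R) : (forall x, b < x -> f x = 0) ->
  mu.-integrable `]0, b] (EFin \o f) -> mu.-integrable `]0, +oo[ (EFin \o f).
Proof.
move=> fb h0; have mD (i : interval R) : measurable [set` i] by exact: measurable_itv.
have h := (@integrable_mkcond _ _ R mu _ (EFin \o f) (mD _)).1 h0.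
apply: (@integrable_mkcond _ _ R mu _ (EFin \o f) (mD _)).2.
apply: eq_integrable h => // x _; rewrite !patchE; have [bx|xb] := ltP b x.
  by rewrite /= fb//; case: ifPn => _; case: ifPn.
by rewrite !mem_setE /= !in_itv/= xb andbT.
Qed.

Lemma continuous_test_integrable u psi : test_function psi ->
  (forall x, -1 < x -> {for x, continuous u}) ->
  mu.-integrable `]0, +oo[ (EFin \o (fun x => u x * psi x)).
Proof.
move=> hp cu; have [b b0 hb] := test_function_support hp.
apply: (@integrable_supported _ b).
  by move=> x bx; rewrite hb ?mulr0// (le_trans (ltW bx))// ler_norm.
apply: continuous_integrable_oc => x x1; apply: cvgM; first exact: cu.
exact: test_function_continuous.
Qed.

Lemma test_integration_by_parts u u' psi : test_function psi ->
  (forall x : R, -1 < x -> is_derive x 1 u (u' x)) ->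
  (forall x : R, -1 < x -> {for x, continuous u'}) ->
  \int[mu]_(x in `]0, +oo[) (u' x * psi x) =
  - (u 0 * psi 0) - \int[mu]_(x in `]0, +oo[) (u x * derive1 psi x).
Proof.
move=> hp du cu'; have [b b0 hb] := test_function_support hp.
have [b' b'0 hb'] := test_function_support (test_function_derive1 hp).
have cu x : -1 < x -> {for x, continuous u} by move=> /du; exact: der_continuous.
have i1 := continuous_test_integrable hp cu'.
have i2 := continuous_test_integrable (test_function_derive1 hp) cu.
have dF (x : R) : -1 < x -> is_derive x 1 (fun x => u x * psi x)
    (u' x * psi x + u x * derive1 psi x).
  move=> x1; apply: (der_eq (derM (du x x1) (test_function_der x hp))).
  by ring.
have cF (x : R) : -1 < x -> {for x, continuous (fun x : R => u' x * psi x + u x * derive1 psi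
    x)}.
  move=> x1; apply: cvgD; apply: cvgM; [exact: cu'|exact: test_function_continuous|exact: cu|].
  by apply: test_function_continuous; exact: test_function_derive1.
suff : \int[mu]_(x in `]0, +oo[) (u' x * psi x + u x * derive1 psi x) = - (u 0 * psi 0).
  by rewrite RintegralD// => h; rewrite -h; ring.
pose B := Num.max b b'.
have B0 : 0 < B by rewrite lt_max b0.
rewrite (@Rintegral_supported _ B); last first.
  move=> x; rewrite gt_max => /andP[bx b'x].
  rewrite hb ?(le_trans (ltW bx)) ?ler_norm// hb' ?(le_trans (ltW b'x)) ?ler_norm//.
  by rewrite !mulr0 addr0.
rewrite Rintegral_itv_obnd_cbnd; last exact: continuous_integrable_oc.
have pos y : y \in `]0, B[ -> -1 < y.
  by rewrite in_itv/= => /andP[y0 _]; rewrite (lt_trans _ y0).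
have B1 : -1 < B by rewrite (lt_trans _ B0).
have cU (x : R) : -1 < x -> {for x, continuous (fun x : R => u x * psi x)}.
  by move=> x1; exact: der_continuous (dF x x1).
rewrite /Rintegral (@continuous_FTC2 _ _ (fun x => u x * psi x) 0 B)//.
- by rewrite /= hb ?mulr0 ?sub0r// ger0_norm ?(ltW B0)// le_max lexx.
- apply: continuous_in_subspaceT => y; rewrite inE/= in_itv/= => /andP[y0 _].
  by apply: cF; rewrite (lt_le_trans _ y0).
- split.
  + by move=> y /pos y1; exact: (der_derive1 (dF y y1)).1.
  + by apply: cvg_at_right_filter; apply: cU.
  + by apply: cvg_at_left_filter; apply: cU.
- by move=> y /pos y1; exact: (der_derive1 (dF y y1)).2.
Qed.

Lemma derivative_sequence (f : R -> R) (df : R) : is_derive (0 : R) 1 f df ->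
  n.+1%:R * (f n.+1%:R^-1 - f 0) @[n --> \oo] --> df.
Proof.
move=> h; have df0 := @ex_derive _ _ _ _ _ _ _ h.
have E := @derive_val _ _ _ _ _ _ _ h.
have c : h^-1 *: ((f \o shift 0) (h *: 1) - f 0) @[h --> 0^'] --> df.
  by rewrite -E; exact: df0.
have cs : (forall n : nat, 0 < n.+1%:R^-1 :> R) /\ (n.+1%:R^-1 @[n --> \oo] --> (0 : R)).
  by split; [move=> n; rewrite invr_gt0|exact: cvg_harmonic].
have := (cvg_at_rightP _ _ _).1 (cvg_dnbhs_at_right c) (fun n => n.+1%:R^-1) cs.
apply: cvg_trans; apply: near_eq_cvg; apply: nearW => n /=.
by rewrite invrK addr0 /GRing.scale/= mulr1.
Qed.

End test_functions.

(** * Measurability of the set of parameters with an integrable section *)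

Section integrability_set.
Context d (X : measurableType d) (R : realType) (m : {sigma_finite_measure set X -> \bar R}).

Lemma measurable_integrable_sections (F : R * X -> R) : measurable_fun setT F ->
  measurable [set t | m.-integrable setT (fun p => (F (t, p))%:E)].
Proof.
move=> mF.
have mG := measurable_fun_fubini_tonelli_F (m2 := m) (abse \o (EFin \o F))
  (measurableT_comp (@abse_measurable R setT) ((measurable_EFinP _ _).2 mF))
      (fun _ => abse_ge0 _).
rewrite (_ : [set _ | _] =
    setT `&` [set t | (fubini_F m (abse \o (EFin \o F)) t < +oo)%E]).
  exact: emeasurable_fun_infty_o.
rewrite setTI; apply/seteqP; split => t /=; first by case/integrableP.
move=> h; apply/integrableP; split => //.
exact: ((measurable_EFinP _ _).2 (measurableT_comp mF (pair1_measurable t))).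
Qed.

End integrability_set.

(** * Transforms of functions that agree almost everywhere *)

Section laplace_ae.
Context {R : realType}.
Notation mu := (@lebesgue_measure R).

Lemma laplace_ae_eq (f g : R -> R) (s : R) : measurable_fun setT g ->
  {ae mu, forall t, 0 < t -> f t = g t} -> has_laplace f s ->
  has_laplace g s /\ laplace g s = laplace f s.
Proof.
move=> mg fg hf.
have mD : measurable (`]0, +oo[%classic : set R) by exact: measurable_itv.
have mg' : measurable_fun (`]0, +oo[%classic : set R) (fun t : R => (expR (- s * t) * g t)%:E).
  apply/measurable_EFinP; apply: measurable_funTS; apply: measurable_funM => //.
  exact: measurable_expRM.
have ae : ae_eq mu (`]0, +oo[%classic : set R) (fun t => (expR (- s * t) * f t)%:E)
    (fun t => (expR (- s * t) * g t)%:E).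
  apply: (@filterS _ _ (ae_filter_ringOfSetsType mu)) fg => t h.
  by rewrite /= in_itv/= andbT => /h ->.
split; first exact: (@ae_eq_integrable _ _ _ mu _ _ _ mD mg' ae hf).
rewrite /laplace /Rintegral; congr fine; apply/esym.
apply: (@ae_eq_integral _ _ _ mu) => //.
by case/integrableP: hf.
Qed.

Lemma laplaceZ (k : R) (f : R -> R) (s : R) : has_laplace f s ->
  has_laplace (fun t => k * f t) s /\ laplace (fun t => k * f t) s = k * laplace f s.
Proof.
move=> h; have [h1 e1] := laplace_lin (k - 1) h h.
have [|h2 e2] := @eq_laplace _ _ (fun t => k * f t) s _ h1; first by move=> t _; ring.
by split => //; rewrite e2 e1; ring.
Qed.

End laplace_ae.

(** * The density tested against functions of [x] *)

Section half_line_equation.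
Context {R : realType} d (Om : measurableType d) (P : probability Om R)
  (Y : R -> Om -> R) (I : finType) (l a c : I -> R) (i0 : I) (eps : R)
  (H : R -> R -> R).
Notation mu := (@lebesgue_measure R).
Notation phi := (mix_exponent l a c).
Notation heaviside := (fun t : R => if 0 <= t then 1 else 0).
Hypothesis l_ge0 : forall i, 0 <= l i.
Hypothesis l_i0 : l i0 = 0.
Hypothesis a_gt0 : forall i, 0 < a i.
Hypothesis c_ge0 : forall i, 0 <= c i.
Hypothesis eps_gt0 : 0 < eps.
Hypothesis eps_le1 : eps <= 1.
Hypothesis eps_a : forall i, eps <= 1 - a i.
Hypothesis Y0 : forall x w, 0 <= Y x w.
Hypothesis mY : measurable_fun setT (fun p : R * Om => Y p.1 p.2).
Hypothesis YL : forall x s, 0 <= x -> 0 < s ->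
  \int[P]_w expR (- s * Y x w) = expR (- x * phi s).
Notation U := (subord P Y heaviside).
Hypothesis cH : forall x t, 0 < x -> 0 < t -> {for x, continuous (H ^~ t)}.
Hypothesis iH : forall t, 0 < t -> mu.-integrable `]0, +oo[ (EFin \o H ^~ t).
Hypothesis UH : forall t x, 0 < t -> 0 < x -> \int[mu]_(y in `]0, x]) H y t = 1 - U x t.

Lemma represents_heaviside : represents heaviside (power_product l (fun k => (k == i0)%:R)).
Proof.
split; first exact: causal_heaviside.
move=> s s1; have s0 : 0 < s by rewrite (lt_trans _ s1).
rewrite (laplace_heaviside s0).2 /power_product (bigD1 i0)//= eqxx mul1r big1 ?addr0.
  by rewrite l_i0 addr0 expRN lnK.
by move=> k /negPf ->; rewrite mul0r.
Qed.

(** At [x = 0] the factor [exp (- x phi s)] is 1, so [U 0] has the transform of the Heaviside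
    function. *)
Lemma subord_heaviside0 t : 0 < t -> U 0 t = 1.
Proof.
move=> t0; transitivity ((fun t : R => if 0 <= t then 1 else 0 : R) t); last first.
  by rewrite /= ltW.
have cU : causal (U 0) by apply: causal_subord => //; exact: causal_heaviside.
have ch := @causal_heaviside R.
apply: (@right_continuous_unique _ (U 0) heaviside 1) => // {t t0}.
- by move=> t _; case: cU.
- by move=> t _; case: ch.
- move=> s s1; split; [exact: causal_laplace|exact: causal_laplace|].
  by rewrite (laplace_subord Y0 mY YL)// oppr0 mul0r expR0 mul1r.
Qed.

(** The extension [g] of [U (., t)] and the distribution function of the inverse have opposite
    increments; continuity of [H] makes [H = - g1] hold at every [x > 0], so [H] inherits a
    derivative. *)
Lemma density_C1 t : 0 < t -> exists g g1 g2 : R -> R,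
  [/\ [/\ forall x, 0 <= x -> g x = U x t,
      forall x : R, -1 < x -> is_derive x 1 g (g1 x),
      forall x : R, -1 < x -> is_derive x 1 g1 (g2 x) &
      forall x : R, -1 < x -> {for x, continuous g2}],
      forall x, 0 < x -> H x t = - g1 x &
      forall x : R, 0 < x -> is_derive x 1 (H ^~ t) (- g2 x)].
Proof.
move=> t0; have b0 k : 0 <= (k == i0)%:R :> R by [].
have b1 : 1 <= (i0 == i0)%:R :> R by rewrite eqxx.
have [g [g1 [g2 hg]]] := C2ext_power_product l_ge0 l_i0 a_gt0 eps_gt0 eps_le1 eps_a Y0 mY YL
  b0 b1 represents_heaviside t0.
have [gU dg dg1 _] := hg.
have Hg (x : R) : 0 < x -> H x t = - g1 x; last first.
  exists g, g1, g2; split => // x x0; have x1 : -1 < x by rewrite (lt_trans _ x0).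
  apply: near_eq_is_derive (derN (dg1 x x1)).
  have : \forall z \near x, 0 < z by exact: lt_nbhsr.
  by apply: filterS => z z0; rewrite Hg.
move=> x0.
(* [H] is continuous on the open half-line, so its primitive is taken from a point inside it. *)
pose y := x / 2; have y0 : 0 < y by rewrite divr_gt0.
have yx : y < x by rewrite /y; lra.
have iD z : mu.-integrable `]0, z] (EFin \o H ^~ t).
  by apply: integrableS (iH t0) => //; apply: subset_itvl; rewrite bnd_simp.
have iyz z : mu.-integrable `[y, z] (EFin \o H ^~ t).
  by apply: integrableS (iD z) => //; apply: subset_itvr; rewrite bnd_simp.
have [||dF dE] := @continuous_FTC1_closed _ (H ^~ t) y x (x + 1) _ (iyz _) yx.
- by rewrite ltrDl.
- exact: cH.
rewrite -dE derive1E.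
rewrite (@near_eq_derive _ _ _ _ (fun z => g y - g z) x 1).
  have x1 : -1 < x by rewrite (lt_trans _ x0).
  have h := derB (der_cst (g y) x) (dg x x1).
  by rewrite (@derive_val _ _ _ _ _ _ _ h) sub0r.
have : \forall z \near x, y < z by exact: lt_nbhsr.
apply: filterS => z yz; have z0 := lt_trans y0 yz.
rewrite -Rintegral_itv_obnd_cbnd; last first.
  by apply: integrableS (iyz z) => //; apply: subset_itvr; rewrite bnd_simp.
rewrite -(@Rintegral_itvB _ _ (BRight 0) (BRight z) y (iD z)) ?bnd_simp ?ltW//.
by rewrite (UH t0 z0) (UH t0 y0) !gU ?ltW//; ring.
Qed.

(* The boundary value [H (0+, t)]. *)
Definition boundary_density (t : R) : R :=
  limn (fun n => n.+1%:R * (1 - U n.+1%:R^-1 t)).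

Lemma boundary_density_cvg t g g1 : 0 < t -> (forall x, 0 <= x -> g x = U x t) ->
  is_derive (0 : R) 1 g g1 ->
  n.+1%:R * (1 - U n.+1%:R^-1 t) @[n --> \oo] --> - g1.
Proof.
move=> t0 gU dg; apply: cvg_trans (cvgN (derivative_sequence dg)).
apply: near_eq_cvg; apply: nearW => n /=.
by rewrite !fctE !gU// subord_heaviside0//; ring.
Qed.

Lemma boundary_densityE t g g1 : 0 < t -> (forall x, 0 <= x -> g x = U x t) ->
  is_derive (0 : R) 1 g g1 -> boundary_density t = - g1.
Proof. by move=> t0 gU dg; apply: cvg_lim => //; exact: boundary_density_cvg gU dg. Qed.

(** Integration by parts trades [H] for [U], whose transform in [t] is explicit; [psi 0] is the
    boundary term, as [U 0 t = 1]. *)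
Lemma regular_density t psi : 0 < t -> test_function psi ->
  regular (H ^~ t) psi = psi 0 + \int[mu]_(x in `]0, +oo[) (U x t * derive1 psi x).
Proof.
move=> t0 hp; have [g [g1 [g2 [[gU dg dg1 cg2] Hg dH]]]] := density_C1 t0.
have cg1 x : -1 < x -> {for x, continuous g1} by move=> /dg1; exact: der_continuous.
have E := test_integration_by_parts hp dg cg1.
have -> : regular (H ^~ t) psi = -1 * \int[mu]_(x in `]0, +oo[) (g1 x * psi x).
  rewrite -RintegralZl//; last exact: continuous_test_integrable.
  by apply: eq_Rintegral => x; rewrite inE/= in_itv/= andbT => x0; rewrite Hg//; ring.
rewrite E gU// subord_heaviside0//.
have -> : \int[mu]_(x in `]0, +oo[) (g x * derive1 psi x) =
    \int[mu]_(x in `]0, +oo[) (U x t * derive1 psi x).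
  by apply: eq_Rintegral => x; rewrite inE/= in_itv/= andbT => x0; rewrite gU// ltW.
ring.
Qed.

Lemma derivable_density t : 0 < t ->
  (forall x, 0 < x -> derivable (H ^~ t) x 1) /\
  locally_integrable_half_line (derive1 (H ^~ t)).
Proof.
move=> t0; have [g [g1 [g2 [[gU dg dg1 cg2] Hg dH]]]] := density_C1 t0.
split; first by move=> x x0; exact: (der_derive1 (dH x x0)).1.
move=> b b0.
apply: (@eq_integrable _ _ _ mu _ (measurable_itv _) (EFin \o (fun x => - g2 x))).
  move=> x; rewrite inE/= in_itv/= => /andP[x0 _].
  by rewrite (der_derive1 (dH x x0)).2.
by apply: continuous_integrable_oc => x x1; apply: cvgN; exact: cg2.
Qed.

Lemma regular_derive1_density t psi : 0 < t -> test_function psi ->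
  regular (derive1 (H ^~ t)) psi =
  - (boundary_density t * psi 0) - regular (H ^~ t) (derive1 psi).
Proof.
move=> t0 hp; have [g [g1 [g2 [[gU dg dg1 cg2] Hg dH]]]] := density_C1 t0.
have cg1 x : -1 < x -> {for x, continuous g1} by move=> /dg1; exact: der_continuous.
rewrite (boundary_densityE t0 gU (dg 0 _))//.
have -> : regular (derive1 (H ^~ t)) psi = -1 * \int[mu]_(x in `]0, +oo[) (g2 x * psi x).
  rewrite -RintegralZl//; last exact: continuous_test_integrable.
  apply: eq_Rintegral => x; rewrite inE/= in_itv/= andbT => x0.
  by rewrite (der_derive1 (dH x x0)).2; ring.
have -> : regular (H ^~ t) (derive1 psi) = -1 * \int[mu]_(x in `]0, +oo[)
    (g1 x * derive1 psi x).
  rewrite -RintegralZl//; last first.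
    by apply: continuous_test_integrable => //; exact: test_function_derive1.
  by apply: eq_Rintegral => x; rewrite inE/= in_itv/= andbT => x0; rewrite Hg//; ring.
by rewrite (test_integration_by_parts hp dg1 cg2); ring.
Qed.

(* Upper bound for the tail: [P (t < Y x) <= x * tail_bound t]. *)
Definition tail_bound (t : R) : R :=
  (1 - expR (-1))^-1 * \sum_i c i * (t `^ (- a i) * (1 + l i * t)).

Lemma mix_exponent_inv_le t : 0 < t ->
  phi t^-1 <= \sum_i c i * (t `^ (- a i) * (1 + l i * t)).
Proof.
move=> t0; apply: ler_sum => i _; apply: ler_wpM2l => //.
apply: (@le_trans _ _ ((t^-1 + l i) `^ a i)); first by rewrite gerBl powR_ge0.
have lt0 : 0 <= l i * t by rewrite mulr_ge0// ltW.
have -> : t^-1 + l i = t^-1 * (1 + l i * t).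
  by rewrite mulrDr mulr1 mulrCA mulVf ?mulr1// gt_eqF.
rewrite powRM ?invr_ge0 ?(ltW t0)//; last by rewrite addr_ge0.
have -> : t^-1 `^ a i = t `^ (- a i) by rewrite -powR_inv1 ?ltW// -powRrM mulN1r.
apply: ler_wpM2l; first exact: powR_ge0.
rewrite ler1_powR ?lerDl//.
by have := eps_a i; have := eps_gt0; lra.
Qed.

Let e1_gt0 : 0 < 1 - expR (-1) :> R.
Proof. by rewrite subr_gt0 expR_lt1. Qed.

(** On the event [t < Y x] the variable [1 - exp (- Y x / t)] is at least [1 - exp (-1)], and its
    mean [1 - exp (- x phi (1 / t))] is at most [x phi (1 / t)]. *)
Lemma subord_heaviside_le x t : 0 <= x -> 0 < t -> 0 <= 1 - U x t <= x * tail_bound t.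
Proof.
move=> x0 t0; have ch := @causal_heaviside R.
have i1 := integrable_subord P Y0 mY x t ch.
have ie : P.-integrable setT (EFin \o (fun w => expR (- t^-1 * Y x w))).
  apply: eq_integrable (integrable_subord_exp P Y0 mY x (ltW (_ : 0 < t^-1))) => //.
    by move=> w _ /=; rewrite mul1r.
  by rewrite invr_gt0.
have i0' : P.-integrable setT (EFin \o (fun=> 1 : R)) by exact: finite_measure_integrable_cst.
have P1 : \int[P]_w (1 : R) = 1.
  have E : fine (P setT) = 1 by rewrite probability_setT.
  by rewrite Rintegral_cst// [X in _ * X]E mulr1.
have E : 1 - U x t = \int[P]_w (1 - cst 1 w * (if 0 <= t - Y x w then 1 else 0)).
  by rewrite RintegralB// P1.
have pos w : 0 <= 1 - cst 1 w * (if 0 <= t - Y x w then 1 else 0) :> R.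
  by rewrite mul1r; case: ifP; rewrite ?subrr ?subr0.
rewrite E; apply/andP; split; first by apply: Rintegral_ge0 => w _; exact: pos.
have i2 : P.-integrable setT (EFin \o (fun w => 1 - expR (- t^-1 * Y x w))).
  by apply: (@integrableB _ _ _ P _ _ (EFin \o (fun=> 1))
      (EFin \o (fun w => expR (- t^-1 * Y x w)))).
apply: (@le_trans _ _ (\int[P]_w ((1 - expR (-1))^-1 * (1 - expR (- t^-1 * Y x w))))).
  apply: le_Rintegral => //.
  - by apply: (@integrableB _ _ _ P _ _ (EFin \o (fun=> 1))
      (EFin \o (fun w => cst 1 w * (if 0 <= t - Y x w then 1 else 0)))).
  - exact: (@integrableZl _ _ _ P _ _ _ (EFin \o (fun w => 1 - expR (- t^-1 * Y x w)))).
  move=> w _; rewrite mul1r subr_ge0; have tY : 0 <= t^-1 * Y x w.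
    by rewrite mulr_ge0// invr_ge0 ltW.
  case: ifPn => [_|].
    rewrite subrr mulr_ge0 ?invr_ge0 ?(ltW e1_gt0)// subr_ge0 expR_le1.
    by rewrite mulNr oppr_le0.
  rewrite -ltNge => tw; rewrite subr0 ler_pdivlMl// mulr1 lerD2l lerN2 ler_expR.
  by rewrite mulNr lerN2 ler_pdivlMl// mulr1 ltW.
rewrite RintegralZl// RintegralB// P1 YL// ?invr_gt0// /tail_bound mulrCA.
apply: ler_wpM2l; first by rewrite invr_ge0 ltW.
apply: (@le_trans _ _ (x * phi t^-1)); last by rewrite ler_wpM2l// mix_exponent_inv_le.
by rewrite lerBlDr -lerBlDl; apply: le_trans (expR_ge1Dx _); rewrite mulNr.
Qed.

(** Each summand combines gamma kernels of orders [1 - a i] and [2 - a i]; the singularity at 0 is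
    integrable because [a i < 1]. *)
Lemma has_laplace_tail_bound s : 0 < s -> has_laplace tail_bound s.
Proof.
move=> s0; have a1 i : 0 < 1 - a i by exact: lt_le_trans eps_gt0 (eps_a i).
have s0' : 0 < s + 0 by rewrite addr0.
have h i : has_laplace (fun t => t `^ (- a i) * (1 + l i * t)) s.
  have a2 : 0 < 2 - a i by have := a1 i; lra.
  have [h1 _] := laplace_gker (a1 i) s0'; have [h2 _] := laplace_gker a2 s0'.
  have [h3 _] := laplaceZ (l i * Gamma (2 - a i)) h2.
  have [h4 _] := laplace_lin (Gamma (1 - a i)) h1 h3.
  apply: (eq_laplace _ h4).1 => t t0.
  rewrite /gker t0 oppr0 mul0r expR0 !mulr1.
  have g1 := Gamma_gt0 (a1 i); have g2 := Gamma_gt0 a2.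
  have -> : 2 - a i - 1 = 1 + - a i by ring.
  have -> : 1 - a i - 1 = - a i by ring.
  rewrite powRD ?powRr1 ?(ltW t0)//; last by rewrite (gt_eqF t0) implybT.
  by field; rewrite !gt_eqF.
have [hs _] := laplace_sum (index_enum I) c h.
exact: (laplaceZ _ hs).1.
Qed.

(** The difference quotients at [x = 1 / (n + 1)] are dominated by [tail_bound], so the limit may be
    taken in their transforms, which are difference quotients of [- exp (- x phi s) / s]. *)
Lemma laplace_boundary_density s : 1 < s ->
  has_laplace boundary_density s /\ laplace boundary_density s = phi s / s.
Proof.
move=> s1; have s0 : 0 < s by rewrite (lt_trans _ s1).
have ch := @causal_heaviside R.
have cU x : causal (U x) by exact: causal_subord.
pose f n (t : R) := expR (- s * t) * (n.+1%:R * (1 - U n.+1%:R^-1 t)).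
have [|||||h1 h2] := @Rintegral_dominated_cvg _ _ _ mu `]0, +oo[ f
  (fun t => expR (- s * t) * boundary_density t) (fun t => expR (- s * t) * tail_bound t).
- exact: measurable_itv.
- move=> n; apply: measurable_funTS; apply: measurable_funM; first exact: measurable_expRM.
  apply: measurable_funM => //; apply: measurable_funB => //.
  by case: (cU n.+1%:R^-1).
- move=> n t; rewrite /= in_itv/= andbT => t0.
  have nx : 0 <= n.+1%:R^-1 :> R by [].
  have /andP[u1 u2] := subord_heaviside_le nx t0.
  rewrite /f ger0_norm ?mulr_ge0 ?expR_ge0// ler_wpM2l ?expR_ge0//.
  by rewrite -ler_pdivlMl.
- move=> t; rewrite /= in_itv/= andbT => t0.
  have [g [g1 [g2 [[gU dg _ _] _ _]]]] := density_C1 t0.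
  have d0 := dg 0 (_ : -1 < 0).
  by rewrite (boundary_densityE t0 gU (d0 _))//; apply: cvgMr;
      apply: boundary_density_cvg gU (d0 _).
- exact: has_laplace_tail_bound.
split => //.
have E n : \int[mu]_(t in `]0, +oo[) f n t = n.+1%:R * (1 - expR (- n.+1%:R^-1 * phi s)) * s^-1.
  have [hh Eh] := laplace_heaviside s0.
  have hU := causal_laplace (cU n.+1%:R^-1) s1.
  have [k1 e1] := laplaceZ (- n.+1%:R) hU.
  have [k2 e2] := laplace_lin n.+1%:R hh k1.
  have EU t : 0 < t -> n.+1%:R * (if 0 <= t then 1 else 0) + - n.+1%:R * U n.+1%:R^-1 t =
      n.+1%:R * (1 - U n.+1%:R^-1 t) by move=> t0; rewrite (ltW t0); ring.
  have [_ e3] := eq_laplace EU k2.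
  rewrite -[LHS]/(laplace (fun t => n.+1%:R * (1 - U n.+1%:R^-1 t)) s) e3 e2 e1 Eh.
  by rewrite (laplace_subord Y0 mY YL)// Eh; ring.
have c1 : \int[mu]_(t in `]0, +oo[) f n t @[n --> \oo] --> phi s / s.
  under eq_cvg do rewrite E.
  apply: cvgMl.
  have h : is_derive (0 : R) 1 (fun x => - expR (x * - phi s)) (phi s).
    have h0 : is_derive (0 : R) 1 (fun x => x * - phi s) (- phi s).
      have -> : (fun x => x * - phi s) = (fun x => (- phi s) * x) by apply/funext => y; ring.
      by apply: (der_eq (derZ (- phi s) (der_id 0))); rewrite mulr1.
    by apply: (der_eq (derN (der_expR h0))); rewrite mul0r expR0; ring.
  apply: cvg_trans (derivative_sequence h); apply: near_eq_cvg; apply: nearW => n /=.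
  by rewrite mul0r expR0 opprK mulrN mulNr addrC.
exact: (cvg_unique _ h2 c1).
Qed.

Notation PW := (prodm mu P).

(** Cutting off at 0 yields a weight over the whole line, as mixtures require, that vanishes where
    the law of [Y x] is not prescribed. *)
Definition half_derivative (psi : R -> R) (x : R) : R := if 0 < x then derive1 psi x else 0.

Lemma half_derivative_le0 psi x : x <= 0 -> half_derivative psi x = 0.
Proof. by rewrite /half_derivative ltNge => ->. Qed.

Lemma half_derivativeE psi : half_derivative psi = derive1 psi \_ `]0, +oo[.
Proof.
by apply/funext => x; rewrite patchE /half_derivative mem_setE /= in_itv/= andbT.
Qed.

Lemma integrable_half_derivative psi : test_function psi ->
  mu.-integrable setT (EFin \o half_derivative psi).
Proof.
move=> hp.
have mD : measurable (`]0, +oo[%classic : set R) by exact: measurable_itv.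
have h : mu.-integrable `]0, +oo[ (EFin \o derive1 psi).
  have h1 := continuous_test_integrable (test_function_derive1 hp)
    (fun (x : R) _ => @cst_continuous R R (1 : R) x).
  by apply: eq_integrable h1 => // x _ /=; rewrite mul1r.
apply: eq_integrable ((@integrable_mkcond _ _ R mu _ _ mD).1 h) => // x _.
by rewrite /= half_derivativeE !patchE; case: ifPn.
Qed.

Lemma Rintegral_half_derivative psi (F : R -> R) :
  \int[mu]_x (half_derivative psi x * F x) = \int[mu]_(x in `]0, +oo[) (F x * derive1 psi x).
Proof.
rewrite [RHS]Rintegral_mkcond; apply: eq_Rintegral => x _.
by rewrite half_derivativeE !patchE; case: ifPn => _; rewrite ?mul0r// mulrC.
Qed.

Lemma half_derivative_lin k f g : test_function f -> test_function g ->
  half_derivative (fun x => k * f x + g x) =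
  (fun x => k * half_derivative f x + half_derivative g x).
Proof.
move=> hf hg; apply/funext => x; rewrite /half_derivative; case: ifPn; last first.
  by rewrite mulr0 addr0.
move=> _; have h := derD (derZ k (test_function_der x hf)) (test_function_der x hg).
exact: (der_derive1 h).2.
Qed.

(** By parts, [psi 0 + test_laplace psi s] is [phi s] times the integral of [exp (- x phi s) psi x],
    in accordance with the transform [phi s / s] times [exp (- x phi s)] of [H (x, .)]. *)
Definition test_laplace (psi : R -> R) (s : R) : R :=
  \int[mu]_(x in `]0, +oo[) (expR (- x * phi s) * derive1 psi x).

Lemma mixtureE psi s : \int[mu]_x (half_derivative psi x * expR (- x * phi s)) =
  test_laplace psi s.
Proof. exact: (Rintegral_half_derivative psi (fun x => expR (- x * phi s))). Qed.

Lemma test_laplace_derive1 psi s : test_function psi ->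
  phi s * test_laplace psi s = derive1 psi 0 + test_laplace (derive1 psi) s.
Proof.
move=> hp; pose u (x : R) := expR (- x * phi s).
have du (x : R) : -1 < x -> is_derive x 1 u (- phi s * u x).
  move=> _; have h : is_derive x 1 (fun x => - x * phi s) (- phi s).
    have -> : (fun x => - x * phi s) = (fun x => (- phi s) * x) by apply/funext => y; ring.
    by apply: (der_eq (derZ (- phi s) (der_id x))); rewrite mulr1.
  exact: (der_eq (der_expR h)).
have cu (x : R) : -1 < x -> {for x, continuous (fun x : R => - phi s * u x)}.
  by move=> x1; apply: cvgMr; exact: der_continuous (du x x1).
have hp' := test_function_derive1 hp.
have := test_integration_by_parts hp' du cu.
have -> : \int[mu]_(x in `]0, +oo[) (- phi s * u x * derive1 psi x) =
    - phi s * test_laplace psi s.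
  rewrite -RintegralZl//; first by apply: eq_Rintegral => x _; rewrite mulrA.
  apply: continuous_test_integrable => // x x1; exact: der_continuous (du x x1).
rewrite {1}/u oppr0 mul0r expR0 mul1r -/(test_laplace (derive1 psi) s) => E.
by rewrite -[LHS]opprK -mulNr E; ring.
Qed.

Lemma laplace_regular_density psi s : test_function psi -> 0 < s ->
  has_laplace (fun t => regular (H ^~ t) psi) s /\
  laplace (fun t => regular (H ^~ t) psi) s = (psi 0 + test_laplace psi s) / s.
Proof.
move=> hp s0; have [hh Eh] := laplace_heaviside s0.
have ch := @causal_heaviside R; have [mh h0 _ _] := ch.
have iq := integrable_half_derivative hp.
have [h1 E1 _] := laplace_mixture Y0 mY YL iq (half_derivative_le0 psi) mh h0 hh s0.
have [h2 E2] := laplace_lin (psi 0) hh h1.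
have [|h3 E3] := @eq_laplace _ _ (fun t => regular (H ^~ t) psi) s _ h2.
  move=> t t0; rewrite regular_density// (mixture_subord P Y0 mY iq)//.
  by rewrite Rintegral_half_derivative (ltW t0) mulr1.
split => //; rewrite E3 E2 E1 Eh mixtureE; ring.
Qed.

(** * Existence of the shifted fractional derivative *)

Section fractional_derivative.
Variables (nu lam : R).
Hypothesis nu1 : 0 < nu < 1.
Hypothesis lam0 : 0 <= lam.

Definition rl_kernel := gker (1 - nu) lam.
Definition rl_primitive := conv mu rl_kernel (fun y : R => `|y|) heaviside.
(* Its Laplace transform is [(s + lam) ^ nu / s]. *)
Definition rl_symbol (t : R) : R :=
  lam * rl_primitive t + rl_kernel t.

Notation w := rl_kernel.
Notation wbar := rl_primitive.
Notation k := rl_symbol.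

Let nu0 : 0 < 1 - nu. Proof. by rewrite subr_gt0; case/andP: nu1. Qed.

Let mheaviside : measurable_fun setT (heaviside : R -> R).
Proof. by have [] := @causal_heaviside R. Qed.

Let mw : measurable_fun setT w. Proof. exact: measurable_gker. Qed.

Let mwbar : measurable_fun setT wbar.
Proof. by apply: measurable_conv => //; exact: normr_measurable. Qed.

Let mk : measurable_fun setT k.
Proof. by apply: measurable_funD => //; apply: measurable_funM. Qed.

Let wbar_ge0 t : 0 <= wbar t.
Proof.
apply: Rintegral_ge0 => y _; apply: mulr_ge0; first exact: gker_ge0.
by case: ifP.
Qed.

Let k_ge0 t : 0 <= k t.
Proof. by apply: addr_ge0; [exact: mulr_ge0|exact: gker_ge0]. Qed.

Let w_lt0 t : t < 0 -> w t = 0.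
Proof. by move=> t0; rewrite /w /gker ltNge ltW. Qed.

Let wbar_lt0 t : t < 0 -> wbar t = 0.
Proof.
move=> t0; rewrite /wbar /conv (@eq_Rintegral _ _ _ _ _ (cst 0)) ?Rintegral_cst ?mul0r//.
move=> y _; rewrite subr_ge0 leNgt (lt_le_trans t0)//= mulr0//.
Qed.

Let k_lt0 t : t < 0 -> k t = 0.
Proof. by move=> t0; rewrite /k w_lt0// wbar_lt0// mulr0 addr0. Qed.

Let laplace_w s : 0 < s -> has_laplace w s /\ laplace w s = (s + lam) `^ (nu - 1).
Proof.
move=> s0; have sl : 0 < s + lam by rewrite ltr_pwDl.
by have [h ->] := laplace_gker nu0 sl; rewrite opprB.
Qed.

Let laplace_wbar s : 0 < s -> has_laplace wbar s /\
  laplace wbar s = (s + lam) `^ (nu - 1) / s.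
Proof.
move=> s0; have sl : 0 < s + lam by rewrite ltr_pwDl.
have [hh Eh] := laplace_heaviside s0; have [iE vE] := gker_exp nu0 sl.
have [_ h0 _ _] := @causal_heaviside R.
have mN : measurable_fun setT (fun y : R => `|y|) by exact: normr_measurable.
have [h1 E1 _] := @laplace_conv R _ _ mu _ _ _ _ mw mN mheaviside (fun y => normr_ge0 y)
    h0 iE hh.
by split => //; rewrite E1 vE Eh opprB.
Qed.

Let laplace_k s : 0 < s -> has_laplace k s /\
  laplace k s = lam * ((s + lam) `^ (nu - 1) / s) + (s + lam) `^ (nu - 1).
Proof.
move=> s0; have [h1 E1] := laplace_w s0; have [h2 E2] := laplace_wbar s0.
by have [h3 E3] := laplace_lin lam h2 h1; split => //; rewrite E3 E1 E2.
Qed.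

(** Up to a factor, these countably many weights majorize the derivatives of all test functions on
    [x > 0], so one null set of times can serve every test function. *)
Definition box (n : nat) (x : R) : R := if (0 < x) && (x <= n%:R) then 1 else 0.

Let mbox n : measurable_fun setT (box n).
Proof.
apply: measurable_fun_ifT => //; apply: measurable_and;
    apply: measurable_fun_ltr => // || apply: measurable_fun_ler => //.
Qed.

(* The times [t] at which the candidate derivative is given by a convergent
   integral, whatever the test function; they have full measure. *)
Definition good : set R := [set t | forall n,
  PW.-integrable setT (fun p => (box n p.1 * k (t - Y p.1 p.2))%:E)].

Let mker (q : R -> R) : measurable_fun setT q ->
  measurable_fun setT (fun p : R * (R * Om) => q p.2.1 * k (p.1 - Y p.2.1 p.2.2)).
Proof.
move=> mq.
have m21 : measurable_fun setT (fun p : R * (R * Om) => p.2.1).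
  exact: (measurableT_comp measurable_fst measurable_snd).
apply: measurable_funM; first exact: (measurableT_comp mq m21).
apply: (measurableT_comp mk); apply: measurable_funB; first exact: measurable_fst.
exact: (measurableT_comp mY measurable_snd).
Qed.

Let measurable_good : measurable good.
Proof.
rewrite (_ : good = \bigcap_n [set t |
    PW.-integrable setT (fun p => (box n p.1 * k (t - Y p.1 p.2))%:E)]); last first.
  by apply/seteqP; split => t /= h n; [move=> _; exact: h|exact: h].
apply: bigcapT_measurable => n.
exact: (measurable_integrable_sections PW (mker (mbox n))).
Qed.

Let box_le0 n x : x <= 0 -> box n x = 0.
Proof. by rewrite /box ltNge => ->. Qed.

Let integrable_box n : mu.-integrable setT (EFin \o box n).
Proof.
apply: eq_integrable (integrable_indic_itv 0 n%:R false false) => // x _.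
by rewrite /= indicE mem_setE /= in_itv/= /box; case: ifP.
Qed.

Let good_ae : {ae mu, forall t, good t}.
Proof.
apply: ae_foralln => n; have [h1 _] := laplace_k ltr01.
by have [] := laplace_mixture Y0 mY YL (integrable_box n) (@box_le0 n) mk k_lt0 h1 ltr01.
Qed.

Let half_box psi b M : (forall x, b < `|x| -> psi x = 0) ->
  (forall x, `|derive1 psi x| <= M) -> forall x,
  `|half_derivative psi x| <= M * box (Num.truncn `|b|).+1 x.
Proof.
move=> hb hM x; rewrite /half_derivative /box; have [x0|x0] := ltP 0 x; last first.
  by rewrite normr0 mulr0.
have [xn|xn] := leP x (Num.truncn `|b|).+1%:R; first by rewrite mulr1.
rewrite (derive1_supported hb) ?normr0 ?mulr0// (gtr0_norm x0).
by apply: lt_trans xn; apply: le_lt_trans (ler_norm b) (truncnS_gt _).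
Qed.

Definition mixture (q : R -> R) (t : R) : R :=
  conv PW (fun p => q p.1) (fun p => Y p.1 p.2) k t.

Let mixture_bound psi t b M : good t -> test_function psi ->
  (forall x, b < `|x| -> psi x = 0) -> (forall x, `|derive1 psi x| <= M) ->
  PW.-integrable setT (fun p => (half_derivative psi p.1 * k (t - Y p.1 p.2))%:E) /\
  `|mixture (half_derivative psi) t| <= M * mixture (box (Num.truncn `|b|).+1) t.
Proof.
move=> gt hp hb hM; set n := (Num.truncn `|b|).+1.
have gn : PW.-integrable setT (fun p => (box n p.1 * k (t - Y p.1 p.2))%:E) by exact: gt.
have mq : measurable_fun setT (half_derivative psi).
  by case/integrableP: (integrable_half_derivative hp) => /measurable_EFinP.
have mf : measurable_fun setT (fun p : R * Om => half_derivative psi p.1 * k (t - Y p.1 p.2)).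
  exact: (measurableT_comp (mker mq) (pair1_measurable t)).
have ib := @integrableZl _ _ _ PW _ measurableT M _ gn.
have bd p : `|half_derivative psi p.1 * k (t - Y p.1 p.2)| <= M * (box n p.1 * k (t - Y p.1
    p.2)).
  by rewrite normrM (ger0_norm (k_ge0 _)) mulrA ler_wpM2r//; exact: half_box.
have i1 := le_Rintegrable PW _ measurableT mf (fun p _ => bd p) ib.
split; first exact: i1.
rewrite /mixture /conv -(@RintegralZl _ _ _ PW _ _ M measurableT gn).
apply: (le_trans (le_normr_Rintegral measurableT i1)).
apply: (le_Rintegral measurableT (integrable_abse i1) ib) => p _.
exact: bd.
Qed.

Let mixture_lin t r f g : good t -> test_function f -> test_function g ->
  mixture (half_derivative (fun x => r * f x + g x)) t =
  r * mixture (half_derivative f) t + mixture (half_derivative g) t.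
Proof.
move=> gt hf hg; rewrite half_derivative_lin//.
have int psi : test_function psi ->
    PW.-integrable setT (fun p => (half_derivative psi p.1 * k (t - Y p.1 p.2))%:E).
  move=> hp; have [_ [b hb]] := hp.
  have [M _ hM] := test_function_bounded (test_function_derive1 hp).
  exact: (mixture_bound gt hp hb hM).1.
have i1 := @integrableZl _ _ _ PW _ measurableT r _ (int f hf).
rewrite /mixture /conv -(@RintegralZl _ _ _ PW _ _ r measurableT (int f hf)).
rewrite -(@RintegralD _ _ _ PW _ _ _ measurableT i1 (int g hg)).
by apply: eq_Rintegral => p _; rewrite mulrDl mulrA.
Qed.

(** The prescribed transform is [(s + lam) ^ nu (psi 0 + test_laplace psi s) / s - (s + lam) ^ (nu -
    1) psi 0]. The coefficient of [psi 0] simplifies to [lam (s + lam) ^ (nu - 1) / s], the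
    transform of [lam] times [rl_primitive]; that of [test_laplace] is the transform of [rl_symbol].
    Dropping the second term outside [good] keeps a distribution at every [t]. *)
Definition rl_derivative (t : R) : gfun R := fun psi =>
  lam * wbar t * psi 0 + (if t \in good then mixture (half_derivative psi) t else 0).

Let rl_derivative_distribution t : is_distribution (rl_derivative t).
Proof.
split.
  move=> r f g hf hg; rewrite /rl_derivative; have [|_] := boolP (t \in good).
    move=> /set_mem gt; rewrite (mixture_lin r gt hf hg) /=.
    move: (mixture _ t) (mixture _ t) (wbar t) => x y z; ring.
  by move: (wbar t) => z; ring.
(* Order 1 suffices, since [psi] enters through [psi 0] and its first derivative. *)
move=> b; exists 1%N.
exists (lam * wbar t + mixture (box (Num.truncn `|b|).+1) t).
move=> f M hf hb hM; have hM0 x : `|f x| <= M by exact: (hM 0%N).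
have hM1 x : `|derive1 f x| <= M by exact: (hM 1%N).
have M0 : 0 <= M by apply: le_trans (hM0 0).
have c0 : 0 <= mixture (box (Num.truncn `|b|).+1) t.
  by apply: Rintegral_ge0 => p _; rewrite mulr_ge0// /box; case: ifP.
have z0 : 0 <= lam * wbar t by rewrite mulr_ge0.
rewrite /rl_derivative mulrDl; apply: (le_trans (ler_normD _ _)); apply: lerD.
  by rewrite normrM (ger0_norm z0) ler_wpM2l.
have [/set_mem gt|_] := boolP (t \in good); last by rewrite normr0 mulr_ge0.
by rewrite [X in _ <= X]mulrC; exact: (mixture_bound gt hf hb hM1).2.
Qed.

Lemma shifted_RL_derivative_density :
  exists D, shifted_RL_derivative lam nu (fun t => regular (H ^~ t)) (@delta R) D.
Proof.
exists rl_derivative; split; first by move=> t _; exact: rl_derivative_distribution.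
move=> psi hp s s0; have [hr Er] := laplace_regular_density hp s0.
have iq := integrable_half_derivative hp.
have [hk Ek] := laplace_k s0; have [hw Ew] := laplace_wbar s0.
have [h1 E1 _] := laplace_mixture Y0 mY YL iq (half_derivative_le0 psi) mk k_lt0 hk s0.
have [h2 E2] := laplaceZ (lam * psi 0) hw.
have [h3 E3] := laplace_lin 1 h2 h1.
have mq : measurable_fun setT (half_derivative psi).
  by case/integrableP: iq => /measurable_EFinP.
have mc : measurable_fun setT (mixture (half_derivative psi)).
  apply: measurable_conv => //; exact: (measurableT_comp mq measurable_fst).
have [||h4 E4] := @laplace_ae_eq _ _ (fun t => rl_derivative t psi) s _ _ h3.
- apply: measurable_funD; first by apply: measurable_funM => //; apply: measurable_funM.
  apply: measurable_fun_if => //.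
  + by apply: (measurable_fun_bool true); rewrite setTI preimage_mem_true;
      exact: measurable_good.
  + exact: measurable_funTS.
- apply: (@filterS _ _ (ae_filter_ringOfSetsType mu)) good_ae => t gt _.
  rewrite /rl_derivative mem_set//.
  rewrite -/(mixture (half_derivative psi) t).
  by move: (mixture _ t) (wbar t) => x z; ring.
split => //; rewrite E4 E3 E2 E1 Er Ek Ew mixtureE /delta (addrC lam s).
have sl : 0 < s + lam by rewrite ltr_pwDl.
case/andP: nu1 => nu00 _; rewrite -[(s + lam) `^ nu](mulr_powRB1 (ltW sl) nu00).
by field; rewrite gt_eqF.
Qed.

End fractional_derivative.

(** In transforms the gamma kernel cancels the initial-value term of [D i], so the [i]-th summand
    becomes [- ((s + l i) ^ a i - l i ^ a i)] times the transform of [H] tested on [psi]. The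
    weighted sum is [- phi s] times that transform, and [test_laplace_derive1] brings the left side
    to the same form. *)
Lemma density_equation (D : I -> R -> gfun R) psi :
  (forall i, shifted_RL_derivative (l i) (a i) (fun t => regular (H ^~ t)) (@delta R) (D i)) ->
  test_function psi ->
  {ae mu, forall t, 0 < t -> regular (derive1 (H ^~ t)) psi =
    \sum_i c i * (l i `^ a i * regular (H ^~ t) psi - D i t psi
                  - psi 0 * gker (1 - a i) (l i) t)}.
Proof.
move=> hD hp; have hp' := test_function_derive1 hp.
pose F i t := l i `^ a i * regular (H ^~ t) psi - D i t psi - psi 0 * gker (1 - a i) (l i) t.
pose L t := - (boundary_density t * psi 0) - regular (H ^~ t) (derive1 psi).
suff : {ae mu, forall t, 0 < t -> L t - \sum_i c i * F i t = 0}.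
  apply: (@filterS _ _ (ae_filter_ringOfSetsType mu)) => t h t0.
  by apply/eqP; rewrite -subr_eq0 regular_derive1_density//; apply/eqP; exact: h.
have H1 s : 1 < s -> has_laplace (fun t => L t - \sum_i c i * F i t) s /\
    laplace (fun t => L t - \sum_i c i * F i t) s = 0.
  move=> s1; have s0 : 0 < s by rewrite (lt_trans _ s1).
  have [hr Er] := laplace_regular_density hp s0.
  have [hr' Er'] := laplace_regular_density hp' s0.
  have [hb Eb] := laplace_boundary_density s1.
  have hF i : has_laplace (F i) s /\ laplace (F i) s =
      - ((s + l i) `^ a i - l i `^ a i) * ((psi 0 + test_laplace psi s) / s).
    have [_ /(_ psi hp s s0)[_ hd Ed]] := hD i.
    have a1 : 0 < 1 - a i by exact: lt_le_trans eps_gt0 (eps_a i).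
    have sl : 0 < s + l i by rewrite ltr_pwDl.
    have [hg Eg] := laplace_gker a1 sl.
    have [k1 e1] := laplaceZ (- psi 0) hg.
    have [k2 e2] := laplace_lin (-1) hd k1.
    have [k3 e3] := laplace_lin (l i `^ a i) hr k2.
    have [|k4 e4] := @eq_laplace _ _ (F i) s _ k3; first by move=> t _; rewrite /F; ring.
    by split => //; rewrite e4 e3 e2 e1 Ed Eg Er /delta opprB (addrC (l i) s); ring.
  have [hS ES] := laplace_sum (index_enum I) c (fun i => (hF i).1).
  have [k1 e1] := laplace_lin (-1) hr' hS.
  have [k1' e1'] := laplaceZ (-1) hS.
  have [k2 e2] := laplace_lin (-1) hr' k1'.
  have [k3 e3] := laplace_lin (- psi 0) hb k2.
  have [|k4 e4] := @eq_laplace _ _ (fun t => L t - \sum_i c i * F i t) s _ k3.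
    by move=> t _; rewrite /L; ring.
  split => //; rewrite e4 e3 e2 e1' ES Er' Eb.
  have -> : \sum_i c i * laplace (F i) s = - phi s * ((psi 0 + test_laplace psi s) / s).
    rewrite /mix_exponent -sumrN mulr_suml; apply: eq_bigr => i _.
    by rewrite (hF i).2; ring.
  have Eq := test_laplace_derive1 s hp.
  rewrite -Eq; move: (test_laplace psi s) (phi s) => x y; ring.
apply: (@laplace_unique0 _ _ 1) => s s1; first exact: (H1 s s1).1.
exact: (H1 s s1).2.
Qed.

End half_line_equation.

(** * The mixture tempered stable case *)

Section exponents.
Context {R : realType}.

(** With [p = 1] and [q = r] the Gamma factor of the rising factorial cancels the denominator,
    leaving the exponential series over [Gamma r]. *)
Lemma mittag_leffler_exp (r z : R) : 0 < r -> mittag_leffler r 1 r z = expR z / Gamma r.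
Proof.
move=> r0; rewrite /mittag_leffler mulrC /expR.
have E : series (fun n : nat => rising r n / Gamma (1 * n%:R + r) * (z ^+ n / n`!%:R)) =
    (fun n => (Gamma r)^-1 * series (exp_coeff z) n).
  apply/funext => n; rewrite /series/= mulr_sumr; apply: eq_bigr => i _.
  have g0 : Gamma (r + i%:R) != 0 by rewrite gt_eqF// Gamma_gt0// ltr_wpDr.
  rewrite /rising mul1r (addrC i%:R) /exp_coeff/=.
  by move: (Gamma (r + i%:R)) g0 (Gamma r) => g g0 h; rewrite (mulrAC g) divff// mul1r.
rewrite E; apply: cvg_lim => //; apply: cvgMr.
exact: is_cvg_series_exp_coeff.
Qed.

Lemma tempered_power_gt0 (a l s : R) : 0 < a -> 0 < l -> 0 < s ->
  0 < (s + l) `^ a - l `^ a.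
Proof.
move=> a0 l0 s0; rewrite subr_gt0 gt0_ltr_powR// ?nnegrE ?ltW ?addr_gt0//.
by rewrite ltrDr.
Qed.

Lemma tempered_power_unbounded (a l : R) : 0 < a -> 0 < l ->
  forall K, exists2 s, 0 < s & K < (s + l) `^ a - l `^ a.
Proof.
move=> a0 l0 K; pose b := `|K| + l `^ a + 1.
have b0 : 0 < b by rewrite ltr_pwDr// addr_ge0// powR_ge0.
exists (b `^ a^-1); first exact: powR_gt0.
rewrite ltrBrDr; apply: (@lt_le_trans _ _ ((b `^ a^-1) `^ a)).
  rewrite -powRrM mulVf ?gt_eqF// powRr1 ?ltW// /b.
  by rewrite (@le_lt_trans _ _ (`|K| + l `^ a)) ?ltrDl// lerD2r ler_norm.
by apply: ge0_ler_powR; rewrite ?nnegrE ?powR_ge0 ?addr_ge0 ?powR_ge0 ?ltW// ltrDl.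
Qed.

Section mtss.
Variables (a1 l1 a2 l2 c1 c2 : R).
Hypotheses (a10 : 0 < a1) (a20 : 0 < a2) (l10 : 0 < l1) (l20 : 0 < l2).
Hypotheses (c10 : 0 <= c1) (c20 : 0 <= c2) (c12 : c1 + c2 = 1).

Lemma mtss_exponent_gt0 s : 0 < s -> 0 < mtss_exponent a1 l1 a2 l2 c1 c2 s.
Proof.
move=> s0; have h1 := tempered_power_gt0 a10 l10 s0.
have h2 := tempered_power_gt0 a20 l20 s0.
move: c10; rewrite le_eqVlt => /predU1P[c1E|c1p].
  by rewrite /mtss_exponent -c1E mul0r add0r (_ : c2 = 1) ?mul1r// -c12 -c1E add0r.
by rewrite /mtss_exponent ltr_pwDl ?mulr_gt0// mulr_ge0// ltW.
Qed.

Lemma mtss_exponent_unbounded K :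
  exists2 s, 0 < s & K < mtss_exponent a1 l1 a2 l2 c1 c2 s.
Proof.
move: c10; rewrite le_eqVlt => /predU1P[c1E|c1p].
  have [s s0 Ks] := tempered_power_unbounded a20 l20 K; exists s => //.
  by rewrite /mtss_exponent -c1E mul0r add0r (_ : c2 = 1) ?mul1r// -c12 -c1E add0r.
have [s s0 Ks] := tempered_power_unbounded a10 l10 (K / c1); exists s => //.
apply: (@lt_le_trans _ _ (c1 * ((s + l1) `^ a1 - l1 `^ a1))).
  by rewrite mulrC -ltr_pdivrMr.
by rewrite /mtss_exponent lerDl mulr_ge0// ltW// tempered_power_gt0.
Qed.

End mtss.

End exponents.

Theorem proposition3p6 (R : realType) (d : measure_display)
  (T : measurableType d) (P : probability T R)
  (a1 a2 l1 l2 c1 c2 : R)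
  (ha1 : 0 < a1 < 1) (ha2 : 0 < a2 < 1) (hl1 : 0 < l1) (hl2 : 0 < l2)
  (hc1 : 0 <= c1) (hc2 : 0 <= c2) (hc : c1 + c2 = 1)
  (S : R -> {RV P >-> R}) (hS : MTSS a1 l1 a2 l2 c1 c2 S)
  (H : R -> R -> R) (hH : density_family P (inverse_process S) H) :
  [/\ (* d/dx H exists on x > 0, and is a generalized function there *)
      forall t, 0 < t ->
        (forall x, 0 < x -> derivable (H ^~ t) x 1) /\
        locally_integrable_half_line (derive1 (H ^~ t)),
      (* both fractional derivatives exist *)
      (exists D1, shifted_RL_derivative l1 a1
         (fun t => regular (H ^~ t)) (@delta R) D1) /\
      (exists D2, shifted_RL_derivative l2 a2
         (fun t => regular (H ^~ t)) (@delta R) D2),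
      (* the equation *)
      forall D1 D2 : R -> gfun R,
        shifted_RL_derivative l1 a1
          (fun t => regular (H ^~ t)) (@delta R) D1 ->
        shifted_RL_derivative l2 a2
          (fun t => regular (H ^~ t)) (@delta R) D2 ->
        forall psi : R -> R, test_function psi ->
        {ae @lebesgue_measure R, forall t, 0 < t ->
          regular (derive1 (H ^~ t)) psi =
            - c1 * D1 t psi - c2 * D2 t psi
            + c1 * l1 `^ a1 * regular (H ^~ t) psi
            + c2 * l2 `^ a2 * regular (H ^~ t) psi
            - c1 * t `^ (- a1)
              * mittag_leffler (1 - a1) 1 (1 - a1) (- l1 * t) * delta psi
            - c2 * t `^ (- a2)
              * mittag_leffler (1 - a2) 1 (1 - a2) (- l2 * t) * delta psi} &
      (* H(x, 0) = delta(x) *)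
      forall A : set R, measurable A ->
        P (inverse_process S 0 @^-1` A) = \d_(0 : R)%R A].
Proof.
have /andP[a10 a11] := ha1; have /andP[a20 a21] := ha2; have [sS SL] := hS.
have phi1 := mtss_exponent_gt0 a10 a20 hl1 hl2 hc1 hc2 hc ltr01.
(* A third component of weight zero and without tempering provides the factor
   [1 / s] of the Laplace transforms. *)
pose l (i : 'I_3) := nth 0 [:: l1; l2; 0] i.
pose c (i : 'I_3) := nth 0 [:: c1; c2; 0] i.
(* Repeating [a1] for the weightless component leaves the minimum [eps] of the [1 - a i]
   unchanged. *)
pose a (i : 'I_3) := nth 0 [:: a1; a2; a1] i.
pose eps := Num.min (1 - a1) (1 - a2).
have l_ge0 i : 0 <= l i by case: i => [[|[|[|]]]]//= *; rewrite /l/= ltW.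
have c_ge0 i : 0 <= c i by case: i => [[|[|[|]]]].
have a_gt0 i : 0 < a i by case: i => [[|[|[|]]]].
have l_i0 : l ord_max = 0 by [].
have eps_gt0 : 0 < eps by rewrite /eps lt_min !subr_gt0 a11.
have eps_le1 : eps <= 1 by rewrite /eps ge_min gerBl ltW.
have eps_a i : eps <= 1 - a i.
  by case: i => [[|[|[|]]]]//= ?; rewrite /a/= /eps ge_min lexx ?orbT.
have phiE s : mix_exponent l a c s = mtss_exponent a1 l1 a2 l2 c1 c2 s.
  by rewrite /mix_exponent !big_ord_recl big_ord0 /c/= mul0r !addr0.
have YL x s : 0 <= x -> 0 < s ->
    \int[P]_w expR (- s * clip S x w) = expR (- x * mix_exponent l a c s).
  by move=> x0 s0; rewrite (clip_laplace sS SL)// phiE.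
have Y0 x w := clip_ge0 S x w; have mY := measurable_clip sS.
have cH x t : 0 < x -> 0 < t -> {for x, continuous (H ^~ t)} by exact: (dens_cont hH).
have iH t : 0 < t -> lebesgue_measure.-integrable `]0, +oo[ (EFin \o H ^~ t).
  exact: (density_integrable hH).
have UH := density_cdf sS SL phi1 hH.
have existsD nu lam := @shifted_RL_derivative_density R d T P (clip S) _ l a c ord_max eps H
  l_ge0 l_i0 a_gt0 eps_gt0 eps_le1 eps_a Y0 mY YL cH iH UH nu lam.
split.
- exact: (derivable_density l_ge0 l_i0 a_gt0 eps_gt0 eps_le1 eps_a Y0 mY YL cH iH UH).
- by split; apply: existsD => //; exact: ltW.
(* The general equation runs over all three components, so the weightless one also receives a
   fractional derivative, with shift 0. *)
- move=> D1 D2 hD1 hD2 psi hp; have [D3 hD3] := existsD a1 0 ha1 (lexx 0).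
  pose D (i : 'I_3) := nth D1 [:: D1; D2; D3] i.
  have hD i : shifted_RL_derivative (l i) (a i) (fun t => regular (H ^~ t)) (@delta R) (D i).
    by case: i => [[|[|[|]]]].
  have := density_equation l_ge0 l_i0 a_gt0 c_ge0 eps_gt0 eps_le1 eps_a Y0 mY YL cH iH UH hD hp.
  apply: (@filterS _ _ (ae_filter_ringOfSetsType lebesgue_measure)) => t E t0.
  rewrite E// !big_ord_recl big_ord0 /c /l /a /D/= mul0r !addr0.
  rewrite !mittag_leffler_exp ?subr_gt0// /gker t0 /delta.
  have sub1 b : 1 - b - 1 = - b :> R by ring.
  by rewrite !sub1; ring.
- exact: (inverse0 sS SL (mtss_exponent_unbounded a10 a20 hl1 hl2 hc1 hc2 hc)).
Qed.
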